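(* Let $(M^7,g_M)$ be a 3-Sasakian 7-manifold and let $\mathcal{F}_{+1}\ni\varphi^{np}$ and $\mathcal{F}_{-1}\ni\varphi^{ts}$ be the families of coclosed $\mathrm{G}_2$-structures on $M$, with their nearly parallel elements (unique up to scale), defined in the context. Both nearly parallel $\mathrm{G}_2$-structures $\varphi^{np}$ and $\varphi^{ts}$ are unstable sources within their families under the rescaled Laplacian flow, so coclosed $\mathrm{G}_2$-structures in these families which are not nearly parallel cannot flow to either of them.
   Context: 3-Sasakian setting. A complete Riemannian 7-manifold $(M^7,g_M)$ is 3-Sasakian if it has an orthonormal triple of Killing fields $E_1,E_2,E_3$ with $[E_i,E_j]=2E_k$ for cyclic permutations $(i,j,k)$ of $(1,2,3)$, each $E_i$ defining a Sasakian structure. Then there is a locally free $\mathrm{SU}(2)$-action on $M$ with leaf space a 4-dimensional orbifold $N$ carrying an anti-self-dual Einstein metric $g_N$ of scalar curvature 48, and an orbifold Riemannian submersion $\pi:M\to N$. Let $\eta_1,\eta_2,\eta_3$ be the 1-forms dual to $E_1,E_2,E_3$, so $g_M=\eta_1^2+\eta_2^2+\eta_3^2+\pi^*g_N$. There are 2-forms $\omega_1,\omega_2,\omega_3$ on $M$, pullbacks of orthogonal self-dual 2-forms on $N$, with $\omega_i\wedge\omega_j=2\delta_{ij}\pi^*\mathrm{vol}_N$, $d\eta_i=-2\eta_j\wedge\eta_k-2\omega_i$ and $d\omega_i=-2\eta_j\wedge\omega_k+2\eta_k\wedge\omega_j$ for cyclic $(i,j,k)$. Families. For $\epsilon\in\{\pm1\}$,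 $\mathcal{F}_\epsilon$ consists of the $\mathrm{G}_2$-structures given, for constants $a,b,c>0$, by the 3-form $$\varphi_\epsilon=\epsilon a^2b\,\eta_1\wedge\eta_2\wedge\eta_3-ac^2(\eta_1\wedge\omega_1+\eta_2\wedge\omega_2)-\epsilon bc^2\,\eta_3\wedge\omega_3,$$ with induced metric $a^2(\eta_1^2+\eta_2^2)+b^2\eta_3^2+c^2\pi^*g_N$, volume form $\epsilon a^2bc^4\eta_1\wedge\eta_2\wedge\eta_3\wedge\pi^*\mathrm{vol}_N$ and closed dual 4-form $\psi_\epsilon=c^4\pi^*\mathrm{vol}_N-\epsilon abc^2(\eta_2\wedge\eta_3\wedge\omega_1+\eta_3\wedge\eta_1\wedge\omega_2)-a^2c^2\,\eta_1\wedge\eta_2\wedge\omega_3$ (so $\varphi_\epsilon$ is coclosed). A $\mathrm{G}_2$-structure $\varphi$ with dual $\psi$ is nearly parallel if $d\varphi=\lambda\psi$ for a non-zero constant $\lambda$. $\varphi^{np}$ denotes the element of $\mathcal{F}_{+1}$ with $a=b=1/\sqrt5$, $c=1$; $\varphi^{ts}$ denotes the element of $\mathcal{F}_{-1}$ with $a=b=c=1$. Flow. The Laplacian flow is $\frac{\partial}{\partial t}\varphi=\Delta_\varphi\varphi=(dd^*_\varphi+d^*_\varphi d)\varphi$, with the Hodge Laplacian of the metric and orientation induced by $\varphi$. It preserves each $\mathcal{F}_\epsilon$, so within $\mathcal{F}_\epsilon$ it is a flow of positive functions $a(t),b(t),c(t)$. The rescaled flow is the evolution of the scale-invariant quantities $X=a^2/c^2$,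 $Y=ab/c^2$ as functions of $s$, where $\frac{ds}{dt}=\frac1{c^2}$; it is an autonomous planar ODE system on $\{X,Y>0\}$, and $\varphi^{np}$, $\varphi^{ts}$ correspond to the critical points $X=Y=1/5$ ($\epsilon=1$) and $X=Y=1$ ($\epsilon=-1$). A critical point is a source if it is asymptotically stable for the time-reversed system (in particular it is unstable). A $\mathrm{G}_2$-structure in $\mathcal{F}_\epsilon$ ''flows to'' a critical point if the rescaled flow $(X(s),Y(s))$ starting at it converges to the critical point. *)

(* Defs.v *)
From HB Require Import structures.
From mathcomp Require Import all_boot all_order all_algebra.
From mathcomp Require Import fingroup perm.
From mathcomp Require Import all_classical all_reals all_analysis.

Set Implicit Arguments.
Unset Strict Implicit.
Unset Printing Implicit Defensive.

Import Order.TTheory GRing.Theory Num.Theory.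
Import numFieldNormedType.Exports.

Local Open Scope classical_set_scope.
Local Open Scope ring_scope.

(* Fields on an open subset U of R^7 are total functions, meaningful on U only;
   points and vectors are row vectors. *)

Section LocalCalculus.
Variable R : realType.
Local Notation V := 'rV[R]_7.

Definition iterD (W : normedModType R) (f : V -> W) (s : seq V) : V -> W :=
  foldr (fun v (h : V -> W) => fun x => 'D_v h x) f s.

(* C^oo: all iterated directional derivatives exist and are (Frechet)
   differentiable, hence continuous. *)
Definition smooth_on (U : set V) (W : normedModType R) (f : V -> W) :=
  forall (s : seq V) (x : V), U x -> differentiable (iterD f s) x.

(* The k arguments of a k-form are the rows of a k x 7 matrix. *)
Definition form (k : nat) := V -> 'M[R]_(k, 7) -> R.

(* Normalized so that (a /\ b)(u, v) = a(u) b(v) - a(v) b(u) for 1-forms. *)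
Definition wedge k l (al : form k) (be : form l) : form (k + l) :=
  fun x v => (k`! * l`!)%:R^-1 *
    \sum_(s : 'S_(k + l)) (-1) ^+ s * al x (usubmx (row_perm s v)) *
                          be x (dsubmx (row_perm s v)).

(* Evaluated on constant vector fields, so that no bracket terms occur. *)
Definition extd k (al : form k) : form k.+1 :=
  fun x v => \sum_(i < k.+1)
    (-1) ^+ i * 'D_(row i v) (fun y => al y (row' i v)) x.

Definition contract k (u : V) (al : form k.+1) : form k :=
  fun x v => al x (col_mx u v).

(* A volume form is given by its density rho: vol = rho dx^1 /\ ... /\ dx^7. *)
Definition volform (rho : V -> R) : form 7 := fun x v => rho x * \det v.

Definition ip (A : 'M[R]_7) (u v : V) : R := (u *m A *m v^T) 0 0.

(* In coordinates, with I and J running over the k-tuples of indices,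
   ( * al)(v) = 1/k! sum_{I,J} G^{I J} al(d_J) vol(d_I, v): this is the linear
   map with *(e^1 /\ ... /\ e^k) = e^{k+1} /\ ... /\ e^{k+l} for every
   orthonormal coframe e with vol = e^1 /\ ... /\ e^{k+l}. *)
Definition hodge k l (G : V -> 'M[R]_7) (vol : form (k + l)) (al : form k) :
    form l :=
  fun x v => (k`!)%:R^-1 *
    \sum_(I : {ffun 'I_k -> 'I_7})
      al x (rowsub I (invmx (G x))) * vol x (col_mx (rowsub I 1%:M) v).

(* In dimension 7, d^* = (-1)^k * d * on k-forms. *)
Definition codiff3 (G : V -> 'M[R]_7) (rho : V -> R) (al : form 3) : form 2 :=
  fun x v => - hodge (k := 5) (l := 2) G (volform rho)
                 (extd (hodge (k := 3) (l := 4) G (volform rho) al)) x v.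

Definition codiff4 (G : V -> 'M[R]_7) (rho : V -> R) (al : form 4) : form 3 :=
  hodge (k := 4) (l := 3) G (volform rho)
    (extd (hodge (k := 4) (l := 3) G (volform rho) al)).

Definition laplacian3 (G : V -> 'M[R]_7) (rho : V -> R) (al : form 3) :
    form 3 :=
  fun x v => extd (codiff3 G rho al) x v + codiff4 G rho (extd al) x v.

Definition lie (X Y : V -> V) : V -> V := fun x => 'D_(X x) Y x - 'D_(Y x) X x.

(* (christoffel G x u v)^k = Gamma^k_{ij} u^i v^j *)
Definition christoffel (G : V -> 'M[R]_7) (x u v : V) : V :=
  (2^-1 *: \row_(k < 7)
     ('D_u (fun y => ip (G y) v (delta_mx 0 k)) x
      + 'D_v (fun y => ip (G y) u (delta_mx 0 k)) x
      - 'D_(delta_mx 0 k) (fun y => ip (G y) u v) x)) *m invmx (G x).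

Definition nabla (G : V -> 'M[R]_7) (X Y : V -> V) : V -> V :=
  fun x => 'D_(X x) Y x + christoffel G x (X x) (Y x).

Definition riemannian_on (U : set V) (G : V -> 'M[R]_7) :=
  forall x, U x -> (G x)^T = G x /\ forall u, u != 0 -> 0 < ip (G x) u u.

Definition killing_on (U : set V) (G : V -> 'M[R]_7) (E : V -> V) :=
  forall X Y : V -> V, smooth_on U X -> smooth_on U Y -> forall x, U x ->
    'D_(E x) (fun y => ip (G y) (X y) (Y y)) x
    = ip (G x) (lie E X x) (Y x) + ip (G x) (X x) (lie E Y x).

(* The unit Killing field E is the Reeb field of a Sasakian structure: with
   Phi Y = nabla_Y E, (nabla_X Phi) Y = g(E, Y) X - g(X, Y) E. *)
Definition sasakian_on (U : set V) (G : V -> 'M[R]_7) (E : V -> V) :=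
  forall X Y : V -> V, smooth_on U X -> smooth_on U Y -> forall x, U x ->
    nabla G X (nabla G Y E) x - nabla G (nabla G X Y) E x
    = ip (G x) (E x) (Y x) *: X x - ip (G x) (X x) (Y x) *: E x.

(* phi is a G_2-structure inducing the metric G and the orientation for which
   the volume form of G is rho dx^1 /\ ... /\ dx^7:
   (i_u phi) /\ (i_w phi) /\ phi = 6 g(u, w) vol. *)
Definition g2_induces (U : set V) (phi : form 3) (G : V -> 'M[R]_7)
    (rho : V -> R) :=
  riemannian_on U G /\
  forall x, U x -> rho x ^+ 2 = \det (G x) /\
    forall (u w : V) (v : 'M[R]_7),
      wedge (wedge (contract u phi) (contract w phi)) phi x v
      = 6%:R * ip (G x) u w * volform rho x v.

(* For a triple of fields E indexed by Z/3, the cyclic permutations of (1,2,3)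
   are (i, i + 1, i + 2). *)
Variables (G : V -> 'M[R]_7) (E : 'I_3 -> V -> V).

Definition eta (i : 'I_3) : form 1 := fun x v => ip (G x) (E i x) v.

(* Determined by d eta_i = - 2 eta_j /\ eta_k - 2 omega_i. *)
Definition omega (i : 'I_3) : form 2 :=
  fun x v => - 2^-1 * (extd (eta i) x v
                       + 2 * wedge (eta (i + 1)) (eta (i + 2)) x v).

Definition phi_local (eps a b c : R) : form 3 :=
  fun x v =>
    eps * a ^+ 2 * b * wedge (wedge (eta 0) (eta 1)) (eta 2) x v
    - a * c ^+ 2 * (wedge (eta 0) (omega 0) x v + wedge (eta 1) (omega 1) x v)
    - eps * b * c ^+ 2 * wedge (eta 2) (omega 2) x v.

End LocalCalculus.

(* dom i is the domain of the chart i, crd i its coordinate map and par i the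
   inverse of crd i; tensor fields are families of local representatives indexed
   by the charts, subject to the transformation law. *)

Record manifold7 (R : realType) := Manifold7 {
  carrier :> topologicalType;
  chart : Type;
  dom : chart -> set carrier;
  crd : chart -> carrier -> 'rV[R]_7;
  par : chart -> 'rV[R]_7 -> carrier;
  carrier_nonempty : [set: carrier] !=set0;
  carrier_hausdorff : hausdorff_space carrier;
  carrier_second_countable : @second_countable carrier;
  dom_open : forall i, open (dom i);
  dom_cover : forall p, exists i, dom i p;
  img_open : forall i, open (crd i @` dom i);
  crdK : forall i p, dom i p -> par i (crd i p) = p;
  crd_continuous : forall i, {within dom i, continuous (crd i)};
  par_continuous : forall i, {within crd i @` dom i, continuous (par i)};
  transition_smooth : forall i j,
    smooth_on (crd i @` (dom i `&` dom j)) (crd j \o par i)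
}.

Section Manifold.
Variables (R : realType) (M : manifold7 R).
Local Notation V := 'rV[R]_7.
Local Notation chart := (chart M).

Definition img (i : chart) : set V := crd i @` dom i.
Definition overlap (i j : chart) : set V := crd i @` (dom i `&` dom j).
Definition trans (i j : chart) : V -> V := crd j \o par i.

Definition is_vfield (X : chart -> V -> V) :=
  (forall i, smooth_on (img i) (X i)) /\
  forall i j x, overlap i j x ->
    X j (trans i j x) = 'D_(X i x) (trans i j) x.

Definition is_metric (g : chart -> V -> 'M[R]_7) :=
  (forall i, smooth_on (img i) (g i) /\ riemannian_on (img i) (g i)) /\
  forall i j x, overlap i j x -> forall u v,
    ip (g j (trans i j x)) ('D_u (trans i j) x) ('D_v (trans i j) x)
    = ip (g i x) u v.

Definition geodesic (g : chart -> V -> 'M[R]_7) (gam : R -> M) :=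
  continuous gam /\
  forall i t, dom i (gam t) ->
    let x : R -> V := crd i \o gam in
    [/\ derivable x t 1, derivable x^`()%classic t 1 &
        x^`()%classic^`()%classic t
        + christoffel (g i) (x t) (x^`()%classic t) (x^`()%classic t) = 0].

(* Geodesic completeness. *)
Definition complete_metric (g : chart -> V -> 'M[R]_7) :=
  forall i x v, img i x -> exists gam : R -> M,
    [/\ geodesic g gam, gam 0 = par i x & (crd i \o gam)^`()%classic 0 = v].

Definition three_sasakian (g : chart -> V -> 'M[R]_7)
    (E : 'I_3 -> chart -> V -> V) :=
  [/\ is_metric g, complete_metric g, forall a, is_vfield (E a) &
      forall i : chart,
      [/\ forall x, img i x ->
            forall a b, ip (g i x) (E a i x) (E b i x) = (a == b)%:R,
          forall x, img i x ->
            forall a, lie (E a i) (E (a + 1) i) x = 2 *: E (a + 2) i x,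
          forall a, killing_on (img i) (g i) (E a i) &
          forall a, sasakian_on (img i) (g i) (E a i)]].

Definition g2_metric (phi : chart -> form R 3) (g : chart -> V -> 'M[R]_7)
    (rho : chart -> V -> R) :=
  forall i, g2_induces (img i) (phi i) (g i) (rho i).

(* The dual 4-form psi is the Hodge dual of phi. *)
Definition nearly_parallel (phi : chart -> form R 3) :=
  exists g rho lam, [/\ g2_metric phi g rho, lam != 0 &
    forall i x v, img i x ->
      extd (phi i) x v
      = lam * hodge (k := 3) (l := 4) (g i) (volform (rho i)) (phi i) x v].

Definition laplacian_flow (J : set R) (phi : R -> chart -> form R 3) :=
  forall t, J t -> exists g rho, g2_metric (phi t) g rho /\
    forall i x v, img i x ->
      is_derive t (1 : R) (fun r => phi r i x v)
        (laplacian3 (g i) (rho i) (phi t i) x v).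

End Manifold.

(* A planar flow is given by its set T of trajectories: T J gam holds when gam
   is a trajectory, at time 0 at gam 0, defined on the open interval J (which
   need not be maximal). *)

Section Stability.
Variable R : realType.
Local Notation plane := (R * R)%type.
Implicit Types (T : set R -> (R -> plane) -> Prop) (P : plane).

Definition time_reversed T : set R -> (R -> plane) -> Prop :=
  fun J gam => T [set - s | s in J] (fun s => gam (- s)).

(* stable does not ask that trajectories exist, so that unstable provides an
   actual trajectory leaving a neighbourhood; existence for all s >= 0 is part
   of asymptotically_stable. *)
Definition stable T P :=
  forall e, 0 < e -> exists2 d, 0 < d &
    forall J gam, T J gam -> ball P d (gam 0) ->
      forall s, J s -> 0 <= s -> ball P e (gam s).

Definition asymptotically_stable T P :=
  stable T P /\
  exists2 d, 0 < d & forall Q, ball P d Q ->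
    (exists J gam, [/\ T J gam, gam 0 = Q & `[0, +oo[ `<=` J]) /\
    (forall J gam, T J gam -> gam 0 = Q -> `[0, +oo[ `<=` J ->
       gam s @[s --> +oo] --> P).

Definition source T P := asymptotically_stable (time_reversed T) P.

Definition unstable T P := ~ stable T P.

End Stability.

Section Families.
Variables (R : realType) (M : manifold7 R).
Local Notation V := 'rV[R]_7.
Variables (g : chart M -> V -> 'M[R]_7) (E : 'I_3 -> chart M -> V -> V).
Variable eps : R.

Definition phi (a b c : R) : chart M -> form R 3 :=
  fun i => phi_local (g i) (fun l => E l i) eps a b c.

Definition flow_in_family (J : set R) (a b c : R -> R) :=
  [/\ open J, is_interval J, J 0,
      forall t, J t -> [/\ 0 < a t, 0 < b t & 0 < c t] &
      laplacian_flow J (fun t => phi (a t) (b t) (c t))].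

Definition XY (a b c : R) : R * R := (a ^+ 2 / c ^+ 2, a * b / c ^+ 2).

(* X and Y as functions of s, where ds/dt = 1/c^2. *)
Definition rescaling (J : set R) (a b c : R -> R) (J' : set R)
    (gam : R -> R * R) :=
  flow_in_family J a b c /\
  exists s : R -> R,
    [/\ s 0 = 0, s @` J = J' &
        forall t, J t -> is_derive t (1 : R) s (c t ^+ 2)^-1 /\
                         gam (s t) = XY (a t) (b t) (c t)].

Definition rescaled_flow (J' : set R) (gam : R -> R * R) :=
  exists J a b c, rescaling J a b c J' gam.

(* Convergence is taken as s increases to the end of J', finite or not; a
   trajectory not starting at a critical point cannot reach it in finite time,
   so this amounts to s --> +oo. *)
Definition flows_to (a0 b0 c0 : R) (P : R * R) :=
  exists J a b c J' gam,
    [/\ rescaling J a b c J' gam, [/\ a 0 = a0, b 0 = b0 & c 0 = c0] &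
        forall W, nbhs P W -> exists2 s0, J' s0 &
          forall s, J' s -> s0 <= s -> W (gam s)].

(* The element (a0, b0, c0) of F_eps is, up to scale, its only nearly parallel
   one (scaling the metric by k^2 scales a, b and c by k). *)
Definition nearly_parallel_up_to_scale (a0 b0 c0 : R) :=
  forall a b c, 0 < a -> 0 < b -> 0 < c ->
    nearly_parallel (phi a b c) <->
    exists2 k, 0 < k & [/\ a = k * a0, b = k * b0 & c = k * c0].

Definition unstable_source (a0 b0 c0 : R) :=
  source rescaled_flow (XY a0 b0 c0) /\ unstable rescaled_flow (XY a0 b0 c0).

Definition not_reached (a0 b0 c0 : R) :=
  forall a b c, 0 < a -> 0 < b -> 0 < c ->
    ~ nearly_parallel (phi a b c) -> ~ flows_to a b c (XY a0 b0 c0).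

End Families.

(* Main.v *)
Require Import Defs.
From HB Require Import structures.
From mathcomp Require Import all_boot all_order all_algebra.
From mathcomp Require Import fingroup perm.
From mathcomp Require Import all_classical all_reals all_analysis.
From mathcomp Require Import ring lra zify.
Import Order.TTheory GRing.Theory Num.Theory.
Import numFieldNormedType.Exports.
Local Open Scope classical_set_scope.
Local Open Scope ring_scope.

Set Implicit Arguments.
Unset Strict Implicit.
Unset Printing Implicit Defensive.

(** A 3-Sasakian structure is, point by point, a piece of quaternionic algebra,
    and this makes every geometric operation in the statement a finite
    computation.  Let Phi_l be the endomorphism u |-> nabla_u E_l.  The Killing
    and Sasakian identities force the quaternion relations for Phi_1, Phi_2,
    Phi_3 on the orthogonal complement of the Reeb fields ([Phi_sq],
    [Phi_mul_next], [Phi_mul_prev]).  Hence any horizontal unit vector h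
    completes the E_l to an orthonormal frame by the vectors h and -Phi_l h, and
    in the dual coframe all eta_l and omega_l have constant integer coefficients
    ([adapted_coframe]).  Together with the formulas for d eta and d omega
    (the second one is d d eta = 0), exterior derivatives of products of these
    forms become identities between lists of signed index sequences, which are
    checked by computation ([eqcP]).

    Put b' = eps b.  The 3-form of the family is
    u eta_123 - v (eta_1 omega_1 + eta_2 omega_2) - w eta_3 omega_3 with
    u = a^2 b', v = a c^2, w = b' c^2.  The identity
    (i_u phi) /\ (i_w phi) /\ phi = 6 g(u, w) vol determines the metric and the
    orientation ([g2_metric_unique]), so they are those of the coframe rescaled
    by a, a, b', c, c, c, c, whose Hodge star is known.  This gives d phi, its
    proportionality to psi ([nearly_parallel_shape]: b = a and
    c^2 = (3 + 2 eps) a^2) and the Laplacian ([laplacian_phi]), which stays in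
    the span of the same three terms.  The Laplacian flow is therefore an
    ordinary differential equation for (u, v, w), and X = u / w, Z = u / v,
    where Z = eps Y, satisfy the autonomous system X' = [rate_X], Z' = [rate_Z]
    in the time s ([rescaled_family_flow]).  Conversely a solution of the planar
    system, together with one quadrature for c and one for t, gives a flow in
    the family ([family_flow_exists]).

    At (X, Z) = (1/5, 1/5) the linearization has the eigenvalues 20 and 64/5,
    with left eigenvectors (1, 2) and (1, -1); at (1, -1) it has the eigenvalues
    4 and 64, with left eigenvectors (1, 2) and (3, 1).  All are positive.  With x, z the
    displacements from the critical point, the quadratic forms
    V = (x + 2z)^2 + (x - z)^2 and V = (x + 2z)^2 + (3x + z)^2
    satisfy V' >= V on an explicit square ([lyapunov_np], [lyapunov_ts]).  So
    small sublevel sets of V cannot be left backwards in time, and there V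
    decays at least like e^s as s goes to minus infinity ([backward_decay]).
    This is asymptotic stability of the time-reversed system, once trajectories
    are known to exist: the field, cut off outside the square, is bounded and
    Lipschitz, and Picard iteration converges on the whole line ([picard]).
    Instability follows by starting such a trajectory far in the past, when it
    is arbitrarily close to the critical point.  A trajectory converging
    forwards to the critical point would have V eventually small and
    nondecreasing, hence zero at some time, hence, by the backward estimate,
    zero at time 0: it starts at the critical point, which means that the initial
    structure is nearly parallel ([repelling_not_reached]). *)

(** * Constant-coefficient exterior algebra by computation *)

Section PointwiseAlgebra.
Variable R : realType.

(** The product of the k linear forms given by the columns of N, evaluated on
    the rows of v: all pointwise exterior algebra reduces to determinants. *)
Definition decform k (N : 'M[R]_(7, k)) : 'M[R]_(k, 7) -> R := fun v => \det (v *m N).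

(** [Defs.wedge] at a point, as an operation on alternating forms rather than on
    fields of forms. *)
Definition wedge_pt k l (A : 'M[R]_(k, 7) -> R) (B : 'M[R]_(l, 7) -> R) :
    'M[R]_(k + l, 7) -> R :=
  fun v => (k`! * l`!)%:R^-1 *
    \sum_(s : 'S_(k + l)) (-1) ^+ s * A (usubmx (row_perm s v)) *
                          B (dsubmx (row_perm s v)).

Lemma det_row_perms k l (A : 'M[R]_(k + l, k)) (B : 'M[R]_(k + l, l))
    (s : 'S_k) (t : 'S_l) :
  \det (row_mx (col_perm s A) (col_perm t B))
  = (-1) ^+ s * (-1) ^+ t * \det (row_mx A B).
Proof.
have -> : row_mx (col_perm s A) (col_perm t B)
   = row_mx A B *m block_mx (perm_mx s^-1) 0 0 (perm_mx t^-1).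
  by rewrite mul_row_block !mulmx0 addr0 add0r -!col_permE.
by rewrite det_mulmx det_ublock !det_perm !odd_permV mulrC.
Qed.

(** Laplace expansion along a block of columns: each permutation of the k + l
    rows is counted once for every pair of permutations inside the two blocks,
    which is what the normalization by k! l! removes. *)
Lemma wedge_decform k l (N : 'M[R]_(7, k)) (N' : 'M[R]_(7, l)) :
  wedge_pt (decform N) (decform N') = decform (row_mx N N').
Proof.
apply/funext => v; rewrite /wedge_pt /decform mul_mx_row.
set A := v *m N; set B := v *m N'.
have kl0 : (k`! * l`!)%:R != 0 :> R.
  by rewrite pnatr_eq0 -lt0n muln_gt0 !fact_gt0.
apply: (canLR (mulKf kl0)).
transitivity (\sum_(s : 'S_k) \sum_(t : 'S_l) (\det (row_mx A B))); last first.
  by rewrite !sumr_const !card_Sn -!mulrnA mulr_natl mulnC.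
transitivity (\sum_(s : 'S_k) \sum_(t : 'S_l) (-1) ^+ s * (-1) ^+ t *
   \det (row_mx (col_perm s A) (col_perm t B))); last first.
  apply: eq_bigr => s _; apply: eq_bigr => t _; rewrite det_row_perms.
  by rewrite -!signr_addb mulrA -signr_addb addbb mul1r.
transitivity (\sum_(s : 'S_k) \sum_(t : 'S_l) \sum_(r : 'S_(k + l))
  (-1) ^+ r * ((-1) ^+ s * \prod_i A (r (lshift l i)) (s i)) *
   ((-1) ^+ t * \prod_i B (r (rshift k i)) (t i))).
  under [RHS]eq_bigr do rewrite exchange_big /=.
  rewrite [RHS]exchange_big /=; apply: eq_bigr => r _.
  have -> : usubmx (row_perm r v) *m N = usubmx (row_perm r A).
    apply/matrixP => i j; rewrite !mxE; apply: eq_bigr => m _; by rewrite !mxE.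
  have -> : dsubmx (row_perm r v) *m N' = dsubmx (row_perm r B).
    apply/matrixP => i j; rewrite !mxE; apply: eq_bigr => m _; by rewrite !mxE.
  rewrite /determinant -mulrA big_distrl mulr_sumr /=.
  apply: eq_bigr => s _; rewrite big_distrr mulr_sumr /=.
  apply: eq_bigr => t _; rewrite -!mulrA; do 2!congr (_ * _).
  congr (_ * _); first by apply: eq_bigr => i _; rewrite !mxE.
  by congr (_ * _); apply: eq_bigr => i _; rewrite !mxE.
apply: eq_bigr => s _; apply: eq_bigr => t _.
rewrite -det_tr /determinant mulr_sumr; apply: eq_bigr => r _.
have aux (a b c d e : R) : a * (b * d) * (c * e) = b * c * (a * (d * e)) by ring.
rewrite big_split_ord /= aux; congr (_ * (_ * (_ * _))).
  by apply: eq_bigr => i _; rewrite [RHS]mxE row_mxEl [RHS]mxE.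
by apply: eq_bigr => i _; rewrite [RHS]mxE row_mxEr [RHS]mxE.
Qed.

(** The columns of C listed by s; with C the matrix of a coframe, [mono C s] is
    then the product of the covectors with indices s. *)
Definition sel k (C : 'M[R]_7) (s : seq nat) : 'M[R]_(7, k) :=
  \matrix_(i < 7, q < k) C i (inord (nth 0%N s q)).

Definition mono k C s : 'M[R]_(k, 7) -> R := decform (sel k C s).

Lemma sel_cat k l C s t : size s = k ->
  row_mx (sel k C s) (sel l C t) = sel (k + l) C (s ++ t).
Proof.
move=> sk; apply/matrixP => i q; rewrite !mxE.
case: splitP => j jq; rewrite !mxE nth_cat sk jq; first by rewrite ltn_ord.
by rewrite ltnNge leq_addr /= addKn.
Qed.

Lemma mono_wedge k l C s t : size s = k ->
  wedge_pt (mono (k := k) C s) (mono (k := l) C t) = mono C (s ++ t).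
Proof. by move=> sk; rewrite /mono wedge_decform sel_cat. Qed.

(** Adjacent transpositions are enough to sort any index sequence. *)
Lemma mono_swap k C s a b t :
  size (s ++ a :: b :: t) = k ->
  mono (k := k) C (s ++ b :: a :: t) =1 (fun v => - mono C (s ++ a :: b :: t) v).
Proof.
move=> sk v; rewrite /mono /decform.
have pk : (size s < k)%N by rewrite -sk size_cat /=; lia.
have qk : ((size s).+1 < k)%N by rewrite -sk size_cat /=; lia.
pose p := Ordinal pk; pose q := Ordinal qk.
have npq : p != q by rewrite -val_eqE /=; lia.
have -> : sel k C (s ++ b :: a :: t)
  = sel k C (s ++ a :: b :: t) *m perm_mx (tperm p q).
  rewrite -[tperm p q]invgK tpermV -col_permE; apply/matrixP => i j.
  rewrite !mxE; congr (C i (inord _)).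
  case: tpermP => [->|->|/eqP jp /eqP jq] /=.
  - by rewrite !nth_cat !ltnn subnn !ltnNge !leqnSn /= subSnn.
  - by rewrite !nth_cat !ltnn subnn !ltnNge !leqnSn /= subSnn.
  rewrite !nth_cat; case: ltnP => // sj.
  move: jp jq; rewrite -!val_eqE /= => jp jq.
  by case: (j - size s)%N (subnKC sj) jp jq => [|[|n]] //=; lia.
by rewrite mulmxA det_mulmx det_perm odd_tperm npq expr1 mulrN1.
Qed.

Lemma mono_dup k C s a t :
  size (s ++ a :: a :: t) = k -> mono (k := k) C (s ++ a :: a :: t) =1 (fun=> 0).
Proof.
move=> sk v; have := mono_swap C sk v.
by move/eqP; rewrite -addr_eq0 -mulr2n mulrn_eq0 /= => /eqP.
Qed.

(** The boolean is the parity of the permutation that sorts, and None stands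
    for a repeated index, whose monomial vanishes. *)
Fixpoint ins (a : nat) (s : seq nat) : option (bool * seq nat) :=
  if s is b :: s' then
    if (a < b)%N then Some (false, a :: s)
    else if a == b then None
    else if ins a s' is Some (e, s'') then Some (~~ e, b :: s'') else None
  else Some (false, [:: a]).

Fixpoint sgnsort (s : seq nat) : option (bool * seq nat) :=
  if s is a :: s' then
    if sgnsort s' is Some (e, t) then
      if ins a t is Some (e', t') then Some (e (+) e', t') else None
    else None
  else Some (false, [::]).

Definition omono k C (o : option (bool * seq nat)) : 'M[R]_(k, 7) -> R :=
  fun v => if o is Some (e, t) then (-1) ^+ e * mono C t v else 0.

Lemma size_ins a s e t : ins a s = Some (e, t) -> size t = (size s).+1.
Proof.
elim: s e t => [|b s IH] e t /=; first by case=> _ <-.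
case: ifP => _; first by case=> _ <-.
case: ifP => // _; case E : (ins a s) => [[e' t']|//] [_ <-] /=.
by rewrite (IH _ _ E).
Qed.

Lemma mono_ins k C p a s : size (p ++ a :: s) = k ->
  mono (k := k) C (p ++ a :: s) =1
  omono C (if ins a s is Some (e, t) then Some (e, p ++ t) else None).
Proof.
elim: s p => [|b s IH] p pk v /=; first by rewrite mul1r.
case: ifP => _ /=; first by rewrite mul1r.
case: eqP => [ab|_]; first by move: pk; rewrite -ab => pk; rewrite mono_dup.
have pk' : size (p ++ b :: a :: s) = k by rewrite -pk !size_cat.
rewrite (mono_swap C pk').
have := IH (rcons p b); rewrite !cat_rcons => /(_ pk' v) ->.
case: (ins a s) => [[e t]|] /=; last by rewrite oppr0.
by rewrite cat_rcons signrN mulNr.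
Qed.

Lemma size_sgnsort s e t : sgnsort s = Some (e, t) -> size t = size s.
Proof.
elim: s e t => [|a s IH] e t /=; first by case=> _ <-.
case E : (sgnsort s) => [[e' t']|//].
by case F : (ins a t') => [[e1 t1]|//] [_ <-]; rewrite (size_ins F) (IH _ _ E).
Qed.

Lemma mono_sgnsort k C s : size s = k ->
  mono (k := k) C s =1 omono C (sgnsort s).
Proof.
suff H p : size (p ++ s) = k -> mono (k := k) C (p ++ s) =1
  omono C (if sgnsort s is Some (e, t) then Some (e, p ++ t) else None).
  by move=> sk v; rewrite (H [::]) //=; case: sgnsort => [[]|].
elim: s p => [|a s IH] p pk v /=; first by rewrite mul1r.
have := IH (rcons p a); rewrite !cat_rcons => /(_ pk v) ->.
case E : (sgnsort s) => [[e t]|//] /=.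
rewrite cat_rcons mono_ins; last first.
  by rewrite -pk !size_cat /= (size_sgnsort E).
case: (ins a t) => [[e' t']|] /=; last by rewrite mulr0.
by rewrite mulrA signr_addb.
Qed.

(** A form with integer coefficients in the monomials of a coframe, independent
    of the coframe: identities between such forms can be decided by computation
    and then evaluated in every coframe by [ev]. *)
Definition comb := seq (int * seq nat).

Definition ev k C (L : comb) : 'M[R]_(k, 7) -> R :=
  fun v => \sum_(p <- L) p.1%:~R * mono C p.2 v.

Definition homog k (L : comb) := all (fun p => size p.2 == k) L.

Lemma ev_cat k C L L' (v : 'M[R]_(k, 7)) : ev C (L ++ L') v = ev C L v + ev C L' v.
Proof. by rewrite /ev big_cat. Qed.

Definition scal (z : int) (L : comb) : comb := [seq (z * p.1, p.2) | p <- L].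

Lemma ev_scal k C z L (v : 'M[R]_(k, 7)) : ev C (scal z L) v = z%:~R * ev C L v.
Proof.
rewrite /ev big_map mulr_sumr; apply: eq_bigr => p _ /=.
by rewrite intrM mulrA.
Qed.

Definition mulc (L L' : comb) : comb :=
  [seq (p.1 * q.1, p.2 ++ q.2) | p <- L, q <- L'].

Lemma wedge_pt_suml k l (T : Type) (r : seq T) (c : T -> R)
   (F : T -> 'M[R]_(k, 7) -> R) (B : 'M[R]_(l, 7) -> R) v :
  wedge_pt (fun u => \sum_(i <- r) c i * F i u) B v
  = \sum_(i <- r) c i * wedge_pt (F i) B v.
Proof.
rewrite /wedge_pt; under [RHS]eq_bigr do rewrite mulrCA mulr_sumr.
rewrite -mulr_sumr exchange_big /=; congr (_ * _); apply: eq_bigr => s _.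
rewrite mulr_sumr big_distrl /=; apply: eq_bigr => i _.
by rewrite mulrCA !mulrA.
Qed.

Lemma wedge_pt_sumr k l (T : Type) (r : seq T) (c : T -> R)
   (A : 'M[R]_(k, 7) -> R) (F : T -> 'M[R]_(l, 7) -> R) v :
  wedge_pt A (fun u => \sum_(i <- r) c i * F i u) v
  = \sum_(i <- r) c i * wedge_pt A (F i) v.
Proof.
rewrite /wedge_pt; under [RHS]eq_bigr do rewrite mulrCA mulr_sumr.
rewrite -mulr_sumr exchange_big /=; congr (_ * _); apply: eq_bigr => s _.
by rewrite mulr_sumr /=; apply: eq_bigr => i _; rewrite mulrCA.
Qed.

Lemma wedge_ev k l C L L' : homog k L ->
  wedge_pt (ev (k := k) C L) (ev (k := l) C L') = ev C (mulc L L').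
Proof.
move=> hL; apply/funext => v; rewrite wedge_pt_suml /ev big_allpairs_dep /=.
rewrite !big_seq; apply: eq_bigr => p /(allP hL)/eqP pk.
rewrite wedge_pt_sumr mulr_sumr; apply: eq_bigr => q _.
by rewrite mono_wedge // intrM mulrA.
Qed.

Fixpoint addc (c : int) (s : seq nat) (L : comb) : comb :=
  if L is p :: L' then
    if p.2 == s then (c + p.1, s) :: L' else p :: addc c s L'
  else [:: (c, s)].

Definition normal_form (L : comb) : comb :=
  foldr (fun p N => if sgnsort p.2 is Some (e, t)
                    then addc ((-1) ^+ e * p.1) t N else N) [::] L.

Definition eqc (L L' : comb) :=
  all (fun p => p.1 == 0) (normal_form (L ++ scal (-1) L')).

Lemma ev_addc k C c s L (v : 'M[R]_(k, 7)) :
  ev C (addc c s L) v = c%:~R * mono C s v + ev C L v.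
Proof.
elim: L => [|p L IH] /=; first by rewrite /ev big_seq1 big_nil addr0.
case: eqP => [<-|_]; rewrite /ev !big_cons /=; first by rewrite intrD mulrDl addrA.
by rewrite -/(ev C _ v) IH addrCA.
Qed.

Lemma ev_norm k C L : homog k L -> ev (k := k) C (normal_form L) =1 ev C L.
Proof.
move=> + v; elim: L => [//|[c s] L IH] /= /andP[/eqP sk /IH {}IH].
rewrite [RHS]/ev big_cons /= -/(ev C L v) (mono_sgnsort C sk) -IH.
case: sgnsort => [[e t]|] /=; last by rewrite mulr0 add0r.
by rewrite ev_addc intrM rmorphXn rmorphN1 mulrA [_ * c%:~R]mulrC.
Qed.

(** The reflection principle behind all pointwise identities below: equality of
    normal forms is a closed boolean computation. *)
Lemma eqcP k C L L' : homog k L -> homog k L' -> eqc L L' ->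
  ev (k := k) C L = ev C L'.
Proof.
move=> hL hL' /allP z; apply/funext => v; apply/eqP; rewrite -subr_eq0.
have -> : ev C L v - ev C L' v = ev C (L ++ scal (-1) L') v.
  by rewrite ev_cat ev_scal mulN1r.
rewrite -ev_norm; last first.
  by rewrite /homog all_cat [X in X && _]hL all_map.
rewrite /ev big_seq big1 // => p /z /eqP ->; by rewrite mul0r.
Qed.

Definition inrange (L : comb) := all (fun p => all (fun i => i < 7)%N p.2) L.

Definition rem_at (q : nat) (s : seq nat) := take q s ++ drop q.+1 s.

Lemma nth_rem_at q s j : nth 0%N (rem_at q s) j = nth 0%N s (bump q j).
Proof.
rewrite /rem_at /bump nth_cat size_take.
case: (leqP q j) => [qj|jq] /=.
  have [qs|sq] := ltnP q (size s).
    rewrite ltnNge qj /= nth_drop; congr nth; lia.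
  rewrite ltnNge (leq_trans sq qj) /= drop_oversize ?nth_nil; last by lia.
  by rewrite nth_default //; lia.
have [qs|sq] := ltnP q (size s); first by rewrite jq nth_take.
 rewrite take_oversize //; case: ltnP => // sj.
by rewrite drop_oversize ?nth_nil ?nth_default //; lia.
Qed.

Definition contract_idx (i : nat) (L : comb) : comb :=
  flatten [seq [seq ((-1) ^+ q * p.1, rem_at q p.2)
                 | q <- iota 0 (size p.2) & nth 0%N p.2 q == i] | p <- L].

(** Contraction with a vector of the dual frame, that is, a row of B: expanding
    the determinant along its first row leaves one term for each occurrence of
    the index. *)
Lemma contract_mono k (B C : 'M[R]_7) (s : seq nat) (i : 'I_7)
    (v : 'M[R]_(k, 7)) : B *m C = 1%:M -> size s = k.+1 ->
  all (fun i => i < 7)%N s ->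
  mono (k := k.+1) C s (col_mx (row i B) v) =
  \sum_(q <- iota 0 k.+1 | nth 0%N s q == i) (-1) ^+ q * mono C (rem_at q s) v.
Proof.
move=> BC sk /allP sr; rewrite /mono /decform (expand_det_row _ ord0) /=.
rewrite -[0%N :: iota 1 k]/(index_iota 0 k.+1) [RHS]big_mkcond /= big_mkord.
have EM : col_mx (row i B) v *m sel k.+1 C s
    = col_mx (row i B *m sel k.+1 C s) (v *m sel k.+1 C s) := mul_col_mx _ _ _.
apply: eq_bigr => q _; rewrite EM.
have -> : col_mx (row i B *m sel k.+1 C s) (v *m sel k.+1 C s) ord0 q
     = (nth 0%N s q == i)%:R.
  have -> : ord0 = lshift k ord0 :> 'I_(1 + k) by apply/val_inj.
  rewrite col_mxEu -row_mul mxE.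
  have -> : B *m sel k.+1 C s = \matrix_(a, b) (B *m C) a (inord (nth 0%N s b)).
    by apply/matrixP => a b; rewrite !mxE; apply: eq_bigr => m _; rewrite !mxE.
  rewrite BC !mxE; congr (nat_of_bool _)%:R; rewrite -val_eqE /= inordK.
    by rewrite eq_sym.
  by apply: sr; apply: mem_nth; rewrite sk.
case: eqP => _; last by rewrite mul0r.
rewrite mul1r /cofactor add0n; congr (_ * \det _).
apply/matrixP => a b; rewrite !mxE.
have -> : lift ord0 a = rshift 1 a :> 'I_(1 + k) by apply/val_inj.
rewrite (unsplitK (inr a : 'I_1 + 'I_k)) !mxE; apply: eq_bigr => m _.
by rewrite !mxE nth_rem_at.
Qed.

Lemma contract_ev k (B C : 'M[R]_7) (i : 'I_7) L (v : 'M[R]_(k, 7)) :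
  B *m C = 1%:M -> homog k.+1 L -> inrange L ->
  ev (k := k.+1) C L (col_mx (row i B) v) = ev C (contract_idx i L) v.
Proof.
move=> BC /allP hL /allP rL; rewrite /ev big_flatten /= big_map !big_seq.
apply: eq_bigr => p pL; rewrite (contract_mono _ _ BC (eqP (hL _ pL)) (rL _ pL)).
rewrite big_map big_filter mulr_sumr (eqP (hL _ pL)); apply: eq_bigr => q _.
by rewrite /= intrM rmorphXn rmorphN1 mulrA [_%:~R * _]mulrC.
Qed.

(** [Defs.hodge] at a point; Gi is the inverse of the matrix of the metric. *)
Definition hodge_pt k l (Gi : 'M[R]_7) (vol : 'M[R]_(k + l, 7) -> R)
    (A : 'M[R]_(k, 7) -> R) : 'M[R]_(l, 7) -> R :=
  fun v => (k`!)%:R^-1 *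
    \sum_(I : {ffun 'I_k -> 'I_7})
      A (rowsub I Gi) * vol (col_mx (rowsub I 1%:M) v).

Lemma det_col_mx_sum k l (Q : 'M[R]_(k, 7)) (w : 'M[R]_(l, k + l))
    (D : 'M[R]_(7, k + l)) :
  \det (col_mx (Q *m D) w) =
  \sum_(J : {ffun 'I_k -> 'I_7}) (\prod_p Q p (J p)) *
     \det (col_mx (rowsub J D) w).
Proof.
rewrite /determinant; under [RHS]eq_bigr do rewrite mulr_sumr.
rewrite [RHS]exchange_big /=; apply: eq_bigr => s _.
rewrite big_split_ord /=.
under eq_bigr do rewrite col_mxEu mxE.
rewrite bigA_distr_bigA /= big_distrl mulr_sumr /=; apply: eq_bigr => J _.
rewrite big_split_ord /= big_split /=.
have -> : \prod_(i < k) col_mx (rowsub J D) w (lshift l i) (s (lshift l i))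
   = \prod_(i < k) D (J i) (s (lshift l i)).
  by apply: eq_bigr => i _; rewrite col_mxEu mxE.
have E (W : 'M[R]_(k, k + l)) :
  \prod_(i < l) col_mx W w (rshift k i) (s (rshift k i))
  = \prod_(i < l) w i (s (rshift k i)) by apply: eq_bigr => i _; rewrite col_mxEd.
by rewrite !E -!mulrA mulrCA.
Qed.

(** The star of a decomposable form is the contraction of the volume form with
    the k metric duals of its factors.  The sum over all index tuples in the
    definition is a multilinear expansion of this determinant; it counts each of
    the k! orderings of the factors, with the right sign. *)
Lemma hodge_decform k l (Gi : 'M[R]_7) (N : 'M[R]_(7, k)) (D : 'M[R]_(7, k + l)) r v :
  hodge_pt Gi (fun u => r * decform D u) (decform N) v
  = r * decform D (col_mx (Gi *m N)^T v).
Proof.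
have k0 : k`!%:R != 0 :> R by rewrite pnatr_eq0 -lt0n fact_gt0.
apply: (canLR (mulKf k0)); rewrite /decform.
transitivity (\sum_(s : 'S_k) r * \det (col_mx (Gi *m N)^T v *m D)); last first.
  by rewrite sumr_const card_Sn mulr_natl.
transitivity (\sum_(s : 'S_k) (-1) ^+ s * (r *
  \det (col_mx ((col_perm s (Gi *m N))^T *m D) (v *m D)))); last first.
  apply: eq_bigr => s _; rewrite -mul_col_mx.
  have -> : col_mx (col_perm s (Gi *m N))^T v =
     block_mx (perm_mx s) 0 0 1%:M *m col_mx (Gi *m N)^T v.
    rewrite mul_block_col !mul0mx addr0 add0r mul1mx -row_permE.
    by congr col_mx; apply/matrixP => i j; rewrite !mxE.
  rewrite -mulmxA det_mulmx det_ublock det1 mulr1 det_perm.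
  by rewrite mulrCA; congr (_ * _); rewrite mulrA -signr_addb addbb mul1r.
under [RHS]eq_bigr do rewrite det_col_mx_sum mulrCA mulr_sumr.
rewrite -mulr_sumr exchange_big /= mulr_sumr; apply: eq_bigr => J _.
rewrite mul_col_mx mul_rowsub_mx mul_rowsub_mx mul1mx mulrCA; congr (_ * _).
rewrite /determinant big_distrl /=; apply: eq_bigr => s _.
rewrite -mulrA; congr (_ * (_ * _)); apply: eq_bigr => p _.
by rewrite !mxE.
Qed.

Definition compl_idx (s : seq nat) := [seq i <- iota 0 7 | i \notin s].

Definition hodge_idx (L : comb) : comb :=
  [seq (if sgnsort (p.2 ++ compl_idx p.2) is Some (e, _) then (-1) ^+ e * p.1 else 0,
        compl_idx p.2) | p <- L].

(** The side conditions of [hodge_mono], checked by computation. *)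
Definition hodge_ok k l (L : comb) :=
  all (fun p => [&& size p.2 == k, size (compl_idx p.2) == l,
     uniq (p.2 ++ compl_idx p.2), all (fun i => i < 7)%N p.2 &
     if sgnsort (p.2 ++ compl_idx p.2) is Some (_, t) then t == iota 0 7
     else false]) L.

(** In an orthonormal coframe the metric duals of the factors are frame vectors,
    and feeding them to the volume form leaves the complementary monomial, up to
    the sign of the shuffle. *)
Lemma hodge_mono k l (B C : 'M[R]_7) s e v :
  B *m C = 1%:M -> size s = k -> size (compl_idx s) = l ->
  uniq (s ++ compl_idx s) -> all (fun i => i < 7)%N s ->
  sgnsort (s ++ compl_idx s) = Some (e, iota 0 7) ->
  mono (k := k + l) C (iota 0 7) (col_mx (sel k B^T s)^T v)
  = (-1) ^+ e * mono (k := l) C (compl_idx s) v.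
Proof.
move=> BC sk sl us /allP rs ss.
set t := compl_idx s in sl us ss *.
have rt i : i \in t -> (i < 7)%N by rewrite mem_filter mem_iota => /andP[].
have skl : size (s ++ t) = (k + l)%N by rewrite size_cat sk sl.
have := mono_sgnsort C skl (col_mx (sel k B^T s)^T v); rewrite ss /=.
move=> /(congr1 ( *%R ((-1) ^+ e))); rewrite [RHS]mulrA -signr_addb addbb mul1r.
move=> <-; congr (_ * _); rewrite /mono /decform -sel_cat // mul_mx_row !mul_col_mx.
have key n (q : seq nat) : (sel k B^T s)^T *m sel n C q =
    \matrix_(a, b) (inord (nth 0%N s a) == inord (nth 0%N q b) :> 'I_7)%:R.
  apply/matrixP => a b; rewrite !mxE.
  transitivity ((B *m C) (inord (nth 0%N s a)) (inord (nth 0%N q b))).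
    by rewrite mxE; apply: eq_bigr => m _; rewrite !mxE.
  by rewrite BC mxE.
rewrite key [X in row_mx _ (col_mx X _)]key.
rewrite -block_mxEh.
have inj i j : (i < 7)%N -> (j < 7)%N -> (inord i == inord j :> 'I_7) = (i == j).
  by move=> i7 j7; rewrite -val_eqE /= !inordK.
have s7 (a : 'I_k) : (nth 0%N s a < 7)%N by apply: rs; rewrite mem_nth ?sk.
have t7 (a : 'I_l) : (nth 0%N t a < 7)%N by apply: rt; rewrite mem_nth ?sl.
move: us; rewrite cat_uniq => /and3P[us1 _ _].
rewrite (_ : \matrix_(a, b) _ = 1%:M); last first.
  by apply/matrixP => a b; rewrite !mxE inj // nth_uniq ?sk.
rewrite (_ : \matrix_(a, b) _ = 0); last first.
  apply/matrixP => a b; rewrite !mxE inj //; case: eqP => // e0.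
  have : nth 0%N t b \in t by rewrite mem_nth ?sl.
  by rewrite mem_filter -e0 mem_nth ?sk.
by rewrite det_lblock det1 mul1r.
Qed.

Lemma hodge_pt_sum k l Gi vol (T : Type) (r : seq T) (c : T -> R)
   (F : T -> 'M[R]_(k, 7) -> R) v :
  hodge_pt (l := l) Gi vol (fun u => \sum_(i <- r) c i * F i u) v
  = \sum_(i <- r) c i * hodge_pt Gi vol (F i) v.
Proof.
rewrite /hodge_pt; under [RHS]eq_bigr do rewrite mulrCA mulr_sumr.
rewrite -mulr_sumr exchange_big /=; congr (_ * _); apply: eq_bigr => s _.
by rewrite big_distrl /=; apply: eq_bigr => i _; rewrite mulrA.
Qed.

Lemma hodge_ev k l (B C : 'M[R]_7) r L (v : 'M[R]_(l, 7)) :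
  B *m C = 1%:M -> hodge_ok k l L ->
  hodge_pt (B^T *m B) (fun u => r * mono (k := k + l) C (iota 0 7) u)
    (ev (k := k) C L) v = r * ev C (hodge_idx L) v.
Proof.
move=> BC /allP hL; rewrite hodge_pt_sum /ev big_map mulr_sumr !big_seq.
apply: eq_bigr => p /hL /and5P[/eqP sk /eqP sl us rs]; case: p => c s /= in sk sl us rs *.
case E : sgnsort => [[e t]|//] /eqP tE; rewrite {}tE in E.
rewrite hodge_decform.
have -> : B^T *m B *m sel k C s = sel k B^T s.
  rewrite -mulmxA; apply/matrixP => i j; rewrite !mxE.
  transitivity ((B^T *m (B *m C)) i (inord (nth 0%N s j))).
    by rewrite mxE; apply: eq_bigr => m _; rewrite !mxE; congr (_ * _);
       apply: eq_bigr => n _; rewrite !mxE.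
  by rewrite BC mulmx1 mxE.
rewrite -/(mono C (iota 0 7) _) (hodge_mono v BC sk sl us rs E).
by rewrite intrM rmorphXn rmorphN1; ring.
Qed.

End PointwiseAlgebra.

(** * Exterior derivative and symmetry of second derivatives *)

Section Calculus.
Variable R : realType.
Local Notation V := 'rV[R]_7.
Local Notation form := (@Defs.form R).

Lemma near_eq_differentiable (W : normedModType R) (f g : V -> W) x :
  (\near x, f x = g x) -> differentiable f x -> differentiable g x.
Proof.
move=> fg df; have fgx : f x = g x by exact: nbhs_singleton fg.
have H : g \o shift x = cst (g x) + 'd f x +o_ 0 id.
  apply/eqaddoP => e e0.
  have /(_ df) := (@diff_locally _ _ _ x f) => /eqaddoP /(_ e e0) {}df.
  have fg0 : \forall y \near (0 : V), f (y + x) = g (y + x).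
    by move: fg; rewrite (near_shift 0) subr0.
  apply: filterS2 df fg0 => y; rewrite !fctE /= /cst fgx => dfy fgy.
  by rewrite -fgy.
have cd : continuous ('d f x) by apply: diff_continuous.
apply/diff_locallyP; rewrite (diff_unique cd H); by split.
Qed.

Lemma open_near (U : set V) (x : V) (P : V -> Prop) :
  open U -> U x -> (forall y, U y -> P y) -> \near x, P x.
Proof. by move=> oU Ux UP; apply: filterS UP _; apply: open_nbhs_nbhs. Qed.

Definition grad (c : V -> R) (x : V) : 'cV[R]_7 :=
  \col_j 'D_(delta_mx 0 j) c x.

Lemma derive_lin (W : normedModType R) (c : V -> W) x (u : V) :
  differentiable c x -> 'D_u c x = \sum_j u 0 j *: 'D_(delta_mx 0 j) c x.
Proof.
move=> dc; rewrite {1}(row_sum_delta u) deriveE // linear_sum /=.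
by apply: eq_bigr => j _; rewrite linearZ /= -deriveE.
Qed.

Lemma derive_grad c x u : differentiable c x -> 'D_u c x = (u *m grad c x) 0 0.
Proof.
move=> /derive_lin ->; rewrite mxE; apply: eq_bigr => j _; by rewrite mxE.
Qed.

Lemma gradM (b c : V -> R) x : differentiable b x -> differentiable c x ->
  grad (fun y => b y * c y) x = b x *: grad c x + c x *: grad b x.
Proof.
move=> db dc; apply/colP => j; rewrite !mxE.
by rewrite (@deriveM _ _ b c) //; apply: diff_derivable.
Qed.

Lemma differentiable_bigsum (W : normedModType R) (T : Type) (r : seq T)
    (f : T -> V -> W) x :
  (forall i, differentiable (f i) x) ->
  differentiable (fun y => \sum_(i <- r) f i y) x.
Proof.
move=> df; elim: r => [|i r IH].
  by under eq_fun do rewrite big_nil; exact: differentiable_cst.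
under eq_fun do rewrite big_cons; exact: differentiableD.
Qed.

Lemma derive_bigsum (W : normedModType R) (T : Type) (r : seq T)
    (f : T -> V -> W) x (u : V) :
  (forall i, differentiable (f i) x) ->
  'D_u (fun y => \sum_(i <- r) f i y) x = \sum_(i <- r) 'D_u (f i) x.
Proof.
move=> df; elim: r => [|i r IH].
  by under eq_fun do rewrite big_nil; rewrite big_nil derive_cst.
under eq_fun do rewrite big_cons; rewrite big_cons -IH.
rewrite (@deriveD _ _ _ (f i)) //; apply: diff_derivable => //.
exact: differentiable_bigsum.
Qed.

(** Forms on U with differentiable coefficients, written in arbitrary constant
    decomposable forms: this class is stable under products without choosing a
    basis of the exterior algebra. *)
Definition dform (U : set V) k (al : form k) :=
  exists (T : finType) (c : T -> V -> R) (N : T -> 'M[R]_(7, k)),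
  (forall x i, U x -> differentiable (c i) x) /\
  (forall x, U x -> al x = fun v => \sum_i c i x * decform (N i) v).

(** Expansion along the first column: the alternating sum over omitted arguments
    in the definition of d is the product with the differential. *)
Lemma decform_gradE k (g : 'cV[R]_7) (N : 'M[R]_(7, k)) (v : 'M[R]_(k.+1, 7)) :
  decform (row_mx g N : 'M[R]_(7, k.+1)) v =
  \sum_(i < k.+1) (-1) ^+ i * (row i v *m g) 0 0 * decform N (row' i v).
Proof.
have E : v *m (row_mx g N : 'M[R]_(7, k.+1)) = row_mx (v *m g) (v *m N) :=
  @mul_mx_row _ k.+1 7 1 k v g N.
rewrite /decform E (expand_det_col _ ord0); apply: eq_bigr => i _.
have -> : ord0 = lshift k ord0 :> 'I_(1 + k) by apply/val_inj.
rewrite mxE (unsplitK (inl ord0 : 'I_1 + 'I_k)) /cofactor addn0 -row_mul [in RHS]mxE.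
rewrite mulrA [X in X * _]mulrC.
congr (_ * \det _); apply/matrixP => a b; rewrite !mxE.
have -> : @lift k.+1 (@lshift 1 k ord0) b = rshift 1 b :> 'I_(1 + k) by apply/val_inj.
rewrite (unsplitK (inr b : 'I_1 + 'I_k)) !mxE; apply: eq_bigr => m _.
by rewrite !mxE.
Qed.

(** d (c N) = dc /\ N for constant N. *)
Lemma extd_rep (U : set V) k (al : form k) (T : finType) (c : T -> V -> R)
    (N : T -> 'M[R]_(7, k)) x :
  open U -> U x ->
  (forall x i, U x -> differentiable (c i) x) ->
  (forall x, U x -> al x = fun v => \sum_i c i x * decform (N i) v) ->
  extd al x = fun v => \sum_i decform (row_mx (grad (c i) x) (N i) : 'M[R]_(7, k.+1)) v.
Proof.
move=> oU Ux dc cE; apply/funext => v; rewrite /extd.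
under [RHS]eq_bigr do rewrite decform_gradE.
rewrite exchange_big /=; apply: eq_bigr => i _.
have -> : 'D_(row i v) (fun y => al y (row' i v)) x
   = \sum_j (row i v *m grad (c j) x) 0 0 * decform (N j) (row' i v).
  rewrite (near_eq_derive (g := fun y => \sum_j c j y * decform (N j) (row' i v)));
    last by apply: (open_near oU Ux) => y /cE ->.
  rewrite derive_bigsum => [|j]; last first.
    by apply: differentiableM; [exact: dc | exact: differentiable_cst].
  apply: eq_bigr => j _; rewrite -derive_grad; last exact: dc.
  rewrite (@deriveM _ _ (c j) (cst (decform (N j) (row' i v)))).
  - by rewrite derive_cst scaler0 add0r /= mulrC.
  - by apply: diff_derivable; exact: dc.
  - exact: derivable_cst.
by rewrite mulr_sumr; apply: eq_bigr => j _; rewrite mulrA.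
Qed.

Lemma wedge_ptZl k l (a : R) (A : 'M[R]_(k, 7) -> R) (B : 'M[R]_(l, 7) -> R) v :
  wedge_pt (fun u => a * A u) B v = a * wedge_pt A B v.
Proof.
have := wedge_pt_suml [:: tt] (fun=> a) (fun=> A) B v; rewrite !big_seq1 => <-.
by congr (wedge_pt _ _ _); apply/funext => u; rewrite big_seq1.
Qed.

Lemma wedge_pt_sums k l (T T' : finType) (c : T -> R) (b : T' -> R)
   (N : T -> 'M[R]_(7, k)) (N' : T' -> 'M[R]_(7, l)) v :
  wedge_pt (fun u => \sum_i c i * decform (N i) u) (fun u => \sum_i b i * decform (N' i) u) v
  = \sum_i \sum_j c i * b j * decform (row_mx (N i) (N' j)) v.
Proof.
rewrite wedge_pt_suml; apply: eq_bigr => i _; rewrite wedge_pt_sumr mulr_sumr.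
by apply: eq_bigr => j _; rewrite wedge_decform mulrA.
Qed.

Lemma wedgeE k l (al : form k) (be : form l) x :
  wedge al be x = wedge_pt (al x) (be x).
Proof. by []. Qed.

Lemma dform_wedge U k l (al : form k) (be : form l) :
  dform U al -> dform U be -> dform U (wedge al be).
Proof.
move=> [T [c [N [dc cE]]]] [T' [b [N' [db bE]]]].
exists (T * T')%type, (fun p y => c p.1 y * b p.2 y),
  (fun p => row_mx (N p.1) (N' p.2)); split=> [x i Ux|x Ux].
  by apply: differentiableM; [exact: dc | exact: db].
apply/funext => v; rewrite wedgeE cE // bE // wedge_pt_sums.
by rewrite pair_big.
Qed.

Lemma decform_wedge_swap l (g h : 'cV[R]_7) (N : 'M[R]_(7, l)) (v : 'M[R]_(l.+2, 7)) :
  decform (row_mx g (row_mx h N) : 'M[R]_(7, l.+2)) v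
  = - decform (row_mx h (row_mx g N) : 'M[R]_(7, l.+2)) v.
Proof.
have E (a b : 'cV[R]_7) : decform (row_mx a (row_mx b N) : 'M[R]_(7, l.+2)) =
   wedge_pt (decform (row_mx a b : 'M[R]_(7, 2))) (decform N).
  rewrite wedge_decform; congr decform; rewrite [RHS](_ : _ = castmx (erefl, esym (addnA 1 1 l))
    (row_mx a (row_mx b N))) ?castmx_id //.
  by rewrite row_mxA !castmx_id.
rewrite !E -[RHS]mulN1r -wedge_ptZl; congr (wedge_pt _ _ _); apply/funext => u.
have F (a b : 'cV[R]_7) : decform (row_mx a b : 'M[R]_(7, 2)) u =
    (u *m a) 0 0 * (u *m b) 1 0 - (u *m b) 0 0 * (u *m a) 1 0.
  rewrite decform_gradE !big_ord_recl big_ord0 addr0 /= /decform !det_mx11.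
  have e (i : 'I_2) : (row' i u *m b) 0 0 = (u *m b) (lift i 0) 0.
    by rewrite !mxE; apply: eq_bigr => m _; rewrite mxE.
  rewrite !e -!row_mul [in LHS]mxE [(row _ (u *m a)) _ _]mxE.
  have -> : lift ord0 (0 : 'I_1) = 1 :> 'I_2 by apply/val_inj.
  have -> : lift (1 : 'I_2) (0 : 'I_1) = 0 :> 'I_2 by apply/val_inj.
  by rewrite expr0 expr1 mul1r mulN1r mulNr [X in _ - X]mulrC.
rewrite !F; ring.
Qed.

Lemma decform_wedge_swapr l (n g h : 'cV[R]_7) (N : 'M[R]_(7, l)) (v : 'M[R]_(l.+3, 7)) :
  decform (row_mx n (row_mx g (row_mx h N)) : 'M[R]_(7, l.+3)) v
  = - decform (row_mx n (row_mx h (row_mx g N)) : 'M[R]_(7, l.+3)) v.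
Proof.
have E (X : 'M[R]_(7, l.+2)) : decform (row_mx n X : 'M[R]_(7, l.+3)) =
   wedge_pt (decform n) (decform X) by rewrite wedge_decform.
have Z (a : R) (X Y : 'M[R]_(l.+2, 7) -> R) : X =1 (fun u => a * Y u) ->
   wedge_pt (decform n) X v = a * wedge_pt (decform n) Y v.
  move=> XY; have := wedge_pt_sumr [:: tt] (fun=> a) (decform n) (fun=> Y) v.
  rewrite !big_seq1 => <-; congr (wedge_pt _ _ _); apply/funext => u.
  by rewrite big_seq1 XY.
rewrite -[RHS]mulN1r !E; apply: Z => u.
by rewrite mulN1r decform_wedge_swap.
Qed.

Lemma decform_gradD k (g h : 'cV[R]_7) a b (N : 'M[R]_(7, k)) (v : 'M[R]_(k.+1, 7)) :
  decform (row_mx (a *: g + b *: h) N : 'M[R]_(7, k.+1)) v =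
  a * decform (row_mx g N : 'M[R]_(7, k.+1)) v + b * decform (row_mx h N : 'M[R]_(7, k.+1)) v.
Proof.
rewrite !decform_gradE !mulr_sumr -big_split; apply: eq_bigr => i _ /=.
rewrite mulmxDr -!scalemxAr !(mxE _ _ 0 0); ring.
Qed.

(** The Leibniz rule before the differential in the second term is moved past
    the first factor; only that move depends on the degree. *)
Lemma extd_wedge_rep (U : set V) k l (al : form k) (be : form l)
    (T T' : finType) (c : T -> V -> R) (N : T -> 'M[R]_(7, k))
    (b : T' -> V -> R) (N' : T' -> 'M[R]_(7, l)) x :
  open U -> U x ->
  (forall x i, U x -> differentiable (c i) x) ->
  (forall x, U x -> al x = fun v => \sum_i c i x * decform (N i) v) ->
  (forall x i, U x -> differentiable (b i) x) ->
  (forall x, U x -> be x = fun v => \sum_i b i x * decform (N' i) v) ->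
  extd (wedge al be) x = fun v => wedge (extd al) be x v +
    \sum_i \sum_j c i x *
      decform (row_mx (grad (b j) x) (row_mx (N i) (N' j)) : 'M[R]_(7, (k + l).+1)) v.
Proof.
move=> oU Ux dc cE db bE.
rewrite (@extd_rep U _ _ (T * T')%type (fun p y => c p.1 y * b p.2 y)
  (fun p => row_mx (N p.1) (N' p.2))) //; first last.
- move=> y Uy; apply/funext => v; rewrite wedgeE cE // bE // wedge_pt_sums.
  by rewrite pair_big.
- by move=> y i Uy; apply: differentiableM; [exact: dc | exact: db].
apply/funext => v.
have -> : wedge (extd al) be x v = \sum_i \sum_j b j x *
   decform (row_mx (grad (c i) x) (row_mx (N i) (N' j)) : 'M[R]_(7, (k + l).+1)) v.
  rewrite wedgeE (extd_rep oU Ux dc cE) bE //.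
  have := wedge_pt_sums (fun=> 1) (fun j => b j x)
     (fun i => row_mx (grad (c i) x) (N i) : 'M[R]_(7, k.+1)) N' v.
  under [X in wedge_pt X _]eq_fun do under eq_bigr do rewrite mul1r.
  move=> ->; apply: eq_bigr => i _; apply: eq_bigr => j _; rewrite mul1r.
  congr (_ * decform _ _).
  by rewrite -[LHS](@castmx_id _ _ _ (erefl, addnA 1 k l)) row_mxA !castmx_id.
rewrite -(pair_bigA _ (fun i j => decform (row_mx (grad (fun y => c i y * b j y) x)
  (row_mx (N i) (N' j)) : 'M[R]_(7, (k + l).+1)) v)) -big_split.
apply: eq_bigr => i _ /=; rewrite -big_split; apply: eq_bigr => j _ /=.
rewrite gradM; [|exact: dc|exact: db].
by rewrite decform_gradD addrC.
Qed.

Lemma leibniz1 (U : set V) l (al : form 1) (be : form l) x :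
  open U -> U x -> dform U al -> dform U be ->
  extd (wedge al be) x = fun v => wedge (extd al) be x v -
     (wedge al (extd be) : form l.+2) x v.
Proof.
move=> oU Ux [T [c [N [dc cE]]]] [T' [b [N' [db bE]]]].
rewrite (extd_wedge_rep oU Ux dc cE db bE); apply/funext => v; congr (_ + _).
rewrite wedgeE cE // (extd_rep oU Ux db bE).
have := wedge_pt_sums (fun i => c i x) (fun=> 1) N
   (fun j => row_mx (grad (b j) x) (N' j) : 'M[R]_(7, l.+1)) v.
under [X in wedge_pt _ X]eq_fun do under eq_bigr do rewrite mul1r.
move=> ->; rewrite -sumrN; apply: eq_bigr => i _; rewrite -sumrN.
by apply: eq_bigr => j _; rewrite decform_wedge_swap mulr1 mulrN.
Qed.

Lemma leibniz2 (U : set V) l (al : form 2) (be : form l) x :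
  open U -> U x -> dform U al -> dform U be ->
  extd (wedge al be) x = fun v => wedge (extd al) be x v +
     (wedge al (extd be) : form l.+3) x v.
Proof.
move=> oU Ux [T [c [N [dc cE]]]] [T' [b [N' [db bE]]]].
rewrite (extd_wedge_rep oU Ux dc cE db bE); apply/funext => v; congr (_ + _).
rewrite wedgeE cE // (extd_rep oU Ux db bE).
have := wedge_pt_sums (fun i => c i x) (fun=> 1) N
   (fun j => row_mx (grad (b j) x) (N' j) : 'M[R]_(7, l.+1)) v.
under [X in wedge_pt _ X]eq_fun do under eq_bigr do rewrite mul1r.
move=> ->; apply: eq_bigr => i _; apply: eq_bigr => j _; rewrite mulr1; congr (_ * _).
set n1 := lsubmx (N i : 'M[R]_(7, 1 + 1)); set n2 := rsubmx (N i : 'M[R]_(7, 1 + 1)).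
have split q (X : 'M[R]_(7, q)) :
  (row_mx (N i) X : 'M[R]_(7, q.+2)) = row_mx n1 (row_mx n2 X : 'M[R]_(7, q.+1)).
  rewrite -[in LHS](hsubmxK (N i : 'M[R]_(7, 1 + 1))).
  by have := @row_mxA R 7 1 1 q n1 n2 X; rewrite /= castmx_id => ->.
rewrite (split _ (N' j)) (split l.+1 (row_mx (grad (b j) x) (N' j))).
rewrite (@decform_wedge_swap l.+1 (grad (b j) x) n1 (row_mx n2 (N' j))).
by rewrite (@decform_wedge_swapr l n1 (grad (b j) x) n2 (N' j)) opprK.
Qed.

Lemma dform_lin U k a b (al be : form k) :
  dform U al -> dform U be -> dform U (fun x v => a * al x v + b * be x v).
Proof.
move=> [T [c [N [dc cE]]]] [T' [d [N' [dd dE]]]].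
exists (T + T')%type, (fun p y => match p with inl i => a * c i y
   | inr i => b * d i y end),
  (fun p => match p with inl i => N i | inr i => N' i end).
split=> [x [i|i] Ux|x Ux].
- by apply: differentiableM; [exact: differentiable_cst | exact: dc].
- by apply: differentiableM; [exact: differentiable_cst | exact: dd].
apply/funext => v; rewrite big_sumType /= cE // dE // !mulr_sumr.
by congr (_ + _); apply: eq_bigr => i _; rewrite mulrA.
Qed.

Lemma extd_lin (U : set V) k a b (al be : form k) x :
  open U -> U x -> dform U al -> dform U be ->
  extd (fun y v => a * al y v + b * be y v) x
  = fun v => a * extd al x v + b * extd be x v.
Proof.
move=> oU Ux da db; apply/funext => v.
have D ga : dform U ga -> forall u (w : 'M[R]_(k, 7)), derivable (fun y => ga y w) x u.
  move=> [T [c [N [dc cE]]]] u w; apply: (near_eq_derivable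
     (f := fun y => \sum_i c i y * decform (N i) w)).
    by apply: (open_near oU Ux) => y /cE ->.
  apply: diff_derivable; apply: differentiable_bigsum => i.
  by apply: differentiableM; [exact: dc|exact: differentiable_cst].
rewrite /extd !mulr_sumr -big_split /=; apply: eq_bigr => i _.
rewrite (@deriveD _ _ _ (fun y => a * al y (row' i v)) (fun y => b * be y (row' i v))).
- rewrite (@deriveZ _ _ _ (fun y => al y (row' i v)) a); last exact: D.
  rewrite (@deriveZ _ _ _ (fun y => be y (row' i v)) b); last exact: D.
  by rewrite /GRing.scale /=; ring.
- exact: (@derivableZ _ _ _ (fun y => al y (row' i v)) a _ _ (D _ da _ _)).
- exact: (@derivableZ _ _ _ (fun y => be y (row' i v)) b _ _ (D _ db _ _)).
Qed.

Lemma dform_eq (U : set V) k (al be : form k) :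
  (forall x, U x -> al x = be x) -> dform U al -> dform U be.
Proof.
move=> ab [T [c [N [dc cE]]]]; exists T, c, N; split=> // x Ux.
by rewrite -ab // cE.
Qed.

Lemma extd_eq (U : set V) k (al be : form k) x : open U -> U x ->
  (forall x, U x -> al x = be x) -> extd al x = extd be x.
Proof.
move=> oU Ux ab; apply/funext => v; rewrite /extd; apply: eq_bigr => i _.
congr (_ * _); apply: near_eq_derive; apply: (open_near oU Ux) => y /ab -> //.
Qed.

Lemma differentiable_lip_near (f : V -> R) x (e : R) : differentiable f x -> 0 < e ->
  exists2 d, 0 < d & forall w : V, `|w| < d ->
    `|f (x + w) - f x - 'd f x w| <= e * `|w|.
Proof.
move=> df e0; have /(_ df) := (@diff_locally _ _ _ x f).
move=> /eqaddoP /(_ e e0) /nbhs_ballP[d /= d0 H]; exists d => // w wd.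
have /H : ball 0 d w by rewrite -ball_normE /= sub0r normrN.
by rewrite !fctE /= /cst opprD addrA [w + x]addrC.
Qed.

Lemma is_derive_line (f : V -> R) (z u : V) (t : R) :
  differentiable f (z + t *: u) ->
  is_derive t (1 : R) (fun s : R => f (z + s *: u)) ('D_u f (z + t *: u)).
Proof.
move=> df; have [] : is_derive (z + t *: u) u f ('D_u f (z + t *: u)).
  by apply/derivableP/diff_derivable.
have E : (fun h : R => h^-1 *: ((f \o shift (z + t *: u)) (h *: u) - f (z + t *: u)))
  = (fun h : R => h^-1 *: (((fun s : R => f (z + s *: u)) \o shift t) (h *: 1) -
        f (z + t *: u))).
  apply/funext => h /=; congr (_ *: (f _ - _)).
  by rewrite [h *: 1]mulr1 scalerDl addrCA.
rewrite /derivable /derive E => c d; exact: DeriveDef.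
Qed.

Lemma mixed_difference_aux (a b h e K : R) : 0 < h -> 0 < K ->
  `|a| <= e / (2 * K) * (h * K) -> `|b| <= e / (2 * K) * (h * K) ->
  `|h * (a - b)| <= e * h ^+ 2.
Proof.
move=> h0 K0; have -> : e / (2 * K) * (h * K) = e / 2 * h by field; rewrite gt_eqF.
move=> ha hb; rewrite normrM gtr0_norm // expr2 mulrCA ler_pM2l //.
apply: (le_trans (ler_normB _ _)); lra.
Qed.

Lemma schwarz_aux (A A' H D D' e : R) : A = A' -> `|A - H * D| <= e / 2 * H ->
  `|A' - H * D'| <= e / 2 * H -> `|H * (D - D')| <= H * e.
Proof.
move=> <-; rewrite !ler_norml mulrBr => /andP[a1 a2] /andP[b1 b2].
by apply/andP; split; lra.
Qed.

(** Mean value theorem in the direction u, then differentiability of D_u f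
    at x. *)
Lemma mixed_difference (U : set V) (f : V -> R) (x u v : V) (e : R) :
  open U -> U x -> (forall y, U y -> differentiable f y) ->
  differentiable ('D_u f) x -> 0 < e ->
  exists2 d, 0 < d & forall h, 0 < h -> h < d ->
    `|f (x + h *: v + h *: u) - f (x + h *: u) - (f (x + h *: v) - f x)
      - h ^+ 2 * 'D_v ('D_u f) x| <= e * h ^+ 2.
Proof.
move=> oU Ux df dDu e0.
pose K := `|u| + `|v| + 1.
have K0 : 0 < K by rewrite ltr_wpDl // addr_ge0.
have e'0 : 0 < e / (2 * K) by rewrite divr_gt0 // mulr_gt0.
have [d0 d00 H] := differentiable_lip_near dDu e'0.
have [r r0 Hr] : exists2 r, 0 < r & forall w : V, `|w| < r -> U (x + w).
  have /nbhs_ballP[r /= r0 rU] : nbhs x U by apply: open_nbhs_nbhs.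
  exists r => // w wr; apply: rU; rewrite -ball_normE /= opprD addrA subrr sub0r.
  by rewrite normrN.
exists (Num.min d0 r / K); first by rewrite divr_gt0 // lt_min d00.
move=> h h0; rewrite ltr_pdivlMr // lt_min => /andP[hd hr].
have small s t : 0 <= s <= h -> 0 <= t <= h -> `|t *: v + s *: u| <= h * K.
  move=> /andP[s0 sh] /andP[t0 th]; apply: (le_trans (ler_normD _ _)).
  rewrite !normrZ !ger0_norm // /K !mulrDr mulr1.
  have := ler_wpM2r (normr_ge0 u) sh; have := ler_wpM2r (normr_ge0 v) th.
  by move: h0; lra.
have inU s t : 0 <= s <= h -> 0 <= t <= h -> U (x + t *: v + s *: u).
  move=> sh th; rewrite -addrA; apply: Hr; apply: le_lt_trans hr; exact: small.
pose phi s := f (x + h *: v + s *: u) - f (x + 0 *: v + s *: u).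
pose dphi s := 'D_u f (x + h *: v + s *: u) - 'D_u f (x + 0 *: v + s *: u).
have hh : 0 <= h <= h by rewrite lexx ltW.
have h00 : 0 <= (0 : R) <= h by rewrite lexx ltW.
have dphiP s : 0 <= s <= h -> is_derive s (1 : R) phi (dphi s).
  move=> sh; apply: is_deriveB; apply: is_derive_line; apply: df; exact: inU.
have [th thi Hth] : exists2 c, c \in `]0, h[%R & phi h - phi 0 = dphi c * (h - 0).
  apply: MVT => // [s|].
    by rewrite in_itv /= => /andP[s0 sh]; apply: dphiP; rewrite !ltW.
  apply: derivable_within_continuous => s; rewrite in_itv /= => sh.
  by have [] := dphiP s sh.
move: thi; rewrite in_itv /= => /andP[th0 thh].
have thi : 0 <= th <= h by rewrite !ltW.
have E1 : f (x + h *: v + h *: u) - f (x + h *: u) - (f (x + h *: v) - f x)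
   = h * dphi th.
  by rewrite mulrC -[h in RHS]subr0 -Hth /phi !scale0r !addr0.
have L1 := H _ (le_lt_trans (small _ _ thi hh) hd).
have L2 := H _ (le_lt_trans (small _ _ thi h00) hd).
have B1 := le_trans L1 (ler_wpM2l (ltW e'0) (small _ _ thi hh)).
have B2 := le_trans L2 (ler_wpM2l (ltW e'0) (small _ _ thi h00)).
rewrite E1 deriveE //.
have -> : h * dphi th - h ^+ 2 * 'd ('D_u f) x v =
  h * (('D_u f (x + (h *: v + th *: u)) - 'D_u f x - 'd ('D_u f) x (h *: v + th *: u))
     - ('D_u f (x + (0 *: v + th *: u)) - 'D_u f x - 'd ('D_u f) x (0 *: v + th *: u))).
  rewrite /dphi !linearD !linearZ /= !addrA /GRing.scale /=; ring.
exact: mixed_difference_aux B1 B2.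
Qed.

(** The classical argument: the mixed second difference of f over a
    parallelogram of size h is symmetric in u and v, and divided by h^2 it tends
    to either iterated derivative. *)
Lemma schwarz (U : set V) (f : V -> R) (x u v : V) :
  open U -> U x -> (forall y, U y -> differentiable f y) ->
  differentiable ('D_u f) x -> differentiable ('D_v f) x ->
  'D_v ('D_u f) x = 'D_u ('D_v f) x.
Proof.
move=> oU Ux df du dv; apply/eqP; rewrite -subr_eq0 -normr_le0.
apply/ler_addgt0Pl => e e0; rewrite addr0.
have e2 : 0 < e / 2 by rewrite divr_gt0.
have [d1 d10 H1] := mixed_difference v oU Ux df du e2.
have [d2 d20 H2] := mixed_difference u oU Ux df dv e2.
pose h := Num.min d1 d2 / 2.
have h0 : 0 < h by rewrite divr_gt0 // lt_min d10.
have hm : h < Num.min d1 d2 by rewrite ltr_pdivrMr // ltr_pMr ?lt_min ?d10 // ltr1n.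
move: hm; rewrite lt_min => /andP[/(H1 _ h0) {}H1 /(H2 _ h0) {}H2].
have h2 : 0 < h ^+ 2 by rewrite exprn_gt0.
rewrite -(ler_pM2l h2) -{1}(ger0_norm (ltW h2)) -normrM.
apply: schwarz_aux H1 H2; rewrite [x + h *: u + h *: v]addrAC.
by rewrite !opprB addrACA [in RHS]addrACA; congr (_ + _); rewrite addrC.
Qed.

End Calculus.

(** * Metric, Christoffel symbols and the forms eta, omega *)

Section InnerProduct.
Variable R : realType.
Local Notation V := 'rV[R]_7.

Lemma ipE (A : 'M[R]_7) (u v : V) : ip A u v = \sum_i \sum_j u 0 i * A i j * v 0 j.
Proof.
rewrite /ip mxE exchange_big /=; apply: eq_bigr => j _; rewrite !mxE mulr_suml.
by apply: eq_bigr.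
Qed.

Lemma ipDl A (u u' v : V) : ip A (u + u') v = ip A u v + ip A u' v.
Proof. by rewrite /ip !mulmxDl mxE. Qed.
Lemma ipDr A (u v v' : V) : ip A u (v + v') = ip A u v + ip A u v'.
Proof. by rewrite /ip linearD /= mulmxDr mxE. Qed.
Lemma ipNl A (u v : V) : ip A (- u) v = - ip A u v.
Proof. by rewrite /ip !mulNmx mxE. Qed.
Lemma ipNr A (u v : V) : ip A u (- v) = - ip A u v.
Proof. by rewrite /ip linearN /= mulmxN mxE. Qed.
Lemma ipZl A a (u v : V) : ip A (a *: u) v = a * ip A u v.
Proof. by rewrite /ip -!scalemxAl mxE. Qed.
Lemma ipZr A a (u v : V) : ip A u (a *: v) = a * ip A u v.
Proof. by rewrite /ip linearZ /= -scalemxAr mxE. Qed.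
Lemma ip0l A (v : V) : ip A 0 v = 0.
Proof. by rewrite /ip !mul0mx mxE. Qed.
Lemma ip0r A (v : V) : ip A v 0 = 0.
Proof. by rewrite /ip trmx0 mulmx0 mxE. Qed.
Lemma ipC A (u v : V) : A^T = A -> ip A u v = ip A v u.
Proof.
move=> sA; rewrite /ip; set m := _ *m _.
by rewrite -(trmxK m) mxE /m !trmx_mul trmxK sA mulmxA.
Qed.

Lemma ip_delta A (u v : V) : ip A u v = \sum_k v 0 k * ip A u (delta_mx 0 k).
Proof.
rewrite {1}(row_sum_delta v) /ip linear_sum mulmx_sumr summxE.
by apply: eq_bigr => k _; rewrite linearZ /= -scalemxAr mxE.
Qed.

Lemma ip_coef A (u v : V) : ip A u v = \sum_j (u *m A) 0 j * v 0 j.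
Proof. by rewrite /ip mxE; apply: eq_bigr => j _; rewrite [v^T _ _]mxE. Qed.

Lemma ip_inj A (u v : V) : A^T = A -> (forall u : V, u != 0 -> 0 < ip A u u) ->
  (forall w, ip A u w = ip A v w) -> u = v.
Proof.
move=> sA pA H; apply/eqP; rewrite -subr_eq0; apply/negPn/negP => /pA.
by rewrite ipDl ipNl H subrr ltxx.
Qed.

Lemma posdef_unit (A : 'M[R]_7) : (forall u : V, u != 0 -> 0 < ip A u u) ->
  A \in unitmx.
Proof.
move=> pA; rewrite -row_free_unit -kermx_eq0; apply/rowV0P => u /sub_kermxP uA.
apply/eqP/negPn/negP => /pA; by rewrite /ip uA mul0mx mxE ltxx.
Qed.

Lemma differentiable_entry m n (F : V -> 'M[R]_(m, n)) x i j :
  differentiable F x -> differentiable (fun y => F y i j) x.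
Proof.
move=> dF; apply: (@differentiable_comp _ _ _ _ F (fun M : 'M[R]_(m, n) => M i j)) => //.
exact: differentiable_coord.
Qed.

Lemma derive_entry m n (F : V -> 'M[R]_(m.+1, n.+1)) x u i j :
  differentiable F x -> 'D_u (fun y => F y i j) x = ('D_u F x) i j.
Proof. by move=> dF; rewrite derive_mx ?mxE //; apply: diff_derivable. Qed.

Lemma derive_ip (G : V -> 'M[R]_7) (X Y : V -> V) x (u : V) :
  differentiable G x -> differentiable X x -> differentiable Y x ->
  'D_u (fun y => ip (G y) (X y) (Y y)) x
  = ip ('D_u G x) (X x) (Y x) + ip (G x) ('D_u X x) (Y x) + ip (G x) (X x) ('D_u Y x).
Proof.
move=> dG dX dY; under eq_fun do rewrite ipE.
have dXY i j : differentiable (fun y => X y 0 i * G y i j) x.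
  by apply: differentiableM; exact: differentiable_entry.
have dXYZ i j : differentiable (fun y => X y 0 i * G y i j * Y y 0 j) x.
  by apply: differentiableM; [exact: dXY|exact: differentiable_entry].
rewrite derive_bigsum => [|i]; last exact: differentiable_bigsum.
rewrite !ipE -!big_split /=; apply: eq_bigr => i _.
rewrite derive_bigsum //= -!big_split /=; apply: eq_bigr => j _.
rewrite (@deriveM _ _ (fun y => X y 0 i * G y i j) (fun y => Y y 0 j)); last 2 first.
- by apply: diff_derivable.
- by apply: diff_derivable; exact: differentiable_entry.
rewrite (@deriveM _ _ (fun y => X y 0 i) (fun y => G y i j)); last 2 first.
- by apply: diff_derivable; exact: differentiable_entry.
- by apply: diff_derivable; exact: differentiable_entry.
rewrite !derive_entry // /GRing.scale /=; ring.
Qed.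

Lemma derive_ip_cst (G : V -> 'M[R]_7) x (u v w : V) :
  differentiable G x ->
  'D_u (fun y => ip (G y) v w) x = ip ('D_u G x) v w.
Proof.
move=> dG; have := derive_ip (X := cst v) (Y := cst w) u dG.
rewrite !derive_cst ip0l ip0r !addr0; apply; exact: differentiable_cst.
Qed.

Lemma smooth_cst (U : set V) (u : V) : smooth_on U (cst u).
Proof.
move=> s x _; have : Defs.iterD (cst u : V -> V) s = cst u \/
    Defs.iterD (cst u : V -> V) s = cst 0.
  elim: s => [|v s [] IH] /=; first by left.
    by right; apply/funext => y; rewrite IH derive_cst.
  by right; apply/funext => y; rewrite IH derive_cst.
by case=> ->; exact: differentiable_cst.
Qed.

End InnerProduct.

Section KillingFields.
Variable R : realType.
Local Notation V := 'rV[R]_7.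
Local Notation form := (@Defs.form R).
Variables (U : set V) (G : V -> 'M[R]_7) (E : 'I_3 -> V -> V).
Hypothesis oU : open U.
Hypothesis sG : smooth_on U G.
Hypothesis sE : forall l, smooth_on U (E l).
Hypothesis rG : riemannian_on U G.

Let dG x : U x -> differentiable G x. Proof. exact: (sG [::]). Qed.
Let dE l x : U x -> differentiable (E l) x. Proof. exact: (sE l [::]). Qed.
Let ddG u x : U x -> differentiable ('D_u G) x. Proof. exact: (sG [:: u]). Qed.
Let ddE l u x : U x -> differentiable ('D_u (E l)) x.
Proof. exact: (sE l [:: u]). Qed.

Definition dmet x (u v w : V) : R := 'D_u (fun y => ip (G y) v w) x.

Lemma dmet_ip x u v w : U x -> dmet x u v w = ip ('D_u G x) v w.
Proof. by move=> Ux; apply: derive_ip_cst; exact: dG. Qed.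

Lemma dmet_linr x u v w : U x ->
  dmet x u v w = \sum_k w 0 k * dmet x u v (delta_mx 0 k).
Proof.
move=> Ux; rewrite dmet_ip //; set A : 'M[R]_7 := 'D_u G x; rewrite ip_delta.
by apply: eq_bigr => k _; rewrite dmet_ip.
Qed.

Lemma dmet_linl x u v w : U x ->
  dmet x w u v = \sum_k w 0 k * dmet x (delta_mx 0 k) u v.
Proof.
move=> Ux; rewrite dmet_ip // derive_lin; last exact: dG.
rewrite /ip mulmx_sumr mulmx_suml summxE; apply: eq_bigr => k _.
by rewrite dmet_ip // /ip -scalemxAr -scalemxAl mxE.
Qed.

Lemma dmetC x u v w : U x -> dmet x u v w = dmet x u w v.
Proof.
move=> Ux; apply: near_eq_derive; apply: (open_near oU Ux) => y Uy.
by apply: ipC; exact: (rG Uy).1.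
Qed.

Lemma ip_invmx (A : 'M[R]_7) (r w : V) : A \in unitmx ->
  ip A (r *m invmx A) w = \sum_k w 0 k * r 0 k.
Proof.
move=> uA; rewrite /ip mulmxKV // mxE; apply: eq_bigr => k _.
by rewrite [w^T _ _]mxE mulrC.
Qed.

Lemma christoffelE x u v : christoffel G x u v =
  (2^-1 *: \row_(k < 7) (dmet x u v (delta_mx 0 k) + dmet x v u (delta_mx 0 k)
      - dmet x (delta_mx 0 k) u v)) *m invmx (G x).
Proof. by []. Qed.

Lemma metric_unit x : U x -> G x \in unitmx.
Proof. by move=> Ux; apply: posdef_unit; exact: (rG Ux).2. Qed.

(** The Koszul formula for constant vector fields. *)
Lemma christoffel_ip x (u v w : V) : U x ->
  ip (G x) (christoffel G x u v) w =
  2^-1 * (dmet x u v w + dmet x v u w - dmet x w u v).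
Proof.
move=> Ux; rewrite christoffelE ip_invmx ?metric_unit //.
rewrite (dmet_linr u v w Ux) (dmet_linr v u w Ux) (dmet_linl u v w Ux).
rewrite -big_split -sumrB mulr_sumr; apply: eq_bigr => k _ /=.
by rewrite (mxE _ _ 0 k) (mxE _ _ 0 k); ring.
Qed.

Lemma christoffelC x u v : U x -> christoffel G x u v = christoffel G x v u.
Proof.
move=> Ux; have [sGx pGx] := rG Ux; apply: (ip_inj sGx pGx) => w.
rewrite !(christoffel_ip _ _ _ Ux) (dmetC w u v Ux).
by rewrite [dmet x v u w + _]addrC.
Qed.

Lemma nabla_eq (F F' X : V -> V) x : U x -> (forall y, U y -> F y = F' y) ->
  nabla G X F x = nabla G X F' x.
Proof.
move=> Ux FF; rewrite /nabla (FF _ Ux); congr (_ + _).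
by apply: near_eq_derive; apply: (open_near oU Ux).
Qed.

Definition eta_coef l j (y : V) : R := (E l y *m G y) 0 j.

Lemma eta_coefE l j y : eta_coef l j y = \sum_k E l y 0 k * G y k j.
Proof. by rewrite /eta_coef mxE. Qed.

Lemma eta_rep l x :
  Defs.eta G E l x = fun v => \sum_j eta_coef l j x * decform (delta_mx j 0 : 'M[R]_(7, 1)) v.
Proof.
apply/funext => v; rewrite /Defs.eta /ip mxE; apply: eq_bigr => j _.
congr (_ * _); rewrite /decform det_mx11 !mxE (bigD1 j) //= mxE !eqxx mulr1.
by rewrite big1 ?addr0 // => i /negbTE ij; rewrite mxE ij mulr0.
Qed.

Lemma eta_coef_diff x l j : U x -> differentiable (eta_coef l j) x.
Proof.
move=> Ux; rewrite (funext (eta_coefE l j)); apply: differentiable_bigsum => k.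
by apply: differentiableM; apply: differentiable_entry; [exact: dE | exact: dG].
Qed.

Lemma eta_coef_diff2 x l j u : U x -> differentiable ('D_u (eta_coef l j)) x.
Proof.
move=> Ux; apply: (near_eq_differentiable (f := fun y => \sum_k
   (E l y 0 k * 'D_u G y k j + 'D_u (E l) y 0 k * G y k j))).
  apply: (open_near oU Ux) => y Uy; rewrite (funext (eta_coefE l j)).
  rewrite derive_bigsum => [|k]; last first.
    by apply: differentiableM; apply: differentiable_entry; [exact: dE | exact: dG].
  apply: eq_bigr => k _.
  rewrite (@deriveM _ _ (fun y => E l y 0 k) (fun y => G y k j)); last 2 first.
  - by apply: diff_derivable; apply: differentiable_entry; exact: dE.
  - by apply: diff_derivable; apply: differentiable_entry; exact: dG.
  rewrite !derive_entry; [|exact: dE|exact: dG].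
  by rewrite /GRing.scale /=; congr (_ + _); rewrite mulrC.
apply: differentiable_bigsum => k; apply: differentiableD.
  by apply: differentiableM; apply: differentiable_entry; [exact: dE | exact: ddG].
by apply: differentiableM; apply: differentiable_entry; [exact: ddE | exact: dG].
Qed.

Lemma dform_eta l : dform U (Defs.eta G E l).
Proof.
exists 'I_7, (eta_coef l), (fun j => delta_mx j 0); split=> [x i Ux|x Ux].
  exact: eta_coef_diff.
exact: eta_rep.
Qed.

Lemma decform_grad_sum k (c : V -> R) (N : 'M[R]_(7, k)) x :
  decform (row_mx (grad c x) N : 'M[R]_(7, k.+1)) = fun v => \sum_(i < 7)
    'D_(delta_mx 0 i) c x * decform (row_mx (delta_mx i 0 : 'cV[R]_7) N : 'M[R]_(7, k.+1)) v.
Proof.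
apply/funext => v; rewrite decform_gradE; under [RHS]eq_bigr do rewrite decform_gradE mulr_sumr.
rewrite exchange_big /=; apply: eq_bigr => m _.
have -> : (row m v *m grad c x) 0 0 = \sum_i row m v 0 i * grad c x i 0.
  by rewrite mxE.
rewrite [X in X * _]mulr_sumr mulr_suml; apply: eq_bigr => i _.
have -> : (row m v *m delta_mx i (0 : 'I_1)) 0 0 = row m v 0 i.
  by rewrite -colE mxE.
have -> : grad c x i 0 = 'D_(delta_mx 0 i) c x by rewrite mxE.
by rewrite [row m v 0 i * _]mulrC mulrCA !mulrA.
Qed.

Lemma extd_eta_rep l x : U x ->
  extd (Defs.eta G E l) x = fun v => \sum_(p : 'I_7 * 'I_7)
    'D_(delta_mx 0 p.2) (eta_coef l p.1) x *
    decform (row_mx (delta_mx p.2 0 : 'cV[R]_7) (delta_mx p.1 0 : 'cV[R]_7) : 'M[R]_(7, 2)) v.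
Proof.
move=> Ux; rewrite (extd_rep oU Ux (c := eta_coef l) (N := fun j => delta_mx j 0)).
- apply/funext => v; rewrite -(pair_bigA _ (fun j i =>
     'D_(delta_mx 0 i) (eta_coef l j) x * decform (row_mx (delta_mx i 0 : 'cV[R]_7)
       (delta_mx j 0 : 'cV[R]_7) : 'M[R]_(7, 2)) v)) /=.
  by apply: eq_bigr => j _; rewrite decform_grad_sum.
- by move=> y i Uy; exact: eta_coef_diff.
- by move=> y _; exact: eta_rep.
Qed.

Lemma dform_extd_eta l : dform U (extd (Defs.eta G E l)).
Proof.
exists ('I_7 * 'I_7)%type, (fun p => 'D_(delta_mx 0 p.2) (eta_coef l p.1)),
  (fun p => row_mx (delta_mx p.2 0 : 'cV[R]_7) (delta_mx p.1 0 : 'cV[R]_7) : 'M[R]_(7, 2)).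
split=> [x p Ux|x Ux]; first exact: eta_coef_diff2.
exact: extd_eta_rep.
Qed.

(** Second derivatives are symmetric in the two directions and the product of
    their covectors is antisymmetric. *)
Lemma extd_extd_eta l x : U x -> extd (extd (Defs.eta G E l)) x = fun=> 0.
Proof.
move=> Ux; rewrite (extd_rep oU Ux
 (c := fun p : 'I_7 * 'I_7 => 'D_(delta_mx 0 p.2) (eta_coef l p.1))
 (N := fun p => row_mx (delta_mx p.2 0 : 'cV[R]_7) (delta_mx p.1 0 : 'cV[R]_7) : 'M[R]_(7, 2))).
- apply/funext => v; rewrite -(pair_bigA _ (fun j i => decform (row_mx
    (grad ('D_(delta_mx 0 i) (eta_coef l j)) x)
    (row_mx (delta_mx i 0 : 'cV[R]_7) (delta_mx j 0 : 'cV[R]_7) : 'M[R]_(7, 2))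
    : 'M[R]_(7, 3)) v)) /=.
  rewrite big1 // => j _; under eq_bigr do rewrite decform_grad_sum.
  set S := \sum_i _; suff : S = - S by move/eqP; rewrite -addr_eq0 -mulr2n mulrn_eq0 /= => /eqP.
  rewrite {1}/S exchange_big /= /S -sumrN; apply: eq_bigr => i _.
  rewrite -sumrN; apply: eq_bigr => k _.
  have -> : 'D_(delta_mx 0 i) ('D_(delta_mx 0 k) (eta_coef l j)) x =
            'D_(delta_mx 0 k) ('D_(delta_mx 0 i) (eta_coef l j)) x.
    apply: (schwarz oU Ux); first by move=> y Uy; exact: eta_coef_diff.
      exact: eta_coef_diff2.
    exact: eta_coef_diff2.
  have := @decform_wedge_swap R 1 (delta_mx i 0) (delta_mx k 0) (delta_mx j 0) v.
  by move=> ->; exact: mulrN.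
- by move=> y i Uy; exact: eta_coef_diff2.
- by move=> y Uy; exact: extd_eta_rep.
Qed.

Lemma omega_aux (a b : R) : - 2^-1 * a + (- 1) * b = - 2^-1 * (a + 2 * b).
Proof. by lra. Qed.

Lemma extd_eta_aux (a b : R) : a = - 2 * b - 2 * (- 2^-1 * (a + 2 * b)).
Proof. by lra. Qed.

Lemma dform_omega l : dform U (Defs.omega G E l).
Proof.
apply: (@dform_eq _ _ _ (fun x v => - 2^-1 * extd (Defs.eta G E l) x v +
   (- 1) * wedge (Defs.eta G E (l + 1)) (Defs.eta G E (l + 2)) x v)); last first.
  by apply: dform_lin; [exact: dform_extd_eta | apply: (@dform_wedge _ _ 1 1); exact: dform_eta].
by move=> x Ux; apply/funext => v; exact: omega_aux.
Qed.

Lemma extd_eta l x v : extd (Defs.eta G E l) x v =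
  - 2 * wedge (Defs.eta G E (l + 1)) (Defs.eta G E (l + 2)) x v - 2 * Defs.omega G E l x v.
Proof.
exact: extd_eta_aux.
Qed.

(** Differentiating d eta_l = - 2 eta_j /\ eta_k - 2 omega_l leaves this, since
    d d eta_l = 0. *)
Lemma extd_omega l x : U x -> extd (Defs.omega G E l) x = fun v =>
  - wedge (extd (Defs.eta G E (l + 1))) (Defs.eta G E (l + 2)) x v +
  (wedge (Defs.eta G E (l + 1)) (extd (Defs.eta G E (l + 2))) : form 3) x v.
Proof.
move=> Ux; rewrite (@extd_eq _ _ _ _ (fun x v => - 2^-1 * extd (Defs.eta G E l) x v +
   (- 1) * wedge (Defs.eta G E (l + 1)) (Defs.eta G E (l + 2)) x v) x oU Ux); last first.
  by move=> y Uy; apply/funext => v; rewrite [RHS]omega_aux.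
rewrite (extd_lin _ _ oU Ux); last 2 first.
- exact: dform_extd_eta.
- by apply: (@dform_wedge _ _ 1 1); exact: dform_eta.
rewrite extd_extd_eta // (leibniz1 oU Ux); [|exact: dform_eta..].
by apply/funext => v; rewrite mulr0 add0r mulN1r opprB addrC.
Qed.

End KillingFields.

(** * The quaternion relations and adapted coframes *)

(* Keeps unification from unfolding inner products into matrix products. *)
Local Opaque ip.

Section Sasakian.
Variable R : realType.
Local Notation V := 'rV[R]_7.
Local Notation form := (@Defs.form R).
Variables (U : set V) (G : V -> 'M[R]_7) (E : 'I_3 -> V -> V).
Hypothesis oU : open U.
Hypothesis sG : smooth_on U G.
Hypothesis sE : forall l, smooth_on U (E l).
Hypothesis rG : riemannian_on U G.
Hypothesis onE : forall x, U x -> forall a b, ip (G x) (E a x) (E b x) = (a == b)%:R.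
Hypothesis lieE : forall x, U x -> forall a, lie (E a) (E (a + 1)) x = 2 *: E (a + 2) x.
Hypothesis kE : forall a, killing_on U G (E a).
Hypothesis saE : forall a, sasakian_on U G (E a).

Let dG x : U x -> differentiable G x. Proof. exact: (sG [::]). Qed.
Let dE l x : U x -> differentiable (E l) x. Proof. exact: (sE l [::]). Qed.
Local Notation dmet := (dmet G).
Local Notation eta_coef := (eta_coef G E).
Local Notation eta := (Defs.eta G E).
Local Notation omega := (Defs.omega G E).

Lemma derive_eta l x u w : U x ->
  'D_u (fun y => ip (G y) (E l y) w) x = dmet x u (E l x) w + ip (G x) ('D_u (E l) x) w.
Proof.
move=> Ux; have := @derive_ip R G (E l) (cst w) x u (dG Ux) (dE l Ux)
   (differentiable_cst _ _).
by rewrite derive_cst ip0r addr0 => ->; rewrite (dmet_ip sG).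
Qed.

Lemma derive_eta_coef l x u w : U x ->
  'D_u (fun y => ip (G y) (E l y) w) x = \sum_j w 0 j * 'D_u (eta_coef l j) x.
Proof.
move=> Ux; have -> : (fun y => ip (G y) (E l y) w) = (fun y => \sum_j eta_coef l j y * w 0 j).
  by apply/funext => y; rewrite ip_coef.
have dc j : differentiable (eta_coef l j) x by apply: (eta_coef_diff sG sE).
rewrite derive_bigsum => [|j]; last first.
  by apply: differentiableM => //; exact: differentiable_cst.
apply: eq_bigr => j _; rewrite (@deriveM _ _ (eta_coef l j) (cst (w 0 j))).
- by rewrite derive_cst scaler0 add0r.
- exact: diff_derivable.
- exact: derivable_cst.
Qed.

Definition cov l x (u : V) : V := 'D_u (E l) x + christoffel G x u (E l x).

(** The Killing equation tested on constant fields. *)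
Lemma killing_dmet l x u w : U x ->
  dmet x (E l x) u w = - ip (G x) ('D_u (E l) x) w - ip (G x) u ('D_w (E l) x).
Proof.
move=> Ux; have := kE l (smooth_cst (U := U) u) (smooth_cst (U := U) w) Ux.
by rewrite /lie !derive_cst !sub0r ipNl ipNr.
Qed.

(** One half of the matrix of d eta_l, so that u |-> nabla_u E_l is given by a
    matrix and is manifestly linear. *)
Definition covm l x : 'M[R]_7 := \matrix_(i, j)
  (2^-1 * ('D_(delta_mx 0 i) (eta_coef l j) x - 'D_(delta_mx 0 j) (eta_coef l i) x)).

Lemma cov_aux (a b c d f : R) : c = - a - f ->
  a + 2^-1 * (b + c - d) = 2^-1 * ((b + a) - (d + f)).
Proof. by move=> ->; lra. Qed.

(** For a Killing field the covariant derivative is skew, so that it equals one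
    half of d eta; the Koszul formula and [killing_dmet] combine to this. *)
Lemma cov_eta l x u w : U x -> ip (G x) (cov l x u) w =
  2^-1 * ('D_u (fun y => ip (G y) (E l y) w) x - 'D_w (fun y => ip (G y) (E l y) u) x).
Proof.
move=> Ux; rewrite !derive_eta // /cov ipDl (christoffel_ip sG rG) //.
rewrite [dmet x w (E l x) u](dmetC oU rG) // [ip _ ('D_w _ _) u]ipC; last exact: (rG Ux).1.
by apply: cov_aux; exact: killing_dmet.
Qed.

Lemma cov_covm l x u : U x -> cov l x u = u *m (covm l x *m invmx (G x)).
Proof.
move=> Ux; have [sGx pGx] := rG Ux; apply: (ip_inj sGx pGx) => w.
rewrite cov_eta // mulmxA ip_invmx; last exact: (metric_unit rG).
rewrite !derive_eta_coef //.
have dc j : differentiable (eta_coef l j) x by apply: (eta_coef_diff sG sE).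
under eq_bigr do rewrite derive_lin //.
under [X in _ - X]eq_bigr do rewrite derive_lin // mulr_sumr.
rewrite [X in _ - X]exchange_big -sumrB mulr_sumr; apply: eq_bigr => j _ /=.
rewrite [(u *m _) _ _]mxE !mulr_sumr -sumrB mulr_sumr; apply: eq_bigr => i _.
rewrite [covm l x i j]mxE /GRing.scale /=; ring.
Qed.

(** The endomorphism u |-> nabla_u E_l, acting on row vectors from the right. *)
Definition Phi l x : 'M[R]_7 := covm l x *m invmx (G x).

Lemma extd_eta_Phi l x v : U x ->
  extd (eta l) x v = 2 * ip (G x) (row 0 v *m Phi l x) (row 1 v).
Proof.
move=> Ux; rewrite -cov_covm // cov_eta // mulrA divff ?pnatr_eq0 // mul1r.
rewrite /extd !big_ord_recl big_ord0 addr0 expr0 mul1r expr1 mulN1r.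
have -> : row' ord0 v = row 1 v.
  by apply/rowP => j; rewrite !mxE; congr (v _ _); apply/val_inj.
have -> : row' (lift ord0 ord0) v = row 0 v.
  by apply/rowP => j; rewrite !mxE; congr (v _ _); apply/val_inj.
by have -> : lift ord0 (ord0 : 'I_1) = 1 :> 'I_2 by apply/val_inj.
Qed.

Lemma Phi_skew l x u w : U x -> ip (G x) (u *m Phi l x) w = - ip (G x) u (w *m Phi l x).
Proof.
move=> Ux; rewrite [ip _ u _]ipC; last exact: (rG Ux).1.
by rewrite -!(cov_covm _ _ Ux) !(cov_eta _ _ _ Ux) -mulrN opprB.
Qed.

(** Differentiate the constant function g(E_l, E_m). *)
Lemma ip_cov_on x l m u : U x ->
  ip (G x) (u *m Phi l x) (E m x) + ip (G x) (E l x) (u *m Phi m x) = 0.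
Proof.
move=> Ux; have sGx := (rG Ux).1.
have D : 'D_u (fun y => ip (G y) (E l y) (E m y)) x = 0.
  rewrite (near_eq_derive (g := cst ((l == m)%:R : R))) ?derive_cst //.
  by apply: (open_near oU Ux) => y Uy; exact: onE.
move: D; rewrite (derive_ip u (dG Ux) (dE l Ux) (dE m Ux)) -(dmet_ip sG) //.
rewrite -!cov_covm // /cov ipDl ipDr !(christoffel_ip sG rG) //.
rewrite [ip _ (E l x) (christoffel _ _ _ _)]ipC // (christoffel_ip sG rG) //.
rewrite [dmet x u (E m x) (E l x)](dmetC oU rG) // [dmet x (E m x) u (E l x)](dmetC oU rG) //.
rewrite [dmet x (E l x) u (E m x)](dmetC oU rG) //.
rewrite [dmet x (E l x) (E m x) u](dmetC oU rG) //.
rewrite [dmet x (E m x) (E l x) u](dmetC oU rG) //.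
set a := dmet _ _ _ _; set b := dmet _ _ _ _; set c := dmet _ _ _ _.
by move=> H; rewrite -[RHS]H; lra.
Qed.

Lemma Phi_antisym x l m : U x -> E m x *m Phi l x = - (E l x *m Phi m x).
Proof.
move=> Ux; have [sGx pGx] := rG Ux; apply: (ip_inj sGx pGx) => w.
rewrite ipNl (Phi_skew l _ w Ux) (Phi_skew m _ w Ux) opprK.
have := ip_cov_on l m w Ux; rewrite (ipC _ (E m x) sGx) => /eqP.
by rewrite addrC addr_eq0 => /eqP ->.
Qed.

Lemma Phi_diag x l : U x -> E l x *m Phi l x = 0.
Proof.
move=> Ux; have /eqP := Phi_antisym l l Ux.
rewrite -addr_eq0 -mulr2n => /eqP H; apply/rowP => j.
have /rowP /(_ j) := H; rewrite mulr2n !mxE => /eqP.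
by rewrite -mulr2n mulrn_eq0 /= => /eqP.
Qed.

(** The bracket relation [E_l, E_(l+1)] = 2 E_(l+2) is the antisymmetrization of
    the covariant derivative, and [Phi_antisym] makes both terms equal. *)
Lemma Phi_next x l : U x -> E l x *m Phi (l + 1) x = E (l + 2) x.
Proof.
move=> Ux; have := lieE Ux l; rewrite /lie.
have -> : 'D_(E l x) (E (l + 1)) x - 'D_(E (l + 1) x) (E l) x =
   cov (l + 1) x (E l x) - cov l x (E (l + 1) x).
  rewrite /cov (christoffelC oU sG rG (E l x) _ Ux) opprD addrACA subrr addr0 //.
rewrite !(cov_covm _ _ Ux) -/(Phi _ _) (Phi_antisym l (l + 1) Ux) opprK -mulr2n -scaler_nat.
by move/(scalerI _); apply; rewrite pnatr_eq0.
Qed.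

Lemma Phi_prev x l : U x -> E (l + 1) x *m Phi l x = - E (l + 2) x.
Proof. by move=> Ux; rewrite (Phi_antisym l (l + 1) Ux) (Phi_next _ Ux). Qed.

(** The Sasakian identity of E_l with the first field constant and the second one
    equal to E_m, in the situation where nabla_(E_m) E_l is a known field F.
    Taking F = 0 and F = E_(l+2) gives the products of the Phi_l. *)
Lemma sasakian_Phi l m x u : U x -> forall F : V -> V,
  (forall y, U y -> E m y *m Phi l y = F y) ->
  nabla G (cst u) F x - u *m Phi m x *m Phi l x
  = ip (G x) (E l x) (E m x) *: u - ip (G x) u (E m x) *: E l x.
Proof.
move=> Ux F FE; have [sGx _] := rG Ux; rewrite (ipC u (E m x) sGx).
have S : nabla G (cst u) (nabla G (E m) (E l)) x
   - nabla G (nabla G (cst u) (E m)) (E l) x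
   = ip (G x) (E l x) (E m x) *: u - ip (G x) u (E m x) *: E l x
  := saE l (smooth_cst (U := U) u) (sE m) Ux.
have N1 : nabla G (cst u) (nabla G (E m) (E l)) x = nabla G (cst u) F x.
  have FE' y : U y -> nabla G (E m) (E l) y = F y.
    move=> Uy; rewrite -(FE _ Uy); exact: (cov_covm l _ Uy).
  exact: (@nabla_eq R U G oU _ _ _ _ Ux FE').
have N2 : nabla G (nabla G (cst u) (E m)) (E l) x = u *m Phi m x *m Phi l x.
  rewrite -(cov_covm m u Ux); exact: (cov_covm l _ Ux).
by rewrite -N1 -N2 S (ipC u (E m x) sGx).
Qed.

Lemma nabla_E x l u : U x -> nabla G (cst u) (E l) x = u *m Phi l x.
Proof. move=> Ux; exact: (cov_covm l u Ux). Qed.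

Lemma nabla_0 x u : U x -> nabla G (cst u) (cst 0) x = 0.
Proof.
move=> Ux; have [sGx pGx] := rG Ux; apply: (ip_inj sGx pGx) => w.
rewrite /nabla derive_cst add0r (christoffel_ip sG rG _ _ _ Ux) ip0l.
rewrite (dmet_ip sG u _ _ Ux) (dmet_ip sG w _ _ Ux) ip0l ip0r.
have -> : dmet x (cst 0 x) (cst u x) w = 0 by exact: derive0.
by rewrite addr0 subrr mulr0.
Qed.

Lemma Phi_sq x l u : U x ->
  u *m Phi l x *m Phi l x = - u + ip (G x) u (E l x) *: E l x.
Proof.
move=> Ux; have H : forall y, U y -> E l y *m Phi l y = (cst 0 : V -> V) y.
  by move=> y Uy; exact: Phi_diag.
have := sasakian_Phi u Ux H; rewrite (nabla_0 _ Ux) (onE Ux) eqxx scale1r sub0r.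
by move/eqP; rewrite eqr_oppLR opprB addrC => /eqP.
Qed.

Lemma Phi_mul_next x l u : U x ->
  u *m Phi l x *m Phi (l + 1) x = u *m Phi (l + 2) x + ip (G x) u (E l x) *: E (l + 1) x.
Proof.
move=> Ux; have H : forall y, U y -> E l y *m Phi (l + 1) y = E (l + 2) y.
  by move=> y Uy; exact: Phi_next.
have := sasakian_Phi u Ux H; rewrite (nabla_E _ _ Ux) (onE Ux).
have -> : (l + 1 == l) = false by rewrite -subr_eq0 addrAC subrr add0r oner_eq0.
rewrite scale0r sub0r => N.
by rewrite -[_ *: E (l + 1) x]opprK -N opprB [RHS]addrC subrK.
Qed.

(** The transpose of [Phi_mul_next]. *)
Lemma Phi_mul_prev x l u : U x ->
  u *m Phi (l + 1) x *m Phi l x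
  = - (u *m Phi (l + 2) x) + ip (G x) u (E (l + 1) x) *: E l x.
Proof.
move=> Ux; have [sGx pGx] := rG Ux; apply: (ip_inj sGx pGx) => w.
rewrite (Phi_skew l _ w Ux) (Phi_skew (l + 1) _ _ Ux) opprK (Phi_mul_next l w Ux).
rewrite ipDr ipZr ipDl ipNl ipZl (Phi_skew (l + 2) u w Ux) opprK.
by rewrite (ipC w (E l x) sGx) mulrC.
Qed.

End Sasakian.

Transparent ip.

Lemma I3P (l : 'I_3) : l = 0 \/ l = 1 \/ l = 2.
Proof.
case: l => -[|[|[|//]]] i; [left|right; left|right; right]; exact/val_inj.
Qed.

Section Frame.
Variable R : realType.
Local Notation V := 'rV[R]_7.
(* An orthonormal triple with the endomorphisms of a 3-Sasakian structure *)
Variables (g : 'M[R]_7) (e : 'I_3 -> V) (P : 'I_3 -> 'M[R]_7).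
Hypothesis sg : g^T = g.
Hypothesis pg : forall u : V, u != 0 -> 0 < ip g u u.
Hypothesis one : forall a b, ip g (e a) (e b) = (a == b)%:R.
Hypothesis skewP : forall l u w, ip g (u *m P l) w = - ip g u (w *m P l).
Hypothesis eP0 : forall l, e l *m P l = 0.
Hypothesis eP1 : forall l, e l *m P (l + 1) = e (l + 2).
Hypothesis eP2 : forall l, e (l + 1) *m P l = - e (l + 2).
Hypothesis PP0 : forall l u, u *m P l *m P l = - u + ip g u (e l) *: e l.
Hypothesis PP1 : forall l u, u *m P l *m P (l + 1) = u *m P (l + 2) + ip g u (e l) *: e (l + 1).
Hypothesis PP2 : forall l u, u *m P (l + 1) *m P l
  = - (u *m P (l + 2)) + ip g u (e (l + 1)) *: e l.

(** Three linear conditions on seven coordinates have a nonzero solution. *)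
Lemma horizontal_unit : exists h : V, ip g h h = 1 /\ forall l, ip g h (e l) = 0.
Proof.
pose A : 'M[R]_(7, 3) := g *m (\matrix_l e l)^T.
have kA : kermx A != 0.
  rewrite kermx_eq0 /row_free; apply/eqP => rA.
  by have := rank_leq_col A; rewrite rA.
have /rowV0Pn[u uA u0] := kA.
have uu := pg u0; pose s := Num.sqrt (ip g u u).
have s0 : 0 < s by rewrite sqrtr_gt0.
have uE l : ip g u (e l) = 0.
  move/sub_kermxP: uA => /rowP /(_ l); rewrite mulmxA [in RHS]mxE => <-.
  rewrite ip_coef [RHS]mxE; apply: eq_bigr => j _.
  by rewrite [(_^T) _ _]mxE [(\matrix_l _) _ _]mxE.
exists (s^-1 *: u); split=> [|l]; last by rewrite ipZl uE mulr0.
by rewrite ipZl ipZr mulrA -invfM -expr2 sqr_sqrtr ?ltW // mulVf // gt_eqF.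
Qed.

Variable h : V.
Hypothesis hh : ip g h h = 1.
Hypothesis he : forall l, ip g h (e l) = 0.

(** The signs of the last three vectors make omega_l equal to
    e_3 e_(4+l) + e_(4+(l+1)) e_(4+(l+2)), where l + 1 and l + 2 are taken
    modulo 3. *)
Definition adapted (a : nat) : V :=
  nth 0 [:: e 0; e 1; e 2; h; - (h *m P 0); - (h *m P 1); - (h *m P 2)] a.

Let s1 : (0 + 1 : 'I_3) = 1. Proof. exact/val_inj. Qed.
Let s2 : (1 + 1 : 'I_3) = 2. Proof. exact/val_inj. Qed.
Let s3 : (2 + 1 : 'I_3) = 0. Proof. exact/val_inj. Qed.
Let s4 : (0 + 2 : 'I_3) = 2. Proof. exact/val_inj. Qed.
Let s5 : (1 + 2 : 'I_3) = 0. Proof. exact/val_inj. Qed.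
Let s6 : (2 + 2 : 'I_3) = 1. Proof. exact/val_inj. Qed.
(* Addition of indices is modulo 3. *)
Let ss := (s1, s2, s3, s4, s5, s6).

Let eP : ((e 0 *m P 0 = 0) * (e 1 *m P 1 = 0) * (e 2 *m P 2 = 0) *
  (e 0 *m P 1 = e 2) * (e 1 *m P 2 = e 0) * (e 2 *m P 0 = e 1) *
  (e 1 *m P 0 = - e 2) * (e 2 *m P 1 = - e 0) * (e 0 *m P 2 = - e 1))%type.
Proof.
have := eP1 0; have := eP1 1; have := eP1 2.
have := eP2 0; have := eP2 1; have := eP2 2; rewrite !ss.
by do 6!move=> ->; rewrite !eP0.
Qed.

Let hP : ((h *m P 0 *m P 0 = - h) * (h *m P 1 *m P 1 = - h) * (h *m P 2 *m P 2 = - h) *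
  (h *m P 0 *m P 1 = h *m P 2) * (h *m P 1 *m P 2 = h *m P 0) * (h *m P 2 *m P 0 = h *m P 1) *
  (h *m P 1 *m P 0 = - (h *m P 2)) * (h *m P 2 *m P 1 = - (h *m P 0))
  * (h *m P 0 *m P 2 = - (h *m P 1)))%type.
Proof.
have := PP1 0 h; have := PP1 1 h; have := PP1 2 h.
have := PP2 0 h; have := PP2 1 h; have := PP2 2 h.
rewrite !ss !he !scale0r !addr0.
by do 6!move=> ->; rewrite !PP0 !he !scale0r !addr0.
Qed.

Let hPe l m : ip g (h *m P l) (e m) = 0.
Proof.
rewrite skewP; have [->|[->|->]] := I3P l; have [->|[->|->]] := I3P m;
  by rewrite eP ?ip0r ?ipNr ?he ?oppr0.
Qed.

Let ehP l m : ip g (e m) (h *m P l) = 0. Proof. by rewrite (ipC _ _ sg). Qed.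
Let eh m : ip g (e m) h = 0. Proof. by rewrite (ipC _ _ sg). Qed.

Let hPh l : ip g (h *m P l) h = 0.
Proof.
have := skewP l h h; rewrite [ip g h _](ipC _ _ sg) => /eqP.
by rewrite -addr_eq0 -mulr2n mulrn_eq0 /= => /eqP.
Qed.

Let hhP l : ip g h (h *m P l) = 0. Proof. by rewrite (ipC _ _ sg). Qed.

Let hPhP l m : ip g (h *m P l) (h *m P m) = (l == m)%:R.
Proof.
rewrite skewP; have [->|[->|->]] := I3P l; have [->|[->|->]] := I3P m;
  by rewrite hP ?ipNr ?hh ?hhP ?opprK ?oppr0.
Qed.

Lemma adapted_on a b : (a < 7)%N -> (b < 7)%N ->
  ip g (adapted a) (adapted b) = (a == b)%:R.
Proof.
rewrite /adapted.
move: a b => [|[|[|[|[|[|[|//]]]]]]] [|[|[|[|[|[|[|//]]]]]]] _ _ /=;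
  by rewrite ?ipNl ?ipNr ?(one, hPe, ehP, eh, he, hh, hPh, hhP, hPhP) ?opprK ?oppr0.
Qed.

(** The matrix of Phi_l in the adapted frame: each row has at most one nonzero
    entry, recorded with its column. *)
Definition Phi_tab (l : 'I_3) (a : nat) : int * nat :=
  nth (0, 0%N) (nth [::]
   [:: [:: (0, 0%N); (-1, 2%N); (1, 1%N); (-1, 4%N); (1, 3%N); (-1, 6%N); (1, 5%N)];
       [:: (1, 2%N); (0, 0%N); (-1, 0%N); (-1, 5%N); (1, 6%N); (1, 3%N); (-1, 4%N)];
       [:: (-1, 1%N); (1, 0%N); (0, 0%N); (-1, 6%N); (-1, 5%N); (1, 4%N); (1, 3%N)]]
   l) a.

Lemma adapted_Phi l a : (a < 7)%N ->
  adapted a *m P l = (Phi_tab l a).1%:~R *: adapted (Phi_tab l a).2.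
Proof.
rewrite /adapted; have [->|[->|->]] := I3P l;
move: a => [|[|[|[|[|[|[|//]]]]]]] _ /=;
  by rewrite ?mulNmx ?eP ?hP ?opprK ?scale0r ?mulrN1z ?mulr1z ?scale1r ?scaleN1r ?opprK.
Qed.

Definition frame_mx : 'M[R]_7 := \matrix_(a < 7) adapted a.

Lemma frame_on : frame_mx *m g *m frame_mx^T = 1%:M.
Proof.
apply/matrixP => a b; rewrite [RHS]mxE -[RHS](adapted_on (ltn_ord a) (ltn_ord b)).
have -> : adapted a = row a frame_mx by rewrite rowK.
have -> : adapted b = row b frame_mx by rewrite rowK.
by rewrite ip_coef [LHS]mxE; apply: eq_bigr => j _; rewrite -row_mul !mxE.
Qed.

Lemma frame_unit : frame_mx \in unitmx.
Proof. by have [] := mulmx1_unit frame_on; rewrite unitmx_mul => /andP[]. Qed.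

Definition coframe_mx : 'M[R]_7 := invmx frame_mx.

Lemma coframe_metric : g = coframe_mx *m coframe_mx^T.
Proof.
have := frame_on; move/(congr1 (fun X => coframe_mx *m X *m coframe_mx^T)).
rewrite mulmx1 -!mulmxA -trmx_mul mulVmx ?frame_unit // trmx1 mulmx1.
by rewrite mulKmx // frame_unit.
Qed.

Lemma coframe_expand (u : V) :
  u = \sum_(a < 7) (u *m coframe_mx) 0 a *: adapted a.
Proof.
rewrite -{1}[u](mulmxKV frame_unit) mulmx_sum_row; apply: eq_bigr => a _.
by rewrite rowK.
Qed.

Lemma coframe_ip a (w : V) : (a < 7)%N ->
  ip g (adapted a) w = (w *m coframe_mx) 0 (inord a).
Proof.
move=> a7; rewrite {1}(coframe_expand w) /ip linear_sum mulmx_sumr summxE.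
rewrite (bigD1 (inord a)) //= linearZ /= -scalemxAr mxE -/(ip _ _ _).
rewrite adapted_on ?ltn_ord // inordK // eqxx mulr1 big1 ?addr0 // => b ba.
rewrite linearZ /= -scalemxAr mxE -/(ip _ _ _) adapted_on ?ltn_ord //.
case: eqP => [ab|]; last by rewrite mulr0.
by move/eqP: ba; case; apply/val_inj; rewrite /= inordK.
Qed.

Lemma coframe_Phi l (u w : V) : ip g (u *m P l) w =
  \sum_(a < 7) (Phi_tab l a).1%:~R * (u *m coframe_mx) 0 a *
     (w *m coframe_mx) 0 (inord (Phi_tab l a).2).
Proof.
rewrite {1}(coframe_expand u) /ip !mulmx_suml summxE; apply: eq_bigr => a _.
rewrite -!scalemxAl mxE -/(ip _ _ _) adapted_Phi ?ltn_ord // ipZl coframe_ip.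
  by rewrite mulrCA mulrA.
case: a => a a7; have [->|[->|->]] := I3P l; by move: a a7 => [|[|[|[|[|[|[|//]]]]]]].
Qed.

Lemma coframe_e l (w : V) : ip g (e l) w = (w *m coframe_mx) 0 (inord l).
Proof.
have -> : e l = adapted l by have [->|[->|->]] := I3P l.
by rewrite coframe_ip // (leq_trans (ltn_ord l)).
Qed.

End Frame.

Section CoframeField.
Variable R : realType.
Local Notation V := 'rV[R]_7.

Lemma mono1 (C : 'M[R]_7) a (v : 'M[R]_(1, 7)) :
  mono C [:: a] v = (v *m C) 0 (inord a).
Proof.
by rewrite /mono /decform det_mx11 !mxE; apply: eq_bigr => j _; rewrite !mxE.
Qed.

Lemma mono2 (C : 'M[R]_7) a b (v : 'M[R]_(2, 7)) :
  mono C [:: a; b] v = (row 0 v *m C) 0 (inord a) * (row 1 v *m C) 0 (inord b)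
   - (row 0 v *m C) 0 (inord b) * (row 1 v *m C) 0 (inord a).
Proof.
have E i (q : 'I_2) : (v *m sel 2 C [:: a; b]) i q =
   (row i v *m C) 0 (inord (nth 0%N [:: a; b] q)).
  by rewrite !mxE; apply: eq_bigr => j _; rewrite !mxE.
rewrite /mono /decform (expand_det_row _ 0) !big_ord_recl big_ord0 /cofactor !det_mx11.
have F (M : 'M[R]_2) q : row' 0 (col' q M) 0 0 = M (lift 0 0) (lift q 0).
  by rewrite !mxE.
rewrite !F.
have -> : lift ord0 (0 : 'I_1) = 1 :> 'I_2 by apply/val_inj.
have -> : lift (1 : 'I_2) (0 : 'I_1) = 0 by apply/val_inj.
rewrite !E /= addr0 expr0 mul1r expr1 mulN1r mulrN; congr (_ - _).
Qed.

(** With e_0, e_1, e_2 the forms eta, the self-dual forms e_34 + e_56,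
    e_35 + e_64 and e_36 + e_45 in the horizontal directions. *)
Definition omega_comb (l : nat) : comb :=
  nth [::] [:: [:: (1, [:: 3%N; 4%N]); (1, [:: 5%N; 6%N])];
              [:: (1, [:: 3%N; 5%N]); (1, [:: 6%N; 4%N])];
              [:: (1, [:: 3%N; 6%N]); (1, [:: 4%N; 5%N])]] l.

Lemma Phi_tab_omega (y z : nat -> R) (l : 'I_3) :
  - (\sum_(a < 7) (Phi_tab l a).1%:~R * y a * z (Phi_tab l a).2)
  - (y (val (l + 1)) * z (val (l + 2)) - y (val (l + 2)) * z (val (l + 1))) =
  \sum_(p <- omega_comb l) p.1%:~R *
     (y (nth 0%N p.2 0) * z (nth 0%N p.2 1) - y (nth 0%N p.2 1) * z (nth 0%N p.2 0)).
Proof.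
rewrite !big_ord_recl big_ord0.
have [->|[->|->]] := I3P l; rewrite /= !big_cons big_nil /Phi_tab /=
  ?(mulr0z, mulr1z, mulrN1z) /bump /=; ring.
Qed.

Variables (U : set V) (G : V -> 'M[R]_7) (E : 'I_3 -> V -> V).
Hypothesis oU : open U.
Hypothesis sG : smooth_on U G.
Hypothesis sE : forall l, smooth_on U (E l).
Hypothesis rG : riemannian_on U G.
Hypothesis onE : forall x, U x -> forall a b, ip (G x) (E a x) (E b x) = (a == b)%:R.
Hypothesis lieE : forall x, U x -> forall a, lie (E a) (E (a + 1)) x = 2 *: E (a + 2) x.
Hypothesis kE : forall a, killing_on U G (E a).
Hypothesis saE : forall a, sasakian_on U G (E a).

(** The normal form of a 3-Sasakian structure at a point: in a suitable
    orthonormal coframe, given by the columns of C, the forms eta_l and omega_l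
    are those of the standard model. *)
Lemma adapted_coframe x : U x -> exists C : 'M[R]_7,
  [/\ C \in unitmx, G x = C *m C^T,
      forall l : 'I_3, Defs.eta G E l x = mono C [:: val l] &
      forall l : 'I_3, Defs.omega G E l x = ev C (omega_comb l)].
Proof.
move=> Ux; have [sg pg] := rG Ux.
have skewP l u w := Phi_skew oU sG sE rG kE l u w Ux.
have f0 l := Phi_diag oU sG sE rG onE kE l Ux.
have f1 l := Phi_next oU sG sE rG onE lieE kE l Ux.
have f2 l := Phi_prev oU sG sE rG onE lieE kE l Ux.
have f3 l u := Phi_sq oU sG sE rG onE kE saE l u Ux.
have f4 l u := Phi_mul_next oU sG sE rG onE lieE kE saE l u Ux.
have f5 l u := Phi_mul_prev oU sG sE rG onE lieE kE saE l u Ux.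
have [h [hh he]] := horizontal_unit (fun l => E l x) pg.
have cm := coframe_metric sg (onE Ux) skewP f0 f1 f2 f3 f4 f5 hh he.
have ce := coframe_e sg (onE Ux) skewP f0 f1 f2 f3 f4 f5 hh he.
have cP := coframe_Phi sg (onE Ux) skewP f0 f1 f2 f3 f4 f5 hh he.
have fu := frame_unit sg (onE Ux) skewP f0 f1 f2 f3 f4 f5 hh he.
set C := coframe_mx _ _ _ in cm ce cP.
have eE l : Defs.eta G E l x = mono C [:: val l].
  by apply/funext => v; rewrite mono1; exact: ce.
exists C; split=> //; first by rewrite unitmx_inv.
move=> l; apply/funext => v.
have -> : Defs.omega G E l x v = - ip (G x) (row 0 v *m Phi G E l x) (row 1 v)
    - wedge (Defs.eta G E (l + 1)) (Defs.eta G E (l + 2)) x v.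
  rewrite /Defs.omega (extd_eta_Phi oU sG sE rG kE l v Ux) mulNr mulrDr.
  by rewrite !mulrA mulVf ?pnatr_eq0 // !mul1r opprD.
rewrite cP wedgeE !eE (@mono_wedge _ 1 1) // cat1s mono2.
pose y a := (row 0 v *m C) 0 (inord a); pose z a := (row 1 v *m C) 0 (inord a).
have -> : \sum_(a < 7) (Phi_tab l a).1%:~R * (row 0 v *m C) 0 a *
    (row 1 v *m C) 0 (inord (Phi_tab l a).2)
  = \sum_(a < 7) (Phi_tab l a).1%:~R * y a * z (Phi_tab l a).2.
  by apply: eq_bigr => a _; rewrite /y inord_val.
rewrite -/(y _) -/(y _) -/(z _) -/(z _) Phi_tab_omega /ev !big_seq.
apply: eq_bigr => -[c s] cs; congr (_ * _).
have hom : homog 2 (omega_comb l) by have [->|[->|->]] := I3P l.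
have /= := allP hom _ cs.
by case: s {cs} => [|a [|b [|]]] // _; rewrite mono2.
Qed.

End CoframeField.

(** * Structure equations, induced metric and Hodge star *)

(** The index lists of eta, of d eta and of d omega (by the structure
    equations), and of the products that occur in the family. *)
Definition etaL (l : 'I_3) : comb := [:: (1, [:: val l])].
Definition detaL (l : 'I_3) : comb :=
  scal (-2) (mulc (etaL (l + 1)) (etaL (l + 2))) ++ scal (-2) (omega_comb l).
Definition domegaL (l : 'I_3) : comb :=
  scal (-1) (mulc (detaL (l + 1)) (etaL (l + 2))) ++ mulc (etaL (l + 1)) (detaL (l + 2)).
Definition eta123L : comb := mulc (mulc (etaL 0) (etaL 1)) (etaL 2).
Definition mixed3L l : comb := mulc (etaL l) (omega_comb l).
Definition mixed4L (l : 'I_3) : comb := mulc (mulc (etaL (l + 1)) (etaL (l + 2))) (omega_comb l).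
Definition omega_sqL : comb := mulc (omega_comb 0) (omega_comb 0).

Lemma homog_omega (l : 'I_3) : homog 2 (omega_comb l).
Proof. by have [->|[->|->]] := I3P l. Qed.
Lemma homog_detaL l : homog 2 (detaL l).
Proof. by have [->|[->|->]] := I3P l. Qed.

Section StructureEquations.
Variable R : realType.
Local Notation V := 'rV[R]_7.
Local Notation form := (@Defs.form R).
Variables (U : set V) (G : V -> 'M[R]_7) (E : 'I_3 -> V -> V).
Local Notation eta := (Defs.eta G E).
Local Notation omega := (Defs.omega G E).
Hypothesis oU : open U.
Hypothesis dfe : forall l, dform U (eta l).
Hypothesis dfo : forall l, dform U (omega l).
Hypothesis domegaE : forall l x, U x -> extd (omega l) x = fun v =>
  - wedge (extd (eta (l + 1))) (eta (l + 2)) x v +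
  (wedge (eta (l + 1)) (extd (eta (l + 2))) : form 3) x v.

Definition eta123 : form 3 := wedge (wedge (eta 0) (eta 1)) (eta 2).
(** The products eta_l /\ omega_l and eta_j /\ eta_k /\ omega_l; with [eta123] and
    [omega_sq] they span the forms of the family and their differentials. *)
Definition mixed3 l : form 3 := wedge (eta l) (omega l).
Definition mixed4 l : form 4 := wedge (wedge (eta (l + 1)) (eta (l + 2))) (omega l).
Definition omega_sq : form 4 := wedge (omega 0) (omega 0).

Lemma dform_eta_eta l m : dform U (wedge (eta l) (eta m)).
Proof. exact: dform_wedge. Qed.
Lemma dform_eta123 : dform U eta123.
Proof. apply: (@dform_wedge _ _ 2 1); [exact: dform_eta_eta|exact: dfe]. Qed.
Lemma dform_mixed3 l : dform U (mixed3 l). Proof. exact: (@dform_wedge _ _ 1 2). Qed.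
Lemma dform_mixed4 l : dform U (mixed4 l).
Proof. apply: (@dform_wedge _ _ 2 2); [exact: dform_eta_eta|exact: dfo]. Qed.
Lemma dform_omega_sq : dform U omega_sq. Proof. exact: (@dform_wedge _ _ 2 2). Qed.

Section AtPoint.
Variables (x : V) (C : 'M[R]_7).
Hypothesis Ux : U x.
Hypothesis etaC : forall l, eta l x = mono C [:: val l].
Hypothesis omegaC : forall l, omega l x = ev C (omega_comb l).

Lemma intr_N2 : (-2 : int)%:~R = - 2 :> R. Proof. by rewrite mulrNz. Qed.

Lemma intr_2 : (2 : int)%:~R = 2 :> R. Proof. by []. Qed.

Lemma eta_ev l : eta l x = ev C (etaL l).
Proof. by rewrite etaC; apply/funext => v; rewrite /ev big_seq1 mul1r. Qed.

Lemma ee_ev l m : wedge (eta l) (eta m) x = ev C (mulc (etaL l) (etaL m)).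
Proof. by rewrite wedgeE !eta_ev (@wedge_ev _ 1 1). Qed.

Lemma deta_ev l : extd (eta l) x = ev C (detaL l).
Proof.
apply/funext => v; rewrite extd_eta ee_ev omegaC /detaL ev_cat !ev_scal.
by rewrite intr_N2 -mulNr.
Qed.

Lemma domega_ev l : extd (omega l) x = ev C (domegaL l).
Proof.
rewrite domegaE //; apply/funext => v; rewrite !wedgeE !deta_ev !eta_ev.
rewrite (@wedge_ev _ 2 1) ?homog_detaL // (@wedge_ev _ 1 2) //.
by rewrite /domegaL ev_cat ev_scal mulN1r.
Qed.

Lemma eta123_ev : eta123 x = ev C eta123L.
Proof. by rewrite /eta123 wedgeE ee_ev eta_ev (@wedge_ev _ 2 1). Qed.
Lemma mixed3_ev l : mixed3 l x = ev C (mixed3L l).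
Proof. by rewrite /mixed3 wedgeE eta_ev omegaC (@wedge_ev _ 1 2). Qed.
Lemma mixed4_ev l : mixed4 l x = ev C (mixed4L l).
Proof. by rewrite /mixed4 wedgeE ee_ev omegaC (@wedge_ev _ 2 2). Qed.
Lemma omega_sq_ev : omega_sq x = ev C omega_sqL.
Proof. by rewrite /omega_sq wedgeE !omegaC (@wedge_ev _ 2 2) // homog_omega. Qed.

Lemma dee_ev l m : extd (wedge (eta l) (eta m)) x =
  ev C (mulc (detaL l) (etaL m) ++ scal (-1) (mulc (etaL l) (detaL m))).
Proof.
rewrite (leibniz1 oU Ux) //; apply/funext => v; rewrite !wedgeE !deta_ev !eta_ev.
rewrite (@wedge_ev _ 2 1) ?homog_detaL // (@wedge_ev _ 1 2) //.
by rewrite ev_cat ev_scal mulN1r.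
Qed.

Lemma ev4 k L1 L2 L3 L4 (v : 'M[R]_(k, 7)) :
  - 2 * ev C L1 v - 2 * ev C L2 v + 2 * ev C L3 v + 2 * ev C L4 v
  = ev C (scal (-2) L1 ++ scal (-2) L2 ++ scal 2 L3 ++ scal 2 L4) v.
Proof. by rewrite !ev_cat !ev_scal intr_N2 intr_2 !mulNr !addrA. Qed.

(** The differentials of the four basic products follow from the Leibniz rule
    and a computation with index lists. *)
Lemma extd_eta123 : extd eta123 x = fun v => - 2 * (mixed4 0 x v + mixed4 1 x v + mixed4 2 x v).
Proof.
rewrite /eta123 (leibniz2 oU Ux (dform_eta_eta 0 1) (dfe 2)); apply/funext => v.
rewrite !wedgeE dee_ev deta_ev !eta_ev (@wedge_ev _ 1 1) //.
rewrite (@wedge_ev _ 3 1) // (@wedge_ev _ 2 2) // -ev_cat !mixed4_ev -!ev_cat.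
rewrite -intr_N2 -ev_scal; apply: (congr1 (fun f => f v)); apply: eqcP => //.
Qed.

Lemma extd_mixed3 l : extd (mixed3 l) x = fun v =>
  - 2 * omega_sq x v - 2 * mixed4 l x v + 2 * mixed4 (l + 1) x v + 2 * mixed4 (l + 2) x v.
Proof.
rewrite /mixed3 (leibniz1 oU Ux (dfe l) (dfo l)); apply/funext => v.
rewrite !wedgeE deta_ev domega_ev eta_ev omegaC.
rewrite (@wedge_ev _ 2 2) ?homog_detaL // (@wedge_ev _ 1 3) // !mixed4_ev omega_sq_ev.
have -> : ev C (mulc (detaL l) (omega_comb l)) v - ev C (mulc (etaL l) (domegaL l)) v
  = ev (k := 4) C (mulc (detaL l) (omega_comb l)
       ++ scal (-1) (mulc (etaL l) (domegaL l))) v by rewrite ev_cat ev_scal mulN1r.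
rewrite ev4.
apply: (congr1 (fun f => f v)); have [->|[->|->]] := I3P l; exact: eqcP.
Qed.

Lemma ev_nil k (v : 'M[R]_(k, 7)) : ev C [::] v = 0.
Proof. by rewrite /ev big_nil. Qed.

Lemma extd_mixed4 l : extd (mixed4 l) x = fun=> 0.
Proof.
rewrite /mixed4 (leibniz2 oU Ux (dform_eta_eta (l + 1) (l + 2)) (dfo l)); apply/funext => v.
rewrite !wedgeE dee_ev domega_ev !eta_ev (@wedge_ev _ 1 1) // omegaC.
rewrite (@wedge_ev _ 3 2) ?(@wedge_ev _ 2 3) //; last first.
  by have [->|[->|->]] := I3P l.
rewrite -ev_cat -(ev_nil (k := 5) v); apply: (congr1 (fun f => f v)).
by have [->|[->|->]] := I3P l; exact: eqcP.
Qed.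

Lemma extd_omega_sq : extd omega_sq x = fun=> 0.
Proof.
rewrite /omega_sq (leibniz2 oU Ux (dfo 0) (dfo 0)); apply/funext => v.
rewrite !wedgeE domega_ev omegaC (@wedge_ev _ 3 2) // (@wedge_ev _ 2 3) //.
rewrite -ev_cat -(ev_nil (k := 5) v); apply: (congr1 (fun f => f v)).
exact: eqcP.
Qed.

End AtPoint.

(** The 3-forms of the family, and the 4-forms that occur as their differentials
    and duals; every omega_l /\ omega_l is twice the horizontal volume form. *)
Definition cubic (p q r : R) : form 3 :=
  fun x v => p * eta123 x v - q * (mixed3 0 x v + mixed3 1 x v) - r * mixed3 2 x v.
Definition quartic (p q r : R) : form 4 :=
  fun x v => p * omega_sq x v + q * (mixed4 0 x v + mixed4 1 x v) + r * mixed4 2 x v.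

End StructureEquations.

Section Star.
Variable R : realType.
Local Notation V := 'rV[R]_7.

(** Rescaling the coframe by a on eta_1, eta_2, by b on eta_3 and by c on the
    horizontal part. *)
Definition weights (a b c : R) : 'rV[R]_7 :=
  \row_i nth 1 [:: a; a; b; c; c; c; c] i.

Definition scaled (C : 'M[R]_7) a b c : 'M[R]_7 := C *m diag_mx (weights a b c).

Definition weight (a b c : R) (s : seq nat) : R :=
  \prod_(i <- s) nth 1 [:: a; a; b; c; c; c; c] i.

Lemma mono_scaled k C a b c s (v : 'M[R]_(k, 7)) : size s = k ->
  all (fun i => i < 7)%N s ->
  mono (scaled C a b c) s v = weight a b c s * mono C s v.
Proof.
move=> sk /allP rs; rewrite /mono /decform.
have -> : sel k (scaled C a b c) s = sel k C s *m
    diag_mx (\row_(q < k) nth 1 [:: a; a; b; c; c; c; c] (nth 0%N s q)).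
  apply/matrixP => i q; rewrite [LHS]mxE /scaled !mul_mx_diag !mxE inordK //.
  by apply: rs; rewrite mem_nth ?sk.
rewrite mulmxA det_mulmx det_diag mulrC; congr (_ * _).
rewrite /weight (big_nth 0%N) sk big_mkord; apply: eq_bigr => q _; by rewrite mxE.
Qed.

Lemma ev_scaled k C a b c w L (v : 'M[R]_(k, 7)) : homog k L -> inrange L ->
  (forall p, p \in L -> weight a b c p.2 = w) ->
  ev (scaled C a b c) L v = w * ev C L v.
Proof.
move=> /allP hL /allP rL Hw; rewrite /ev mulr_sumr !big_seq; apply: eq_bigr => p pL.
by rewrite mono_scaled ?(eqP (hL _ pL)) ?rL // (Hw _ pL) mulrCA.
Qed.

Lemma eta123_scaled C a b c v : ev (k := 3) (scaled C a b c) eta123L v = a ^+ 2 * b * ev C eta123L v.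
Proof.
apply: ev_scaled => // p; rewrite inE => /eqP ->.
by rewrite /weight !big_cons big_nil /=; ring.
Qed.
Lemma mixed3_scaled C a b c v (l : 'I_3) : ev (k := 3) (scaled C a b c) (mixed3L l) v =
   (if l == 2 then b else a) * c ^+ 2 * ev C (mixed3L l) v.
Proof.
have [->|[->|->]] := I3P l; apply: ev_scaled => // p; rewrite !inE => /orP[] /eqP ->;
by rewrite /weight !big_cons big_nil /=; ring.
Qed.
Lemma mixed4_scaled C a b c v (l : 'I_3) : ev (k := 4) (scaled C a b c) (mixed4L l) v =
   (if l == 2 then a ^+ 2 else a * b) * c ^+ 2 * ev C (mixed4L l) v.
Proof.
have [->|[->|->]] := I3P l; apply: ev_scaled => // p; rewrite !inE => /orP[] /eqP ->;
by rewrite /weight !big_cons big_nil /=; ring.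
Qed.
Lemma omega_sq_scaled C a b c v : ev (k := 4) (scaled C a b c) omega_sqL v = c ^+ 4 * ev C omega_sqL v.
Proof.
apply: ev_scaled => // p; rewrite !inE.
by rewrite /weight; case/or4P => /eqP ->; rewrite /= !big_cons big_nil /=; ring.
Qed.

(** The standard G_2-form and, in [psiL], its dual. *)
Definition phiL : comb := eta123L ++ scal (-1) (mixed3L 0 ++ mixed3L 1 ++ mixed3L 2).

Definition horizontal_volL : comb := [:: (1, [:: 3; 4; 5; 6]%N)].
Definition psiL : comb := horizontal_volL ++ scal (-1) (mixed4L 0 ++ mixed4L 1 ++ mixed4L 2).

Definition table_entry (i j : nat) :=
  let P := mulc (mulc (contract_idx i phiL) (contract_idx j phiL)) phiL in
  [&& homog 2 (contract_idx i phiL),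
      homog 4 (mulc (contract_idx i phiL) (contract_idx j phiL)), homog 7 P &
      eqc P (if i == j then [:: (6, iota 0 7)] else [::])].

(** The 49 instances of (i_i phi) /\ (i_j phi) /\ phi = 6 delta_ij vol for the
    standard form. *)
Lemma contract_table (i j : 'I_7) : table_entry i j.
Proof.
have H : all (fun i => all (table_entry i) (iota 0 7)) (iota 0 7) by vm_compute.
have I (n : 'I_7) : val n \in iota 0 7 by rewrite mem_iota /=.
exact: (allP (allP H _ (I i)) _ (I j)).
Qed.

Lemma omega_sqL_eqc : eqc omega_sqL (scal 2 horizontal_volL). Proof. by vm_compute. Qed.
Lemma hodge_phiL : eqc (hodge_idx phiL) psiL. Proof. by vm_compute. Qed.
Lemma hodge_horizontal_volL : eqc (hodge_idx horizontal_volL) eta123L. Proof. by vm_compute. Qed.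
Lemma hodge_mixed4L l : eqc (hodge_idx (mixed4L l)) (mixed3L l).
Proof. by have [->|[->|->]] := I3P l; vm_compute. Qed.
Lemma ok_phiL : hodge_ok 3 4 phiL. Proof. by vm_compute. Qed.
Lemma ok_horizontal_volL : hodge_ok 4 3 horizontal_volL. Proof. by vm_compute. Qed.
Lemma ok_mixed4L l : hodge_ok 4 3 (mixed4L l).
Proof. by have [->|[->|->]] := I3P l; vm_compute. Qed.

Lemma ev_phiL (C : 'M[R]_7) v : ev (k := 3) C phiL v =
  ev C eta123L v - (ev C (mixed3L 0) v + ev C (mixed3L 1) v) - ev C (mixed3L 2) v.
Proof.
rewrite /phiL (ev_cat C eta123L) ev_scal (ev_cat C (mixed3L 0)) (ev_cat C (mixed3L 1)).
by rewrite mulN1r addrA opprD addrA.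
Qed.

Lemma ev_psiL (C : 'M[R]_7) v : ev (k := 4) C psiL v =
  ev C horizontal_volL v - (ev C (mixed4L 0) v + ev C (mixed4L 1) v) - ev C (mixed4L 2) v.
Proof.
rewrite /psiL (ev_cat C horizontal_volL) ev_scal (ev_cat C (mixed4L 0)) (ev_cat C (mixed4L 1)).
by rewrite mulN1r addrA opprD addrA.
Qed.

Lemma ev_horizontal_vol (C : 'M[R]_7) v : ev (k := 4) C horizontal_volL v = ev C omega_sqL v / 2.
Proof.
by rewrite (eqcP C _ _ omega_sqL_eqc) // (ev_scal C 2) mulrC mulKf // pnatr_eq0.
Qed.

Section MetricAtPoint.
Variables (C : 'M[R]_7).
Hypothesis uC : C \in unitmx.
Let B := invmx C.
Let BC : B *m C = 1%:M. Proof. exact: mulVmx. Qed.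

(* The metric for which the columns of C are an orthonormal coframe. *)
Let gC := C *m C^T.

Lemma gram_unit : gC \in unitmx. Proof. by rewrite unitmx_mul unitmx_tr uC. Qed.

Lemma invmx_gram : invmx gC = B^T *m B.
Proof.
rewrite -[LHS]mul1mx; apply: (canLR (mulmxK gram_unit)).
by rewrite /gC mulmxA -(mulmxA B^T B C) BC mulmx1 -trmx_mul mulmxV // trmx1.
Qed.

Lemma coframe_sym : gC^T = gC. Proof. by rewrite trmx_mul trmxK. Qed.

Lemma coframe_ipE (u w : V) : ip gC u w = \sum_i (u *m C) 0 i * (w *m C) 0 i.
Proof.
rewrite /ip /gC mulmxA -mulmxA -trmx_mul mxE; apply: eq_bigr => i _.
by rewrite [(_ ^T) _ _]mxE.
Qed.

Lemma coframe_pos (u : V) : u != 0 -> 0 < ip gC u u.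
Proof.
move=> u0; have uC0 : u *m C != 0.
  by apply: contra u0 => /eqP H; rewrite -[u](mulmxK uC) H mul0mx.
rewrite coframe_ipE lt_def; apply/andP; split; last first.
  by apply: sumr_ge0 => i _; rewrite -expr2 sqr_ge0.
rewrite psumr_neq0 => [|i _]; last by rewrite -expr2 sqr_ge0.
have /rV0Pn[i ui] := uC0.
by apply/hasP; exists i; rewrite ?mem_index_enum // -expr2 exprn_even_gt0.
Qed.

Lemma mono_full (v : 'M[R]_7) : mono C (iota 0 7) v = \det C * \det v.
Proof.
rewrite /mono /decform -[RHS]mulrC -det_mulmx; congr (\det (v *m _)).
apply/matrixP => i j; rewrite mxE; congr (C i _).
by rewrite nth_iota ?ltn_ord // add0n inord_val.
Qed.

Lemma decform_row_lin k (N : 'M[R]_(7, k.+1)) (m : 'M[R]_(k, 7)) (T : finType)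
    (a : T -> R) (u : T -> V) :
  decform N (col_mx (\sum_i a i *: u i) m : 'M[R]_(k.+1, 7))
  = \sum_i a i * decform N (col_mx (u i) m : 'M[R]_(k.+1, 7)).
Proof.
have E (w : V) : decform N (col_mx w m : 'M[R]_(k.+1, 7)) = \sum_j (w *m N) 0 j *
   ((-1) ^+ j * \det (col' j (m *m N))).
  rewrite /decform (expand_det_row _ ord0); apply: eq_bigr => j _.
  have EM : (col_mx w m : 'M[R]_(k.+1, 7)) *m N = col_mx (w *m N) (m *m N)
     := @mul_col_mx _ 1 k 7 k.+1 w m N.
  rewrite EM /cofactor add0n; congr (_ * _).
    have -> : ord0 = lshift k ord0 :> 'I_(1 + k) by apply/val_inj.
    by rewrite [LHS]mxE (unsplitK (inl ord0 : 'I_1 + 'I_k)).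
  congr (_ * determinant _); apply/matrixP => p q; rewrite !mxE.
  have -> : lift ord0 p = rshift 1 p :> 'I_(1 + k) by apply/val_inj.
  by rewrite (unsplitK (inr p : 'I_1 + 'I_k)) !mxE.
under [RHS]eq_bigr do rewrite E mulr_sumr.
rewrite exchange_big E /=; apply: eq_bigr => j _.
rewrite mulmx_suml summxE mulr_suml; apply: eq_bigr => i _.
by rewrite -scalemxAl mxE mulrA.
Qed.

Lemma ev_contract k L (u : V) (m : 'M[R]_(k, 7)) : homog k.+1 L -> inrange L ->
  ev C L (col_mx u m : 'M[R]_(k.+1, 7)) =
  \sum_(i < 7) (u *m C) 0 i * ev C (contract_idx i L) m.
Proof.
move=> hL rL; transitivity (\sum_(i < 7) (u *m C) 0 i *
   ev C L (col_mx (row i B) m : 'M[R]_(k.+1, 7))); last first.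
  by apply: eq_bigr => i _; rewrite (contract_ev _ _ BC).
rewrite /ev; under [RHS]eq_bigr do rewrite mulr_sumr.
rewrite exchange_big /=; apply: eq_bigr => p _.
rewrite -{1}[u](mulmxK uC) mulmx_sum_row /mono decform_row_lin mulr_sumr.
by apply: eq_bigr => i _; rewrite mulrCA.
Qed.

(** Bilinearity reduces the identity to frame vectors, where it is
    [contract_table]. *)
Lemma g2_identity (u w : V) (v : 'M[R]_7) :
  wedge_pt (wedge_pt (fun m : 'M[R]_(2, 7) => ev (k := 3) C phiL (col_mx u m))
                     (fun m : 'M[R]_(2, 7) => ev (k := 3) C phiL (col_mx w m)))
           (ev (k := 3) C phiL) v = 6%:R * ip gC u w * (\det C * \det v).
Proof.
have cE (z : V) : (fun m : 'M[R]_(2, 7) => ev (k := 3) C phiL (col_mx z m)) =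
   fun m => \sum_(i < 7) (z *m C) 0 i * ev C (contract_idx i phiL) m.
  by apply/funext => m; exact: (@ev_contract 2).
rewrite !cE.
have -> : wedge_pt (fun m => \sum_(i < 7) (u *m C) 0 i * ev (k := 2) C (contract_idx i phiL) m)
     (fun m => \sum_(i < 7) (w *m C) 0 i * ev (k := 2) C (contract_idx i phiL) m)
  = fun m => \sum_(i < 7) (u *m C) 0 i * (\sum_(j < 7) (w *m C) 0 j *
      ev (k := 2 + 2) C (mulc (contract_idx i phiL) (contract_idx j phiL)) m).
  apply/funext => m; rewrite wedge_pt_suml; apply: eq_bigr => i _; congr (_ * _).
  rewrite wedge_pt_sumr; apply: eq_bigr => j _; congr (_ * _).
  by have /and4P[h2 _ _ _] := contract_table i j; rewrite wedge_ev.
have key (i j : 'I_7) : wedge_pt (ev (k := 2 + 2) C (mulc (contract_idx i phiL) (contract_idx j phiL)))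
    (ev (k := 3) C phiL) v = if i == j then 6 * (\det C * \det v) else 0.
  have /and4P[_ h4 h7 e] := contract_table i j; rewrite (@wedge_ev _ 4 3) //.
  rewrite (eqcP (k := 7) C h7 _ e); last by case: ifP.
  rewrite val_eqE; case: ifP => _; last by rewrite /ev big_nil.
  by rewrite /ev big_seq1 -mono_full.
rewrite wedge_pt_suml coframe_ipE mulr_sumr mulr_suml; apply: eq_bigr => i _.
rewrite wedge_pt_suml (bigD1 i) //= key eqxx big1 ?addr0 => [|j ji].
  by ring.
by rewrite key eq_sym (negbTE ji) mulr0.
Qed.

Lemma exprn_odd_inj (n : nat) (x y : R) : odd n -> x ^+ n = y ^+ n -> x = y.
Proof.
move=> on xy; have n0 : (0 < n)%N by case: n on {xy}.
have nx : `|x| = `|y|.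
  by apply: (@pexpIrn _ n n0); rewrite ?nnegrE // -!normrX xy.
have /orP[/eqP //|/eqP xNy] : (x == y) || (x == - y) by rewrite -eqr_norm2 nx.
move: xy; rewrite xNy exprNn -signr_odd on expr1 mulN1r => /eqP.
rewrite eq_sym -addr_eq0 -mulr2n mulrn_eq0 /= expf_eq0 n0 /=.
by move/eqP => ->; rewrite oppr0.
Qed.

(** Both pairs satisfy the same identity, so that r g' = det C gC; taking
    determinants and using r^2 = det g' gives r^9 = (det C)^9. *)
Lemma g2_metric_unique (g' : 'M[R]_7) r :
  r ^+ 2 = \det g' ->
  (forall u w v, 6%:R * ip gC u w * (\det C * \det v) = 6%:R * ip g' u w * (r * \det (v : 'M[R]_7))) ->
  r = \det C /\ g' = gC.
Proof.
move=> r2 H; have dC : \det C != 0 by rewrite -unitfE -unitmxE.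
have M : r *: g' = \det C *: gC.
  apply/matrixP => i j; have := H (delta_mx 0 i) (delta_mx 0 j) 1%:M.
  have ipd (m : 'M[R]_7) : ip m (delta_mx 0 i) (delta_mx 0 j) = m i j.
    by rewrite /ip -rowE trmx_delta -colE !mxE.
  rewrite !ipd det1 !mulr1 -!mulrA => /mulfI; rewrite pnatr_eq0 => /(_ isT).
  by move=> e; rewrite [LHS]mxE [RHS]mxE mulrC -e mulrC.
have r9 : r ^+ 9 = \det C ^+ 9.
  have := congr1 determinant M; rewrite !detZ -r2 /gC det_mulmx det_tr -expr2 -!exprD.
  by [].
have rC := exprn_odd_inj (n := 9) isT r9; split => //.
move: M; rewrite rC => /(congr1 (fun X => (\det C)^-1 *: X)).
by rewrite !scalerA mulVf // !scale1r.
Qed.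

Lemma hodge_coframe k l L (v : 'M[R]_(l, 7)) : hodge_ok k l L ->
  forall (vol : 'M[R]_(k + l, 7) -> R), vol = (fun m => 1 * mono C (iota 0 7) m) ->
  hodge_pt (invmx gC) vol (ev (k := k) C L) v = ev C (hodge_idx L) v.
Proof.
by move=> ok vol ->; rewrite invmx_gram (hodge_ev _ _ BC) // mul1r.
Qed.

End MetricAtPoint.

Lemma hodge_ptZ k l Gi vol (a b c : R) (F1 F2 F3 : 'M[R]_(k, 7) -> R) v :
  hodge_pt (l := l) Gi vol (fun u => a * F1 u + b * F2 u + c * F3 u) v =
  a * hodge_pt Gi vol F1 v + b * hodge_pt Gi vol F2 v + c * hodge_pt Gi vol F3 v.
Proof.
have := hodge_pt_sum Gi vol [:: (a, F1); (b, F2); (c, F3)] fst snd v.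
rewrite !big_cons big_nil /= addr0 addrA => <-; congr (hodge_pt _ _ _ _).
by apply/funext => u; rewrite !big_cons big_nil addr0 addrA.
Qed.

End Star.

(** * The Hodge Laplacian on the family *)

Section LocalGeometry.
Variable R : realType.
Local Notation V := 'rV[R]_7.
Local Notation form := (@Defs.form R).
Variables (U : set V) (G : V -> 'M[R]_7) (E : 'I_3 -> V -> V).
Hypothesis oU : open U.
Hypothesis sG : smooth_on U G.
Hypothesis sE : forall l, smooth_on U (E l).
Hypothesis rG : riemannian_on U G.
Hypothesis onE : forall x, U x -> forall a b, ip (G x) (E a x) (E b x) = (a == b)%:R.
Hypothesis lieE : forall x, U x -> forall a, lie (E a) (E (a + 1)) x = 2 *: E (a + 2) x.
Hypothesis kE : forall a, killing_on U G (E a).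
Hypothesis saE : forall a, sasakian_on U G (E a).

Local Notation eta123 := (eta123 G E).
Local Notation mixed3 := (mixed3 G E).
Local Notation mixed4 := (mixed4 G E).
Local Notation omega_sq := (omega_sq G E).
Local Notation cubic := (cubic G E).
Local Notation quartic := (quartic G E).

Let dfe l : dform U (Defs.eta G E l). Proof. exact: dform_eta. Qed.
Let dfo l : dform U (Defs.omega G E l). Proof. exact: dform_omega. Qed.
Let dom := extd_omega oU sG sE.

Lemma extd_at x : U x ->
  [/\ extd eta123 x = fun v => - 2 * (mixed4 0 x v + mixed4 1 x v + mixed4 2 x v),
      forall l, extd (mixed3 l) x = fun v =>
        - 2 * omega_sq x v - 2 * mixed4 l x v + 2 * mixed4 (l + 1) x v + 2 * mixed4 (l + 2) x v,
      forall l, extd (mixed4 l) x = fun=> 0 & extd omega_sq x = fun=> 0].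
Proof.
move=> Ux; have [C [_ _ eC oC]] := adapted_coframe oU sG sE rG onE lieE kE saE Ux.
split=> [|l|l|].
- exact: (extd_eta123 oU dfe Ux eC oC).
- exact: (extd_mixed3 oU dfe dfo dom Ux eC oC).
- exact: (extd_mixed4 oU dfe dfo dom Ux eC oC).
- exact: (extd_omega_sq oU dfo dom Ux eC oC).
Qed.

Lemma cubicE p q r : cubic p q r = fun x v =>
  1 * (p * eta123 x v + (- q) * (1 * mixed3 0 x v + 1 * mixed3 1 x v)) + (- r) * mixed3 2 x v.
Proof. by apply/funext => x; apply/funext => v; rewrite /cubic !mul1r !mulNr. Qed.

Lemma quarticE p q r : quartic p q r = fun x v =>
  1 * (p * omega_sq x v + q * (1 * mixed4 0 x v + 1 * mixed4 1 x v)) + r * mixed4 2 x v.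
Proof. by apply/funext => x; apply/funext => v; rewrite /quartic !mul1r. Qed.

Let dT0 := dform_eta123 dfe.
Let dT := dform_mixed3 dfe dfo.
Let dA := dform_mixed4 dfe dfo.
Let dW := dform_omega_sq dfo.

Lemma cubic_aux (a0 a1 a2 w p q r : R) :
  1 * (p * (- 2 * (a0 + a1 + a2)) + (- q) *
     (1 * (- 2 * w - 2 * a0 + 2 * a1 + 2 * a2) + 1 * (- 2 * w - 2 * a1 + 2 * a2 + 2 * a0)))
   + (- r) * (- 2 * w - 2 * a2 + 2 * a0 + 2 * a1)
  = (4 * q + 2 * r) * w + (- 2 * p - 2 * r) * (a0 + a1) + (- 2 * p - 4 * q + 2 * r) * a2.
Proof. by ring. Qed.

(** The structure equations, collected on the span of the three 3-forms. *)
Lemma extd_cubic p q r x : U x -> extd (cubic p q r) x =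
  quartic (4 * q + 2 * r) (- 2 * p - 2 * r) (- 2 * p - 4 * q + 2 * r) x.
Proof.
move=> Ux; have [e0 eT _ _] := extd_at Ux.
have d1 : dform U (fun x v => 1 * mixed3 0 x v + 1 * mixed3 1 x v) by apply: dform_lin.
have d2 : dform U (fun x v => p * eta123 x v + (- q) * (1 * mixed3 0 x v + 1 * mixed3 1 x v)).
  by apply: dform_lin.
rewrite cubicE (extd_lin _ _ oU Ux d2 (dT 2)) (extd_lin _ _ oU Ux dT0 d1).
rewrite (extd_lin _ _ oU Ux (dT 0) (dT 1)) e0 !eT /quartic.
have -> : (0 + 1 : 'I_3) = 1 by apply/val_inj.
have -> : (0 + 2 : 'I_3) = 2 by apply/val_inj.
have -> : (1 + 1 : 'I_3) = 2 by apply/val_inj.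
have -> : (1 + 2 : 'I_3) = 0 by apply/val_inj.
have -> : (2 + 1 : 'I_3) = 0 by apply/val_inj.
have -> : (2 + 2 : 'I_3) = 1 by apply/val_inj.
by apply/funext => v; exact: cubic_aux.
Qed.

Lemma extd_quartic p q r x : U x -> extd (quartic p q r) x = fun=> 0.
Proof.
move=> Ux; have [_ _ eA eW] := extd_at Ux.
have d1 : dform U (fun x v => 1 * mixed4 0 x v + 1 * mixed4 1 x v) by apply: dform_lin.
have d2 : dform U (fun x v => p * omega_sq x v + q * (1 * mixed4 0 x v + 1 * mixed4 1 x v)).
  by apply: dform_lin.
rewrite quarticE (extd_lin _ _ oU Ux d2 (dA 2)) (extd_lin _ _ oU Ux dW d1).
rewrite (extd_lin _ _ oU Ux (dA 0) (dA 1)) !eA eW.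
by apply/funext => v; rewrite !(mulr0, addr0).
Qed.

Lemma phi_local_cubic eps a b c :
  phi_local G E eps a b c = cubic (a ^+ 2 * (eps * b)) (a * c ^+ 2) (eps * b * c ^+ 2).
Proof.
apply/funext => x; apply/funext => v; rewrite /phi_local /cubic; congr (_ * _ - _ - _).
by ring.
Qed.

Lemma scaled_unit (C : 'M[R]_7) a b c : C \in unitmx ->
  a != 0 -> b != 0 -> c != 0 -> scaled C a b c \in unitmx.
Proof.
move=> uC a0 b0 c0; rewrite /scaled unitmx_mul uC /= unitmxE det_diag unitfE.
apply/prodf_neq0 => i _; rewrite mxE.
by case: i => -[|[|[|[|[|[|[|//]]]]]]].
Qed.

Section AtPoint.
Variables (x : V) (C : 'M[R]_7) (a b c : R).
Hypothesis Ux : U x.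
Hypothesis uC : C \in unitmx.
Hypothesis eC : forall l : 'I_3, Defs.eta G E l x = mono C [:: val l].
Hypothesis oC : forall l : 'I_3, Defs.omega G E l x = ev C (omega_comb l).
Hypotheses (a0 : a != 0) (b0 : b != 0) (c0 : c != 0).
Let C' := scaled C a b c.
Let uC' : C' \in unitmx. Proof. exact: scaled_unit. Qed.

(** The form of the family is the standard form of the rescaled coframe. *)
Lemma cubic_phiL : cubic (a ^+ 2 * b) (a * c ^+ 2) (b * c ^+ 2) x = ev C' phiL.
Proof.
apply/funext => v; rewrite /cubic (eta123_ev eC) !(mixed3_ev eC oC).
have T0S := eta123_scaled C a b c v; rewrite -/C' in T0S.
have TS := mixed3_scaled C a b c v; rewrite -/C' in TS.
rewrite ev_phiL T0S (TS 0) (TS 1) (TS 2) /=; ring.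
Qed.

Lemma quartic_psiL : quartic (c ^+ 4 / 2) (- (a * b * c ^+ 2)) (- (a ^+ 2 * c ^+ 2)) x
  = ev C' psiL.
Proof.
apply/funext => v; rewrite /quartic (omega_sq_ev oC) !(mixed4_ev eC oC).
have AS := mixed4_scaled C a b c v; rewrite -/C' in AS.
have WS := omega_sq_scaled C a b c v; rewrite -/C' in WS.
rewrite ev_psiL ev_horizontal_vol WS (AS 0) (AS 1) (AS 2) /=; ring.
Qed.

Variables (g' : 'M[R]_7) (r : R).
Hypothesis gE : g' = C' *m C'^T.
Hypothesis rE : r = \det C'.

Lemma volE : (fun m : 'M[R]_7 => r * \det m) = fun m => 1 * mono C' (iota 0 7) m.
Proof. by apply/funext => m; rewrite mono_full mul1r rE. Qed.

Lemma hodge3_phi :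
  hodge_pt (k := 3) (l := 4) (invmx g') (fun m : 'M[R]_7 => r * \det m)
    (cubic (a ^+ 2 * b) (a * c ^+ 2) (b * c ^+ 2) x)
  = quartic (c ^+ 4 / 2) (- (a * b * c ^+ 2)) (- (a ^+ 2 * c ^+ 2)) x.
Proof.
rewrite cubic_phiL quartic_psiL gE; apply/funext => v.
rewrite (@hodge_coframe _ C' uC' 3 4 _ v ok_phiL _ volE).
by rewrite (eqcP C' _ _ hodge_phiL).
Qed.

(** Passing to the rescaled coframe, taking the star there by table and passing
    back divides each coefficient by the weight of its monomial and multiplies it
    by the weight of the complementary one. *)
Lemma hodge4_quartic p q s :
  hodge_pt (k := 4) (l := 3) (invmx g') (fun m : 'M[R]_7 => r * \det m)
    (quartic p q s x)
  = cubic (2 * p * (a ^+ 2 * b) / c ^+ 4) (- (q / b)) (- (s * b / a ^+ 2)) x.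
Proof.
have -> : quartic p q s x = fun v => (2 * p / c ^+ 4) * ev C' horizontal_volL v +
  (q / (a * b * c ^+ 2)) * ev C' (mixed4L 0 ++ mixed4L 1) v + (s / (a ^+ 2 * c ^+ 2)) * ev C' (mixed4L 2) v.
  apply/funext => v; rewrite /quartic (omega_sq_ev oC) !(mixed4_ev eC oC).
  have AS := mixed4_scaled C a b c v; rewrite -/C' in AS.
  have WS := omega_sq_scaled C a b c v; rewrite -/C' in WS.
  rewrite (ev_cat C' (mixed4L 0)) ev_horizontal_vol WS (AS 0) (AS 1) (AS 2) /=; field.
  by rewrite a0 b0 c0.
apply/funext => v; rewrite hodge_ptZ gE.
have okA : hodge_ok 4 3 (mixed4L 0 ++ mixed4L 1) by vm_compute.
rewrite (@hodge_coframe _ C' uC' 4 3 _ v ok_horizontal_volL _ volE).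
rewrite (@hodge_coframe _ C' uC' 4 3 _ v okA _ volE).
rewrite (@hodge_coframe _ C' uC' 4 3 _ v (ok_mixed4L 2) _ volE).
have hA : eqc (hodge_idx (mixed4L 0 ++ mixed4L 1)) (mixed3L 0 ++ mixed3L 1) by vm_compute.
rewrite (eqcP C' _ _ hodge_horizontal_volL) // (eqcP C' _ _ hA) // (eqcP C' _ _ (hodge_mixed4L 2)) //.
have TS := mixed3_scaled C a b c v; rewrite -/C' in TS.
have T0S := eta123_scaled C a b c v; rewrite -/C' in T0S.
rewrite (ev_cat C' (mixed3L 0)) (TS 0) (TS 1) (TS 2) T0S /= /cubic (eta123_ev eC) !(mixed3_ev eC oC); field.
by rewrite a0 b0 c0.
Qed.

End AtPoint.

Section Induced.
Variables (a b c : R) (g' : V -> 'M[R]_7) (rho : V -> R).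
Hypotheses (a0 : a != 0) (b0 : b != 0) (c0 : c != 0).
Local Notation phi := (cubic (a ^+ 2 * b) (a * c ^+ 2) (b * c ^+ 2)).
Hypothesis ind : g2_induces U phi g' rho.

(** Any metric and volume density induced by phi are those of the rescaled
    coframe. *)
Lemma induced_coframe x : U x -> exists C : 'M[R]_7,
  [/\ C \in unitmx, forall l : 'I_3, Defs.eta G E l x = mono C [:: val l],
      forall l : 'I_3, Defs.omega G E l x = ev C (omega_comb l),
      g' x = scaled C a b c *m (scaled C a b c)^T & rho x = \det (scaled C a b c)].
Proof.
move=> Ux; have [C [uC _ eC oC]] := adapted_coframe oU sG sE rG onE lieE kE saE Ux.
exists C; have uC' := scaled_unit uC a0 b0 c0.
have [_ /(_ x Ux)[r2 H]] := ind.
have [] := g2_metric_unique uC' r2; last by move=> -> ->; split.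
move=> u w v; rewrite -g2_identity // -(cubic_phiL a b c eC oC).
exact: H.
Qed.

Lemma hodge_phi x : U x -> hodge (k := 3) (l := 4) g' (volform rho) phi x =
  quartic (c ^+ 4 / 2) (- (a * b * c ^+ 2)) (- (a ^+ 2 * c ^+ 2)) x.
Proof.
move=> Ux; have [C [uC eC oC gE rE]] := induced_coframe Ux.
exact: (hodge3_phi uC eC oC a0 b0 c0 gE rE).
Qed.

Lemma hodge_quartic al p q s x : U x -> al x = quartic p q s x ->
  hodge (k := 4) (l := 3) g' (volform rho) al x =
  cubic (2 * p * (a ^+ 2 * b) / c ^+ 4) (- (q / b)) (- (s * b / a ^+ 2)) x.
Proof.
move=> Ux aE; have [C [uC eC oC gE rE]] := induced_coframe Ux.
rewrite -(hodge4_quartic uC eC oC a0 b0 c0 gE rE) -aE; exact: erefl.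
Qed.

Lemma extd_phi x : U x -> extd phi x =
  quartic (4 * (a * c ^+ 2) + 2 * (b * c ^+ 2)) (- 2 * (a ^+ 2 * b) - 2 * (b * c ^+ 2))
    (- 2 * (a ^+ 2 * b) - 4 * (a * c ^+ 2) + 2 * (b * c ^+ 2)) x.
Proof. exact: extd_cubic. Qed.

Lemma codiff3_phi x : U x -> codiff3 g' rho phi x = fun=> 0.
Proof.
move=> Ux; apply/funext => v; rewrite /codiff3 /hodge.
have -> : extd (hodge (k := 3) (l := 4) g' (volform rho) phi) x = fun=> 0.
  by rewrite (extd_eq oU Ux hodge_phi) extd_quartic.
by rewrite big1 ?mulr0 ?oppr0 // => I _; rewrite mul0r.
Qed.

(** d psi = 0 kills the first term of the Laplacian, and the other one is
    * d * d phi: P, Q, S are the coefficients of * d phi. *)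
Lemma laplacian_phi x : U x ->
  let P := 2 * (4 * (a * c ^+ 2) + 2 * (b * c ^+ 2)) * (a ^+ 2 * b) / c ^+ 4 in
  let Q := - ((- 2 * (a ^+ 2 * b) - 2 * (b * c ^+ 2)) / b) in
  let S := - ((- 2 * (a ^+ 2 * b) - 4 * (a * c ^+ 2) + 2 * (b * c ^+ 2)) * b / a ^+ 2) in
  laplacian3 g' rho phi x = cubic (2 * (4 * Q + 2 * S) * (a ^+ 2 * b) / c ^+ 4) (- ((- 2 * P - 2 * S) / b))
    (- ((- 2 * P - 4 * Q + 2 * S) * b / a ^+ 2)) x.
Proof.
move=> Ux P Q S; rewrite -(hodge_quartic (al := extd (hodge (k := 4) (l := 3)
  g' (volform rho) (extd phi)))) //; last first.
  rewrite (extd_eq (be := cubic P Q S) oU Ux) ?extd_cubic // => y Uy.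
  exact: hodge_quartic (extd_phi Uy).
apply/funext => v; rewrite /laplacian3 -[RHS]add0r; congr (_ + _).
rewrite (extd_eq (be := fun _ _ => 0) oU Ux codiff3_phi) /extd big1 // => i _.
by rewrite derive_cst mulr0.
Qed.

End Induced.

(** The rescaled coframes are chosen independently at each point: the induced
    metric does not depend on the choice. *)
Lemma g2_exists a b c : a != 0 -> b != 0 -> c != 0 ->
  exists g' rho, g2_induces U (cubic (a ^+ 2 * b) (a * c ^+ 2) (b * c ^+ 2)) g' rho.
Proof.
move=> a0 b0 c0.
have /choice[Cf HC] : forall x, exists C : 'M[R]_7, U x ->
  [/\ C \in unitmx, forall l : 'I_3, Defs.eta G E l x = mono C [:: val l] &
      forall l : 'I_3, Defs.omega G E l x = ev C (omega_comb l)].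
  move=> x; have [Ux|nU] := pselect (U x); last by exists 0.
  have [C [uC _ eC oC]] := adapted_coframe oU sG sE rG onE lieE kE saE Ux.
  by exists C.
exists (fun x => scaled (Cf x) a b c *m (scaled (Cf x) a b c)^T),
  (fun x => \det (scaled (Cf x) a b c)); split.
  move=> x /HC[uC _ _]; have uC' := scaled_unit uC a0 b0 c0.
  by split; [exact: coframe_sym | move=> u; exact: coframe_pos].
move=> x /HC[uC eC oC]; have uC' := scaled_unit uC a0 b0 c0.
split=> [|u w v]; first by rewrite [RHS]det_mulmx det_tr expr2.
by rewrite -(g2_identity uC') -(cubic_phiL a b c eC oC).
Qed.

(** Evaluation on frame vectors extracts the coefficients of a form. *)
Lemma mono_dual k (C : 'M[R]_7) (s t : seq nat) : C \in unitmx ->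
  size s = k -> size t = k -> all (fun i => i < 7)%N s -> all (fun i => i < 7)%N t ->
  mono C t (\matrix_(p < k) row (inord (nth 0%N s p)) (invmx C)) =
  \det (\matrix_(p < k, q < k) (nth 0%N s p == nth 0%N t q)%:R).
Proof.
move=> uC sk tk /allP rs /allP rt; rewrite /mono /decform; congr (\det _).
apply/matrixP => p q; rewrite [RHS]mxE.
transitivity ((invmx C *m C) (inord (nth 0%N s p)) (inord (nth 0%N t q))).
  by rewrite !mxE; apply: eq_bigr => m _; rewrite !mxE.
rewrite mulVmx // mxE -val_eqE /= !inordK //.
  by apply: rt; rewrite mem_nth ?tk.
by apply: rs; rewrite mem_nth ?sk.
Qed.

Lemma ev_dual k (C : 'M[R]_7) (s : seq nat) L : C \in unitmx ->
  size s = k -> uniq s -> all (fun i => i < 7)%N s -> homog k L -> inrange L ->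
  all (fun p => (p.2 == s) || has (fun i => i \notin p.2) s) L ->
  ev C L (\matrix_(p < k) row (inord (nth 0%N s p)) (invmx C)) =
  (\sum_(p <- L) (if p.2 == s then p.1 else 0))%:~R.
Proof.
move=> uC sk us rs /allP hL /allP rL /allP dL.
rewrite /ev (big_morph _ (@intrD R) (erefl : (0 : int)%:~R = 0)).
rewrite !big_seq; apply: eq_bigr => p pL.
rewrite (mono_dual uC sk (eqP (hL _ pL)) rs (rL _ pL)).
have := dL _ pL; case: eqP => [ps _|_ /= /hasP[i is_ ip]].
  rewrite ps (_ : \matrix_(_, _) _ = 1%:M) ?det1 ?mulr1 //.
  by apply/matrixP => a b; rewrite !mxE nth_uniq ?sk.
have ik : (index i s < k)%N by rewrite -sk index_mem.
rewrite (expand_det_row _ (Ordinal ik)) big1 ?mulr0 // => q _.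
rewrite mxE /= nth_index //; case: eqP => [iq|]; last by rewrite mul0r.
by have : i \in p.2; [rewrite iq mem_nth // (eqP (hL _ pL)) | rewrite (negbTE ip)].
Qed.

Definition dual_rows (C : 'M[R]_7) k (s : seq nat) : 'M[R]_(k, 7) :=
  \matrix_(p < k) row (inord (nth 0%N s p)) (invmx C).

Lemma cubic_coords x : U x -> exists v1 v2 v3 : 'M[R]_(3, 7), forall p q r,
  [/\ cubic p q r x v1 = p, cubic p q r x v2 = - q & cubic p q r x v3 = - r].
Proof.
move=> Ux; have [C [uC _ eC oC]] := adapted_coframe oU sG sE rG onE lieE kE saE Ux.
(* These index triples each occur in exactly one of the three terms. *)
exists (dual_rows C 3 [:: 0; 1; 2]%N), (dual_rows C 3 [:: 0; 3; 4]%N),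
  (dual_rows C 3 [:: 2; 3; 6]%N) => p q r.
have D s L : [&& size s == 3, uniq s, all (fun i => i < 7)%N s, homog 3 L, inrange L &
  all (fun p => (p.2 == s) || has (fun i => i \notin p.2) s) L] ->
  ev C L (dual_rows C 3 s) = (\sum_(p <- L) (if p.2 == s then p.1 else 0))%:~R.
  by case/and5P => /eqP s3 us rs hL /andP[rL dL]; exact: ev_dual.
have S1 L s : \sum_(p <- L) (if p.2 == s then p.1 else 0) =
  foldr (fun p z => (if p.2 == s then p.1 else 0) + z) 0 L :> int.
  by rewrite unlock.
rewrite /cubic (eta123_ev eC) !(mixed3_ev eC oC); split;
  rewrite !D // !S1 /=; rewrite ?(mulr0z, mulr1z, addr0, add0r); ring.
Qed.

Lemma quartic_coords x : U x -> exists v1 v2 v3 : 'M[R]_(4, 7), forall p q r,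
  [/\ quartic p q r x v1 = 2 * p, quartic p q r x v2 = q & quartic p q r x v3 = r].
Proof.
move=> Ux; have [C [uC _ eC oC]] := adapted_coframe oU sG sE rG onE lieE kE saE Ux.
(* omega_l /\ omega_l has the coefficient 2 on e_3456. *)
exists (dual_rows C 4 [:: 3; 4; 5; 6]%N), (dual_rows C 4 [:: 1; 2; 3; 4]%N),
  (dual_rows C 4 [:: 0; 1; 3; 6]%N) => p q r.
have D s L : [&& size s == 4, uniq s, all (fun i => i < 7)%N s, homog 4 L, inrange L &
  all (fun p => (p.2 == s) || has (fun i => i \notin p.2) s) L] ->
  ev C L (dual_rows C 4 s) = (\sum_(p <- L) (if p.2 == s then p.1 else 0))%:~R.
  by case/and5P => /eqP s3 us rs hL /andP[rL dL]; exact: ev_dual.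
have S1 L s : \sum_(p <- L) (if p.2 == s then p.1 else 0) =
  foldr (fun p z => (if p.2 == s then p.1 else 0) + z) 0 L :> int.
  by rewrite unlock.
have WE v : ev (k := 4) C omega_sqL v = 2 * ev C horizontal_volL v by rewrite ev_horizontal_vol mulrC divfK // pnatr_eq0.
rewrite /quartic (omega_sq_ev oC) !(mixed4_ev eC oC); split;
  rewrite WE !D // !S1 /=; rewrite ?(mulr0z, mulr1z, addr0, add0r); ring.
Qed.

End LocalGeometry.

(** * Global solutions of planar Lipschitz systems *)

Section RealAnalysis.
Variable R : realType.
Implicit Types (f g : R -> R) (a b t : R).

Lemma is_derive_continuous f t d : is_derive t (1 : R) f d -> {for t, continuous f}.
Proof. by case=> df _; apply: differentiable_continuous; apply/derivable1_diffP. Qed.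

Lemma within_continuous_derive f (df : R -> R) a b :
  (forall t, a <= t <= b -> is_derive t (1 : R) f (df t)) ->
  {within `[a, b], continuous f}.
Proof.
move=> H; apply: derivable_within_continuous => t; rewrite in_itv /= => /H.
by case.
Qed.

Lemma derive_ge0_le f (df : R -> R) a b : a <= b ->
  (forall t, a <= t <= b -> is_derive t (1 : R) f (df t)) ->
  (forall t, a <= t <= b -> 0 <= df t) -> f a <= f b.
Proof.
move=> ab H H0; have [t|t tab E] := @MVT_segment _ f df a b ab _ (within_continuous_derive H).
  by rewrite in_itv /= => /andP[at_ tb]; apply: H; rewrite !ltW.
rewrite -subr_ge0 E mulr_ge0 ?subr_ge0 //; apply: H0.
by move: tab; rewrite in_itv.
Qed.

Lemma derive_gt0_lt f (df : R -> R) a b : a < b ->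
  (forall t, a <= t <= b -> is_derive t (1 : R) f (df t)) ->
  (forall t, a <= t <= b -> 0 < df t) -> f a < f b.
Proof.
move=> ab H H0; have [t|t tab E] := @MVT_segment _ f df a b (ltW ab) _ (within_continuous_derive H).
  by rewrite in_itv /= => /andP[at_ tb]; apply: H; rewrite !ltW.
rewrite -subr_gt0 E mulr_gt0 ?subr_gt0 //; apply: H0.
by move: tab; rewrite in_itv.
Qed.

(** Stated with the minimum and the maximum so that a and b may come in either
    order. *)
Lemma derive_eq0_cst f a b :
  (forall t, Num.min a b <= t <= Num.max a b -> is_derive t (1 : R) f 0) -> f a = f b.
Proof.
wlog ab : a b / a <= b.
  move=> H H'; have [ab|/ltW ba] := leP a b; first exact: H.
  by apply/esym/H => // t; rewrite minC maxC; exact: H'.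
rewrite (min_idPl ab) (max_idPr ab) => H.
have [t|t tab E] := @MVT_segment _ f (cst 0) a b ab _ (within_continuous_derive H).
  by rewrite in_itv /= => /andP[at_ tb]; apply: H; rewrite !ltW.
by move: E; rewrite mul0r => /eqP; rewrite subr_eq0 => /eqP.
Qed.

Lemma integral_derive f (n t : R) : continuous f -> - n < t ->
  is_derive t (1 : R) (fun s => \int[lebesgue_measure]_(x in `[- n, s]) f x) (f t).
Proof.
move=> cf nt; have t1 : t < t + 1 by rewrite ltrDl.
have int : lebesgue_measure.-integrable `[- n, t + 1] (EFin \o f).
  apply: continuous_compact_integrable; first exact: segment_compact.
  exact: continuous_subspaceT.
have [d e] := @continuous_FTC1_closed R f (- n) t (t + 1) t1 int nt (cf t).
by split; [exact: d|rewrite -derive1E; exact: e].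
Qed.

(** The integral from -n to t is a primitive on the half-line t > -n; normalized
    to vanish at 0, these primitives agree where they overlap. *)
Lemma primitive_exists f : continuous f ->
  exists F : R -> R, F 0 = 0 /\ forall t, is_derive t (1 : R) F (f t).
Proof.
move=> cf; pose Q n s := \int[lebesgue_measure]_(x in `[- n, s]) f x.
have QE (n m t : R) : `|t| < n -> `|t| < m -> Q n t - Q n 0 = Q m t - Q m 0.
  move=> tn tm; have E : Q n t - Q m t = Q n 0 - Q m 0.
    apply: (@derive_eq0_cst (fun s => Q n s - Q m s)) => s.
    rewrite ge_min le_max => /andP[s1 s2].
    have t1 := ler_norm (- t); rewrite normrN in t1.
    have ts : - `|t| <= s by case/orP: s1; have := normr_ge0 t; lra.
    rewrite -[X in is_derive _ _ _ X](subrr (f s)).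
    by apply: is_deriveB; apply: integral_derive => //; lra.
  by move: E; lra.
exists (fun t => Q (`|t| + 1) t - Q (`|t| + 1) 0); split; first by rewrite subrr.
move=> t; apply: (near_eq_is_derive (f := fun s => Q (`|t| + 2) s - Q (`|t| + 2) 0)).
  near=> s; apply: QE; last by lra.
  have : `|s - t| < 1.
    by near: s; apply: cvgr_distC_lt => //; exact: cvg_id.
  by have := ler_normD (s - t) t; rewrite subrK; lra.
have -> : f t = f t - 0 by rewrite subr0.
apply: is_deriveB; apply: integral_derive => //.
by have := ler_norm (- t); rewrite normrN; lra.
Unshelve. all: by end_near. Qed.

Lemma lipschitz_continuous f (K : R) : 0 <= K -> (forall s t, `|f s - f t| <= K * `|s - t|) ->
  continuous f.
Proof.
move=> K0 H t; apply/cvgrPdist_lt => e e0.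
have K1 : 0 < K + 1 by lra.
near=> s; apply: (le_lt_trans (H t s)).
have : `|t - s| < e / (K + 1).
  by near: s; apply: cvgr_dist_lt; [exact: cvg_id | rewrite divr_gt0].
rewrite ltr_pdivlMr //; have := normr_ge0 (t - s); nra.
Unshelve. all: by end_near. Qed.

Lemma exp_growth_pos (w dw : R -> R) (C l : R) : 0 < l -> 0 <= C -> w 0 = 0 ->
  (forall t, is_derive t (1 : R) w (dw t)) ->
  (forall t, 0 <= t -> `|dw t| <= C * l * expR (l * t)) ->
  forall t, 0 <= t -> `|w t| <= C * expR (l * t).
Proof.
move=> l0 C0 w0 Hw Hd t t0.
have De s : is_derive s (1 : R) (fun s => C * expR (l * s)) (C * l * expR (l * s)).
  have Dl : is_derive s (1 : R) (fun s : R => l * s) l.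
    have := @is_deriveZ _ _ _ (@id R) l s 1 1 _; rewrite /GRing.scale /= mulr1; apply.
  have D2 := @is_derive1_comp R expR (fun s => l * s) s _ _ (is_derive_expR (l * s)) Dl.
  have := @is_deriveZ _ _ _ (expR \o (fun s => l * s)) C s 1 _ D2.
  by rewrite /GRing.scale /= [expR _ * l]mulrC mulrA.
have Hpos s : 0 <= s -> `|dw s| <= C * l * expR (l * s) by exact: Hd.
have C1 : C * expR (l * 0) - w 0 <= C * expR (l * t) - w t.
  apply: (@derive_ge0_le (fun s => C * expR (l * s) - w s)
     (fun s => C * l * expR (l * s) - dw s)) => // s /andP[s0 _].
  by rewrite subr_ge0 (le_trans (ler_norm _)) // Hpos.
have C2 : C * expR (l * 0) + w 0 <= C * expR (l * t) + w t.
  apply: (@derive_ge0_le (fun s => C * expR (l * s) + w s)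
     (fun s => C * l * expR (l * s) + dw s)) => // s /andP[s0 _].
  have := Hpos _ s0; have := ler_norm (- dw s); rewrite normrN; lra.
move: C1 C2; rewrite w0 mulr0 expR0 mulr1 subr0 addr0 => C1 C2.
by rewrite ler_norml; apply/andP; split; lra.
Qed.

(** The weighted estimate that makes Picard iteration contract on the whole line:
    integrating C l e^(l |t|) gains the factor 1 / l. *)
Lemma exp_growth (w dw : R -> R) (C l : R) : 0 < l -> 0 <= C -> w 0 = 0 ->
  (forall t, is_derive t (1 : R) w (dw t)) ->
  (forall t, `|dw t| <= C * l * expR (l * `|t|)) ->
  forall t, `|w t| <= C * expR (l * `|t|).
Proof.
move=> l0 C0 w0 Hw Hd t; have [t0|t0] := leP 0 t.
  rewrite (ger0_norm t0); apply: (exp_growth_pos l0 C0 w0 Hw) => // s s0.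
  by rewrite -{2}(ger0_norm s0).
have t0' : 0 <= - t by rewrite oppr_ge0 ltW.
have Dw s : is_derive s (1 : R) (fun s => w (- s)) (- dw (- s)).
  have Dn : is_derive s (1 : R) (fun s : R => - s) (- 1) by apply: is_deriveN.
  have := @is_derive1_comp R w (fun s => - s) s _ _ (Hw (- s)) Dn.
  by rewrite mulrN1.
have Bw s : 0 <= s -> `|- dw (- s)| <= C * l * expR (l * s).
  by move=> s0; rewrite normrN (le_trans (Hd _)) // normrN ger0_norm.
have w0' : w (- 0) = 0 by rewrite oppr0.
have := exp_growth_pos l0 C0 w0' Dw Bw t0'.
by rewrite opprK (ltr0_norm t0).
Qed.

(** The intervals [u n - 2 C / 2^n, u n + 2 C / 2^n] are nested. *)
Lemma geometric_limit (u : nat -> R) C : 0 <= C ->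
  (forall n, `|u n.+1 - u n| <= C / 2 ^+ n) ->
  exists l, forall n, `|u n - l| <= 2 * C / 2 ^+ n.
Proof.
move=> C0 H; pose a n := u n - 2 * C / 2 ^+ n; pose b n := u n + 2 * C / 2 ^+ n.
have p2 n : 0 < (2 : R) ^+ n by rewrite exprn_gt0.
have half n : C / 2 ^+ n.+1 = C / 2 ^+ n / 2 by rewrite exprS; field; rewrite gt_eqF.
have d0 n : 0 <= C / 2 ^+ n by rewrite divr_ge0 // ltW.
have aS n : a n <= a n.+1.
  rewrite /a -!mulrA (half n); have := H n; rewrite ler_norml => /andP[]; lra.
have bS n : b n.+1 <= b n.
  rewrite /b -!mulrA (half n); have := H n; rewrite ler_norml => /andP[]; lra.
have ab n : a n <= b n by rewrite /a /b -!mulrA; have := d0 n; lra.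
have am : {homo a : m n / (m <= n)%N >-> m <= n}.
  by apply: homo_leq => //; exact: le_trans.
have bm m n : (m <= n)%N -> b n <= b m.
  elim: n => [|n IH]; first by rewrite leqn0 => /eqP ->.
  by rewrite leq_eqVlt => /orP[/eqP -> //|/IH]; apply: le_trans.
have amb m n : a m <= b n.
  have := am m (maxn m n) (leq_maxl _ _); have := bm n (maxn m n) (leq_maxr _ _).
  have := ab (maxn m n); lra.
have hs : has_sup [set a n | n in [set: nat]].
  by split; [exists (a 0%N), 0%N | exists (b 0%N) => _ [n _ <-]].
exists (sup [set a n | n in [set: nat]]) => n.
have l1 : a n <= sup [set a n | n in [set: nat]] by apply: sup_upper_bound => //; exists n.
have l2 : sup [set a n | n in [set: nat]] <= b n.
  by apply: ge_sup => [|_ [m _ <-]] //; exists (a 0%N), 0%N.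
by move: l1 l2; rewrite ler_norml /a /b; lra.
Qed.

Lemma le_add_geometric (x y D : R) : (forall n, x <= y + D / 2 ^+ n) -> x <= y.
Proof.
move=> H; rewrite leNgt; apply/negP => yx.
have D0 : 0 < D by have := H 0%N; rewrite expr0 divr1; lra.
pose n := Num.truncn (D / (x - y)).
have h1 : D / (x - y) < n.+1%:R by rewrite truncnS_gt.
have h2 : (n.+1%:R : R) <= 2 ^+ n.+1 by rewrite -natrX ler_nat ltnW // ltn_expl.
have p2 : 0 < (2 : R) ^+ n.+1 by rewrite exprn_gt0.
have : D < (x - y) * 2 ^+ n.+1.
  by rewrite mulrC -ltr_pdivrMr ?subr_gt0 // (lt_le_trans h1).
by rewrite -ltr_pdivrMr //; have := H n.+1; lra.
Qed.

Lemma derive_bounded_lipschitz (w dw : R -> R) (K : R) :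
  (forall t, is_derive t (1 : R) w (dw t)) -> (forall t, `|dw t| <= K) ->
  forall s t, `|w s - w t| <= K * `|s - t|.
Proof.
move=> Dw Bw; have Hle s t : s <= t -> `|w t - w s| <= K * (t - s).
  move=> st; have [r _ E] := @MVT_segment _ w dw s t st _ (within_continuous_derive (fun r _ => Dw r)).
  by rewrite E normrM (ger0_norm (x := t - s)) ?subr_ge0 // ler_wpM2r ?subr_ge0.
move=> s t; have [st|/ltW ts] := leP s t.
  by rewrite distrC (distrC s) (ger0_norm (x := t - s)) ?subr_ge0 // Hle.
by rewrite (ger0_norm (x := s - t)) ?subr_ge0 // Hle.
Qed.

Definition lipschitz2 (L : R) (f : R -> R -> R) :=
  forall x y x' y', `|f x y - f x' y'| <= L * (`|x - x'| + `|y - y'|).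

Lemma lipschitz2_comp_continuous (L : R) (f : R -> R -> R) (x y : R -> R) : 0 <= L -> lipschitz2 L f ->
  continuous x -> continuous y -> continuous (fun t => f (x t) (y t)).
Proof.
move=> L0 Lf cx cy t; apply/cvgrPdist_lt => e e0.
have L1 : 0 < L + 1 by lra.
have d0 : 0 < e / (L + 1) / 2 by rewrite !divr_gt0.
near=> s; apply: (le_lt_trans (Lf _ _ _ _)).
have h1 : `|x t - x s| < e / (L + 1) / 2.
  by near: s; apply: cvgr_dist_lt; [exact: cx | ].
have h2 : `|y t - y s| < e / (L + 1) / 2.
  by near: s; apply: cvgr_dist_lt; [exact: cy | ].
have : `|x t - x s| + `|y t - y s| < e / (L + 1) by lra.
by rewrite ltr_pdivlMr //; have := normr_ge0 (x t - x s); have := normr_ge0 (y t - y s); nra.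
Unshelve. all: by end_near. Qed.

Section Picard.
Variables (f g : R -> R -> R) (K L x0 y0 : R).
Hypotheses (L0 : 0 < L) (Lf : lipschitz2 L f) (Lg : lipschitz2 L g).
Hypotheses (Kf : forall x y, `|f x y| <= K) (Kg : forall x y, `|g x y| <= K).

Let K0 : 0 <= K. Proof. exact: le_trans (Kf 0 0). Qed.
Let lam := 4 * L.
Let lam0 : 0 < lam. Proof. by rewrite mulr_gt0. Qed.
Let C := K / lam.
Let C0 : 0 <= C. Proof. by rewrite divr_ge0 // ltW. Qed.

Variable P : (R -> R) -> R -> R.
Hypothesis PP : forall h, continuous h ->
  P h 0 = 0 /\ forall t, is_derive t (1 : R) (P h) (h t).

(* One Picard step is t |-> (x0 + int_0^t f(x, y), y0 + int_0^t g(x, y)). *)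
Let step (p : (R -> R) * (R -> R)) : (R -> R) * (R -> R) :=
  (fun t => x0 + P (fun s => f (p.1 s) (p.2 s)) t,
   fun t => y0 + P (fun s => g (p.1 s) (p.2 s)) t).
Let it n := iter n step (cst x0, cst y0).

Let cont2 h (p : (R -> R) * (R -> R)) : lipschitz2 L h -> continuous p.1 -> continuous p.2 ->
  continuous (fun s => h (p.1 s) (p.2 s)).
Proof. by move=> Lh; exact: (lipschitz2_comp_continuous (ltW L0) Lh). Qed.

Let derivP h c : continuous h -> forall t, is_derive t (1 : R) (fun t => c + P h t) (h t).
Proof.
move=> ch t; rewrite -[X in is_derive _ _ _ X]add0r; apply: is_deriveD.
by have [_] := PP ch.
Qed.

Let lipP h c : continuous h -> (forall t, `|h t| <= K) ->
  forall s t, `|(c + P h s) - (c + P h t)| <= K * `|s - t|.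
Proof.
move=> ch Kh; apply: (derive_bounded_lipschitz (w := fun t => c + P h t) (dw := h)) => //.
exact: derivP.
Qed.

Let itc n : continuous (it n).1 /\ continuous (it n).2.
Proof.
elim: n => [|n [c1 c2]]; first by split=> t; exact: cvg_cst.
have cf := cont2 Lf c1 c2; have cg := cont2 Lg c1 c2.
by split; apply: (lipschitz_continuous K0); apply: lipP.
Qed.

Let itlip n s t : `|(it n).1 s - (it n).1 t| <= K * `|s - t| /\
                  `|(it n).2 s - (it n).2 t| <= K * `|s - t|.
Proof.
case: n => [|n]; first by rewrite /= /cst !subrr normr0 mulr_ge0.
have [c1 c2] := itc n; have cf := cont2 Lf c1 c2; have cg := cont2 Lg c1 c2.
by split; apply: lipP.
Qed.

Let itD n t : `|(it n.+1).1 t - (it n).1 t| <= C / 2 ^+ n * expR (lam * `|t|) /\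
              `|(it n.+1).2 t - (it n).2 t| <= C / 2 ^+ n * expR (lam * `|t|).
Proof.
elim: n t => [|n IH] t.
  have [c1 c2] := itc 0.
  have H h c : continuous h -> (forall t, `|h t| <= K) ->
      `|c + P h t - c| <= C / 2 ^+ 0 * expR (lam * `|t|).
    move=> ch Kh; rewrite [c + _]addrC addrK expr0 divr1.
    have [p0 pD] := PP ch.
    apply: (exp_growth lam0 C0 p0 pD) => s; rewrite /C mulfVK ?gt_eqF //.
    apply: (le_trans (Kh s)); rewrite ler_peMr // -expR0 ler_expR mulr_ge0 //.
    exact: ltW.
  by split; apply: H => [|s]; [exact: cont2|exact: Kf|exact: cont2|exact: Kg].
have [c1 c2] := itc n; have [d1 d2] := itc n.+1.
have H h c : lipschitz2 L h ->
   `|(c + P (fun s => h ((it n.+1).1 s) ((it n.+1).2 s)) t) -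
     (c + P (fun s => h ((it n).1 s) ((it n).2 s)) t)| <= C / 2 ^+ n.+1 * expR (lam * `|t|).
  move=> Lh; have ch := cont2 Lh c1 c2; have dh := cont2 Lh d1 d2.
  have D1 := derivP c ch; have D2 := derivP c dh.
  have [p0 _] := PP ch; have [q0 _] := PP dh.
  apply: (@exp_growth (fun t => (c + P (fun s => h ((it n.+1).1 s) ((it n.+1).2 s)) t) -
     (c + P (fun s => h ((it n).1 s) ((it n).2 s)) t)) _ (C / 2 ^+ n.+1) lam) => //.
  - by rewrite divr_ge0 // exprn_ge0.
  - by rewrite p0 q0 subrr.
  move=> s; apply: (le_trans (Lh _ _ _ _)); have [e1 e2] := IH s.
  have -> : C / 2 ^+ n.+1 * lam * expR (lam * `|s|) =
            L * (C / 2 ^+ n * expR (lam * `|s|) + C / 2 ^+ n * expR (lam * `|s|)).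
    by rewrite exprS /lam; field; rewrite gt_eqF // exprn_gt0.
  by rewrite ler_pM2l // lerD.
by split; exact: H.
Qed.

(** Picard iteration with respect to the weight e^(4 L |t|): by [exp_growth] the
    distance of two consecutive iterates is halved at each step.  The limit is
    continuous because all iterates are K-Lipschitz. *)
Lemma picard_aux : exists x y : R -> R, [/\ x 0 = x0, y 0 = y0 &
  forall t, is_derive t (1 : R) x (f (x t) (y t)) /\ is_derive t (1 : R) y (g (x t) (y t))].
Proof.
have lims (u : nat -> R -> R) :
    (forall n t, `|u n.+1 t - u n t| <= C / 2 ^+ n * expR (lam * `|t|)) ->
    exists x, forall n t, `|u n t - x t| <= 2 * (C * expR (lam * `|t|)) / 2 ^+ n.
  move=> H; have /choice[x Hx] : forall t, exists l, forall n,
      `|u n t - l| <= 2 * (C * expR (lam * `|t|)) / 2 ^+ n.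
    move=> t; apply: geometric_limit => [|n]; first by rewrite mulr_ge0 ?expR_ge0.
    by rewrite mulrAC.
  by exists x => n t; exact: Hx.
have [x Hx] := lims (fun n => (it n).1) (fun n t => (itD n t).1).
have [y Hy] := lims (fun n => (it n).2) (fun n t => (itD n t).2).
have clim (u : nat -> R -> R) (z : R -> R) :
    (forall n t, `|u n t - z t| <= 2 * (C * expR (lam * `|t|)) / 2 ^+ n) ->
    (forall n s t, `|u n s - u n t| <= K * `|s - t|) -> continuous z.
  move=> Hz Hu; apply: (lipschitz_continuous K0) => s t.
  apply: (@le_add_geometric _ _
    (2 * (C * expR (lam * `|s|)) + 2 * (C * expR (lam * `|t|)))) => n.
  rewrite mulrDl; have := Hz n s; have := Hz n t; have := Hu n s t.
  rewrite !ler_norml => /andP[? ?] /andP[? ?] /andP[? ?]; apply/andP; split; lra.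
have cx := clim _ _ Hx (fun n s t => (itlip n s t).1).
have cy := clim _ _ Hy (fun n s t => (itlip n s t).2).
have fix_eq h c (u : nat -> R -> R) (z : R -> R) : lipschitz2 L h ->
    (forall n t, u n.+1 t = c + P (fun s => h ((it n).1 s) ((it n).2 s)) t) ->
    (forall n t, `|u n t - z t| <= 2 * (C * expR (lam * `|t|)) / 2 ^+ n) ->
    z = fun t => c + P (fun s => h (x s) (y s)) t.
  move=> Lh Hu Hz; apply/funext => t.
  have ch : continuous (fun s => h (x s) (y s)) by exact: (cont2 (p := (x, y)) Lh).
  have est n : `|u n.+1 t - (c + P (fun s => h (x s) (y s)) t)| <=
               C / 2 ^+ n * expR (lam * `|t|).
    rewrite Hu; have [c1 c2] := itc n; have dh := cont2 Lh c1 c2.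
    have D1 := derivP c ch; have D2 := derivP c dh.
    have [p0 _] := PP ch; have [q0 _] := PP dh.
    apply: (@exp_growth (fun t => (c + P (fun s => h ((it n).1 s) ((it n).2 s)) t) -
       (c + P (fun s => h (x s) (y s)) t)) _ (C / 2 ^+ n) lam) => //.
    - by rewrite divr_ge0 // exprn_ge0.
    - by rewrite p0 q0 subrr.
      move=> s; apply: (le_trans (Lh _ _ _ _)).
    have -> : C / 2 ^+ n * lam * expR (lam * `|s|) =
              L * (2 * (C * expR (lam * `|s|)) / 2 ^+ n + 2 * (C * expR (lam * `|s|)) / 2 ^+ n).
      by rewrite /lam; field; rewrite gt_eqF // exprn_gt0.
    by rewrite ler_pM2l // lerD.
  apply/eqP; rewrite -subr_eq0 -normr_le0.
  apply: (@le_add_geometric _ _ (2 * (C * expR (lam * `|t|)))) => n; rewrite add0r.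
  have := Hz n.+1 t; have := est n.
  have -> : 2 * (C * expR (lam * `|t|)) / 2 ^+ n.+1 = C / 2 ^+ n * expR (lam * `|t|).
    by rewrite exprS; field; rewrite gt_eqF // exprn_gt0.
  have -> : 2 * (C * expR (lam * `|t|)) / 2 ^+ n =
    C / 2 ^+ n * expR (lam * `|t|) + C / 2 ^+ n * expR (lam * `|t|).
    by field; rewrite gt_eqF // exprn_gt0.
  by rewrite !ler_norml => /andP[? ?] /andP[? ?]; apply/andP; split; lra.
have Ex := fix_eq f x0 (fun n => (it n).1) x Lf (fun n t => erefl) Hx.
have Ey := fix_eq g y0 (fun n => (it n).2) y Lg (fun n t => erefl) Hy.
have cf : continuous (fun s => f (x s) (y s)) by exact: (cont2 (p := (x, y)) Lf).
have cg : continuous (fun s => g (x s) (y s)) by exact: (cont2 (p := (x, y)) Lg).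
exists x, y; split.
- by rewrite Ex (PP cf).1 addr0.
- by rewrite Ey (PP cg).1 addr0.
move=> t; split.
  by rewrite {1}Ex; exact: derivP.
by rewrite {1}Ey; exact: derivP.
Qed.

End Picard.

Theorem picard (f g : R -> R -> R) (K L x0 y0 : R) : 0 < L ->
  lipschitz2 L f -> lipschitz2 L g ->
  (forall x y, `|f x y| <= K) -> (forall x y, `|g x y| <= K) ->
  exists x y : R -> R, [/\ x 0 = x0, y 0 = y0 &
  forall t, is_derive t (1 : R) x (f (x t) (y t)) /\ is_derive t (1 : R) y (g (x t) (y t))].
Proof.
move=> L0 Lf Lg Kf Kg.
have /choice[P HP] : forall h : R -> R, exists F : R -> R, continuous h ->
    F 0 = 0 /\ forall t, is_derive t (1 : R) F (h t).
  move=> h; have [/primitive_exists[F HF]|nc] := pselect (continuous h); first by exists F.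
  by exists id.
exact: (picard_aux _ _ L0 Lf Lg Kf Kg HP).
Qed.

End RealAnalysis.

(** * Repelling critical points of the rescaled system *)

Section BoundedLipschitz.
Variable R : realType.
Implicit Types (f g : R -> R -> R).

(** A class of fields stable under the operations from which the rates are built,
    as products of unbounded Lipschitz functions would not be. *)
Definition bounded_lipschitz f :=
  exists K L : R, [/\ 0 <= K, 0 <= L, forall x y, `|f x y| <= K & lipschitz2 L f].

Lemma bounded_lipschitz_cst (k : R) : bounded_lipschitz (fun _ _ => k).
Proof.
exists `|k|, 0; split=> // x y x' y'; by rewrite subrr normr0 mul0r.
Qed.

Lemma bounded_lipschitzD f g : bounded_lipschitz f -> bounded_lipschitz g ->
  bounded_lipschitz (fun x y => f x y + g x y).
Proof.
move=> [K [L [K0 L0 Kf Lf]]] [K' [L' [K0' L0' Kg Lg]]].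
exists (K + K'), (L + L'); split=> [||x y|x y x' y']; rewrite ?addr_ge0 //.
  by rewrite (le_trans (ler_normD _ _)) // lerD.
by rewrite mulrDl opprD addrACA (le_trans (ler_normD _ _)) // lerD.
Qed.

Lemma bounded_lipschitzM f g : bounded_lipschitz f -> bounded_lipschitz g ->
  bounded_lipschitz (fun x y => f x y * g x y).
Proof.
move=> [K [L [K0 L0 Kf Lf]]] [K' [L' [K0' L0' Kg Lg]]].
exists (K * K'), (K * L' + K' * L); split=> [||x y|x y x' y'].
- by rewrite mulr_ge0.
- by rewrite addr_ge0 // mulr_ge0.
- by rewrite normrM ler_pM.
have -> : f x y * g x y - f x' y' * g x' y' =
  f x y * (g x y - g x' y') + g x' y' * (f x y - f x' y') by ring.
by rewrite mulrDl (le_trans (ler_normD _ _)) // !normrM -!mulrA lerD // ler_pM.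
Qed.

Lemma bounded_lipschitzN f : bounded_lipschitz f -> bounded_lipschitz (fun x y => - f x y).
Proof.
move=> [K [L [K0 L0 Kf Lf]]]; exists K, L; split=> // [x y|x y x' y'].
  by rewrite normrN.
by rewrite -opprD normrN; exact: Lf.
Qed.

Lemma bounded_lipschitzX f n : bounded_lipschitz f -> bounded_lipschitz (fun x y => f x y ^+ n).
Proof.
move=> bf; elim: n => [|n IH]; first exact: bounded_lipschitz_cst.
have -> : (fun x y => f x y ^+ n.+1) = (fun x y => f x y * f x y ^+ n).
  by apply/funext => x; apply/funext => y; rewrite exprS.
exact: bounded_lipschitzM.
Qed.

Lemma bounded_lipschitzV f (m : R) : 0 < m -> (forall x y, m <= f x y) ->
  bounded_lipschitz f -> bounded_lipschitz (fun x y => (f x y)^-1).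
Proof.
move=> m0 mf [K [L [K0 L0 Kf Lf]]]; exists m^-1, (m^-1 * m^-1 * L).
have f0 x y : 0 < f x y by exact: lt_le_trans (mf x y).
have fm x y : (f x y)^-1 <= m^-1 by rewrite lef_pV2 ?posrE.
split=> [||x y|x y x' y'].
- by rewrite invr_ge0 ltW.
- by rewrite !mulr_ge0 // invr_ge0 ltW.
- by rewrite ger0_norm // invr_ge0 ltW.
have -> : (f x y)^-1 - (f x' y')^-1 = (f x y)^-1 * (f x' y')^-1 * (f x' y' - f x y).
  by field; rewrite !gt_eqF.
rewrite normrM -[m^-1 / m * L * _]mulrA ler_pM //.
  rewrite ger0_norm ?mulr_ge0 ?invr_ge0 ?(ltW (f0 _ _)) //.
  by rewrite ler_pM // invr_ge0 ltW.
by rewrite distrC; exact: Lf.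
Qed.

(** The point of [c - d, c + d] nearest to x. *)
Definition clamp (c d x : R) := Num.max (c - d) (Num.min (c + d) x).

Lemma clamp_id (c d x : R) : `|x - c| <= d -> clamp c d x = x.
Proof.
rewrite ler_distl => /andP[h1 h2]; rewrite /clamp (min_idPr h2).
exact/max_idPr.
Qed.

Lemma clamp_ge (c d x : R) : c - d <= clamp c d x.
Proof. by rewrite /clamp le_max lexx. Qed.

Lemma clamp_dist (c d x : R) : 0 <= d -> `|clamp c d x - c| <= d.
Proof.
move=> d0; rewrite ler_distl /clamp le_max lexx /= ge_max ge_min lexx andbT.
lra.
Qed.

Lemma max_lipschitz (m x x' : R) : `|Num.max m x - Num.max m x'| <= `|x - x'|.
Proof.
have := ler_norm (x - x'); have := ler_norm (x' - x); rewrite (distrC x').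
by case: (leP m x) => h; case: (leP m x') => h' ? ?;
  rewrite ler_norml; apply/andP; split; lra.
Qed.

Lemma min_lipschitz (m x x' : R) : `|Num.min m x - Num.min m x'| <= `|x - x'|.
Proof.
have := ler_norm (x - x'); have := ler_norm (x' - x); rewrite (distrC x').
by case: (leP m x) => h; case: (leP m x') => h' ? ?;
  rewrite ler_norml; apply/andP; split; lra.
Qed.

Lemma clamp_lipschitz (c d x x' : R) : `|clamp c d x - clamp c d x'| <= `|x - x'|.
Proof. exact: le_trans (max_lipschitz _ _ _) (min_lipschitz _ _ _). Qed.

Lemma bounded_lipschitz_clamp1 (c d : R) : 0 <= d ->
  bounded_lipschitz (fun x _ => clamp c d x).
Proof.
move=> d0; exists (`|c| + d), 1; split=> // [|x y|x y x' y'].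
- by rewrite addr_ge0.
- have := clamp_dist c x d0; have := ler_normD (clamp c d x - c) c.
  by rewrite subrK; lra.
- by have := clamp_lipschitz c d x x'; have := normr_ge0 (y - y'); lra.
Qed.

Lemma bounded_lipschitz_clamp2 (c d : R) : 0 <= d ->
  bounded_lipschitz (fun _ x => clamp c d x).
Proof.
move=> d0; exists (`|c| + d), 1; split=> // [|x y|x y x' y'].
- by rewrite addr_ge0.
- have := clamp_dist c y d0; have := ler_normD (clamp c d y - c) c.
  by rewrite subrK; lra.
- by have := clamp_lipschitz c d y y'; have := normr_ge0 (x - x'); lra.
Qed.

Lemma bounded_lipschitz_solution f g (x0 y0 : R) :
  bounded_lipschitz f -> bounded_lipschitz g ->
  exists x y : R -> R, [/\ x 0 = x0, y 0 = y0 &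
  forall t, is_derive t (1 : R) x (f (x t) (y t)) /\ is_derive t (1 : R) y (g (x t) (y t))].
Proof.
move=> [K [L [K0 L0 Kf Lf]]] [K' [L' [K0' L0' Kg Lg]]].
have Lm f' l (m : R) : l <= m -> lipschitz2 l f' -> lipschitz2 m f'.
  move=> lm H x y x' y'; apply: (le_trans (H _ _ _ _)).
  by rewrite ler_wpM2r // addr_ge0.
apply: (@picard _ f g (K + K') (L + L' + 1)).
- lra.
- by apply: Lm Lf; lra.
- by apply: Lm Lg; lra.
- by move=> x y; have := Kf x y; lra.
- by move=> x y; have := Kg x y; lra.
Qed.

End BoundedLipschitz.

Section BackwardDecay.
Variable R : realType.

(** The function w(t) e^(b - t) is nondecreasing. *)
Lemma derive_ge_decay (w dw : R -> R) (a b : R) : a <= b ->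
  (forall t, a <= t <= b -> is_derive t (1 : R) w (dw t)) ->
  (forall t, a <= t <= b -> w t <= dw t) -> w a <= w b * expR (a - b).
Proof.
move=> ab Dw Hw.
have De t : is_derive t (1 : R) (fun t => expR (b - t)) (- expR (b - t)).
  have Dl : is_derive t (1 : R) (fun t : R => b - t) (0 - 1) by apply: is_deriveB.
  have := @is_derive1_comp R expR (fun t => b - t) t _ _ (is_derive_expR (b - t)) Dl.
  by rewrite sub0r mulrN1.
have := @derive_ge0_le R (fun t => w t * expR (b - t))
   (fun t => (dw t - w t) * expR (b - t)) a b ab.
rewrite subrr expR0 mulr1.
have -> : expR (a - b) = (expR (b - a))^-1 by rewrite -expRN opprB.
rewrite ler_pdivlMr ?expR_gt0 //; apply.
  move=> t /Dw Dwt; have := is_deriveM Dwt (De t).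
  by rewrite /GRing.scale /= => H; apply: is_derive_eq H _; ring.
by move=> t /Hw h; rewrite mulr_ge0 ?expR_ge0 // subr_ge0.
Qed.

(** The sublevel set w < r cannot be left backwards in time: at the last time m
    at which w >= r one has w(m) = r, but on [m, b] the inequality w' >= w >= 0
    holds, so that w(m) <= w(b) < r. *)
Lemma backward_decay (w dw : R -> R) (r a b : R) : a <= b ->
  (forall t, a <= t <= b -> is_derive t (1 : R) w (dw t)) ->
  (forall t, a <= t <= b -> 0 <= w t) ->
  (forall t, a <= t <= b -> w t <= r -> w t <= dw t) ->
  w b < r -> (forall t, a <= t <= b -> w t < r) /\ w a <= w b * expR (a - b).
Proof.
move=> ab Dw w0 Hw wb.
have Hr : forall t, a <= t <= b -> w t < r.
  move=> t tab; rewrite ltNge; apply/negP => wt.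
  pose S := [set s | t <= s <= b /\ r <= w s].
  have St : S t by split=> //; move/andP: tab => [_ ->]; rewrite lexx.
  have hs : has_sup S by split; [exists t | exists b => s [/andP[]]].
  pose m := sup S.
  have tm : t <= m by apply: sup_upper_bound.
  have mb : m <= b by apply: ge_sup; [exists t | move=> s [/andP[]]].
  have mab : a <= m <= b by case/andP: tab => at_ _; rewrite mb (le_trans at_).
  have cw s : a <= s <= b -> {for s, continuous w}.
    by move=> /Dw; exact: is_derive_continuous.
  have rm : r <= w m.
    rewrite leNgt; apply/negP => wm.
    have : \forall s \near m, w s < r by exact: (cvgr_lt _ (cw m mab)).
    move=> /nbhs_ballP[e /= e0 He].
    have [s Ss ms] := sup_adherent e0 hs.
    have sm : s <= m by apply: sup_upper_bound.
    case: Ss => _; rewrite leNgt => /negP; apply; apply: He.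
    by rewrite /ball /= ger0_norm ?subr_ge0 //; move: ms; rewrite -/m; lra.
  have mb' : m < b by rewrite lt_neqAle mb andbT; apply: contraTneq rm => ->; rewrite -ltNge.
  have above s : m < s -> s <= b -> w s < r.
    move=> ms sb; rewrite ltNge; apply/negP => ws.
    have : s <= m by apply: sup_upper_bound => //; split=> //; rewrite sb andbT; lra.
    by rewrite leNgt ms.
  have wmr : w m <= r.
    rewrite leNgt; apply/negP => wm.
    have : \forall s \near m, r < w s by exact: (cvgr_gt _ (cw m mab)).
    move=> /nbhs_ballP[e /= e0 He].
    pose s := m + Num.min (e / 2) (b - m).
    have k0 : 0 < Num.min (e / 2) (b - m) by rewrite lt_min subr_gt0 mb' andbT divr_gt0.
    have k1 : Num.min (e / 2) (b - m) <= e / 2 by rewrite ge_min lexx.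
    have k2 : Num.min (e / 2) (b - m) <= b - m by rewrite ge_min lexx orbT.
    have h1 : r < w s.
      apply: He; rewrite /ball /= /s opprD addrA subrr sub0r normrN gtr0_norm //; lra.
    have : w s < r by apply: above; rewrite /s; lra.
    by lra.
  have : w m <= w b * expR (m - b).
    apply: (@derive_ge_decay w dw) => // s /andP[ms sb].
      by apply: Dw; case/andP: mab => am _; rewrite sb (le_trans am).
    have sab : a <= s <= b by case/andP: mab => am _; rewrite sb (le_trans am).
    apply: Hw => //; move: ms; rewrite le_eqVlt => /orP[/eqP <- //|ms].
    exact/ltW/above.
  have wb0 : 0 <= w b by apply: w0; rewrite ab lexx.
  have : expR (m - b) <= 1 by rewrite -expR0 ler_expR subr_le0.
  have := expR_ge0 (m - b); nra.
split=> //; apply: (derive_ge_decay ab Dw) => t tab; apply: Hw => //.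
exact/ltW/Hr.
Qed.

End BackwardDecay.

Section PlanarSystem.
Variable R : realType.
Implicit Types (X Z : R).

(** The derivatives with respect to s of X = a^2 / c^2 and, in [rate_Z], of
    Z = eps a b / c^2 under the Laplacian flow; see [family_flow_rates]. *)
Definition rate_X X Z : R :=
  16 * X ^+ 2 + 8 * X + 16 * Z - 4 * Z ^+ 2 / X - 16 * X * Z - 8 + 8 * Z / X
  - 4 * Z ^+ 2 / X ^+ 2.

Definition rate_Z X Z : R :=
  Z * (16 + 8 * Z ^+ 2 / X + 12 * Z / X - 8 * Z ^+ 2 / X ^+ 2 - 8 * Z - 8 / X
       + 4 * Z / X ^+ 2).

(** The logarithmic derivative of c with respect to s, needed to lift a planar
    solution to the family. *)
Definition rate_c X Z : R :=
  (16 * X + 32 * Z - 8 + 24 / X + 4 * Z ^+ 2 / X ^+ 2 - 8 * Z / X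
   - 16 * Z / X ^+ 2 + 4 * Z ^+ 2 / X ^+ 3) / 6.

Lemma small_mul (d x y : R) : `|x| <= d -> `|y| <= 1 -> `|x * y| <= d.
Proof. by move=> hx hy; rewrite normrM -[leRHS]mulr1 ler_pM. Qed.

(** A quadratic form whose coefficients may themselves vary is nonnegative when
    bounds on them have the right discriminant. *)
Lemma quadratic_ge0 (al be ga x z m n k : R) : m <= al -> `|be| <= n -> k <= ga ->
  0 <= m -> 0 <= k -> n ^+ 2 <= 4 * m * k -> 0 <= al * x ^+ 2 + be * x * z + ga * z ^+ 2.
Proof.
move=> mal ben kga m0 k0 nmk.
have x2 : 0 <= x ^+ 2 by exact: sqr_ge0.
have z2 : 0 <= z ^+ 2 by exact: sqr_ge0.
have n0 : 0 <= n by exact: le_trans ben.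
have h1 : - (n * (`|x| * `|z|)) <= be * x * z.
  have : `|be * x * z| <= n * (`|x| * `|z|) by rewrite !normrM -mulrA ler_wpM2r // mulr_ge0.
  by rewrite ler_norml => /andP[].
suff h2 : n * (`|x| * `|z|) <= m * x ^+ 2 + k * z ^+ 2 by nra.
rewrite -(real_normK (num_real x)) -(real_normK (num_real z)).
rewrite -(@ler_pXn2r _ 2) ?nnegrE //; last first.
- by rewrite addr_ge0 // mulr_ge0 // exprn_ge0.
- by rewrite !mulr_ge0.
set a := `|x|; set b := `|z|.
have ab : 0 <= (a * b) ^+ 2 by exact: sqr_ge0.
have : 0 <= (m * a ^+ 2 - k * b ^+ 2) ^+ 2 by exact: sqr_ge0.
have : n ^+ 2 * (a * b) ^+ 2 <= 4 * m * k * (a * b) ^+ 2 by rewrite ler_wpM2r.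
by rewrite !exprMn; nra.
Qed.

(** The left-hand side is (x + 2z)^2 + (x - z)^2, and the right-hand side is its
    derivative along the flow.  Multiplied by X^2, their difference is a
    polynomial in x and z without terms of degree below 2, hence a quadratic
    form whose coefficients are polynomials close to their constant terms. *)
Lemma lyapunov_np (x z : R) : `|x| <= 1 / 100 -> `|z| <= 1 / 100 ->
  2 * x ^+ 2 + 2 * x * z + 5 * z ^+ 2 <=
  (4 * x + 2 * z) * rate_X (1 / 5 + x) (1 / 5 + z)
  + (2 * x + 10 * z) * rate_Z (1 / 5 + x) (1 / 5 + z).
Proof.
move=> hx hz; have := hx; rewrite ler_norml => /andP[x1 x2].
have hx1 : `|x| <= 1 by lra. have hz1 : `|z| <= 1 by lra.
have X0 : 1 / 5 + x != 0 by rewrite gt_eqF //; lra.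
have Xp : 0 < (1 / 5 + x) ^+ 2 by rewrite exprn_even_gt0.
rewrite -subr_ge0 -(pmulr_rge0 _ Xp).
pose al := 64 * (x * x * x) + 342 / 5 * (x * x) + 316 / 25 * x + 318 / 125
  + 422 / 5 * (x * z) + 2028 / 25 * z + 147 * (z * z) - 32 * (x * x * z)
  - 48 * (x * z * z) - 64 * (z * z * z).
pose be := 534 / 125 + 846 / 25 * z + 576 / 5 * (z * z) + 80 * (z * z * z).
pose ga := 903 / 125 + 64 / 5 * z - 64 * (z * z).
have -> : (1 / 5 + x) ^+ 2 * ((4 * x + 2 * z) * rate_X (1 / 5 + x) (1 / 5 + z)
  + (2 * x + 10 * z) * rate_Z (1 / 5 + x) (1 / 5 + z) - (2 * x ^+ 2 + 2 * x * z + 5 * z ^+ 2))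
  = al * x ^+ 2 + be * x * z + ga * z ^+ 2.
  rewrite /rate_X /rate_Z /al /be /ga; have [X XE] : exists X, X = 1 / 5 + x by eexists.
  by rewrite -XE in X0 *; have -> : x = X - 1 / 5 by [rewrite XE addrC addKr]; field.
(* Monomials of degree at least 2 are bounded by e, which turns the bounds on
   the coefficients into linear inequalities. *)
have [e eE] : exists e : R, e = 1 / 100 * (1 / 100) by eexists.
have bd (a b : R) : `|a| <= 1 / 100 -> `|b| <= 1 / 100 -> `|a * b| <= e.
  by move=> ha hb; rewrite normrM eE ler_pM.
have bd3 (a b : R) : `|a| <= e -> `|b| <= 1 -> `|a * b| <= e by exact: small_mul.
have e100 : 100 * e = 1 / 100 by rewrite eE; field.
have xx := bd _ _ hx hx; have xz := bd _ _ hx hz; have zz := bd _ _ hz hz.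
have xxx := bd3 _ _ xx hx1; have xxz := bd3 _ _ xx hz1; have xzz := bd3 _ _ xz hz1.
have zzz := bd3 _ _ zz hz1.
move: hx hz xx xz zz xxx xxz xzz zzz; rewrite !ler_norml.
do 9 move=> /andP[? ?].
suff [h1 h2 h3 h4] : [/\ 3 / 2 <= al, - 5 <= be, be <= 5 & 7 <= ga].
  by apply: (@quadratic_ge0 _ _ _ _ _ (3 / 2) 5 7); rewrite ?ler_norml ?h2 //; lra.
rewrite /al /be /ga; clear al be ga bd bd3 eE Xp X0 hx1 hz1 x1 x2.
by split; lra.
Qed.

(** As in [lyapunov_np], with (x + 2z)^2 + (3x + z)^2. *)
Lemma lyapunov_ts (x z : R) : `|x| <= 1 / 100 -> `|z| <= 1 / 100 ->
  10 * x ^+ 2 + 10 * x * z + 5 * z ^+ 2 <=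
  (20 * x + 10 * z) * rate_X (1 + x) (- 1 + z)
  + (10 * x + 10 * z) * rate_Z (1 + x) (- 1 + z).
Proof.
move=> hx hz; have := hx; rewrite ler_norml => /andP[x1 x2].
have hx1 : `|x| <= 1 by lra. have hz1 : `|z| <= 1 by lra.
have X0 : 1 + x != 0 by rewrite gt_eqF //; lra.
have Xp : 0 < (1 + x) ^+ 2 by rewrite exprn_even_gt0.
rewrite -subr_ge0 -(pmulr_rge0 _ Xp).
pose al := 320 * (x * x * x) + 1750 * (x * x) + 2620 * x + 1150
  + 550 * (x * z) + 1740 * z - 365 * (z * z) - 160 * (x * x * z)
  - 240 * (x * z * z).
pose be := 790 + 470 * z - 320 * (z * z) + 80 * (z * z * z).
have -> : (1 + x) ^+ 2 * ((20 * x + 10 * z) * rate_X (1 + x) (- 1 + z)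
  + (10 * x + 10 * z) * rate_Z (1 + x) (- 1 + z) - (10 * x ^+ 2 + 10 * x * z + 5 * z ^+ 2))
  = al * x ^+ 2 + be * x * z + 155 * z ^+ 2.
  rewrite /rate_X /rate_Z /al /be; have [X XE] : exists X, X = 1 + x by eexists.
  by rewrite -XE in X0 *; have -> : x = X - 1 by [rewrite XE addrC addKr]; field.
have [e eE] : exists e : R, e = 1 / 100 * (1 / 100) by eexists.
have bd (a b : R) : `|a| <= 1 / 100 -> `|b| <= 1 / 100 -> `|a * b| <= e.
  by move=> ha hb; rewrite normrM eE ler_pM.
have bd3 (a b : R) : `|a| <= e -> `|b| <= 1 -> `|a * b| <= e by exact: small_mul.
have e100 : 100 * e = 1 / 100 by rewrite eE; field.
have xx := bd _ _ hx hx; have xz := bd _ _ hx hz; have zz := bd _ _ hz hz.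
have xxx := bd3 _ _ xx hx1; have xxz := bd3 _ _ xx hz1; have xzz := bd3 _ _ xz hz1.
have zzz := bd3 _ _ zz hz1.
move: hx hz xx xz zz xxx xxz xzz zzz; rewrite !ler_norml.
do 9 move=> /andP[? ?].
suff [h1 h2 h3] : [/\ 22 <= al / 50, - 16 <= be / 50 & be / 50 <= 16].
  have h : 0 <= al / 50 * x ^+ 2 + be / 50 * x * z + 31 / 10 * z ^+ 2.
    by apply: (@quadratic_ge0 _ _ _ _ _ 22 16 (31 / 10)); rewrite ?ler_norml ?h2 //; lra.
  have -> : al * x ^+ 2 + be * x * z + 155 * z ^+ 2 =
    50 * (al / 50 * x ^+ 2 + be / 50 * x * z + 31 / 10 * z ^+ 2) by field.
  exact: mulr_ge0.
rewrite /al /be; clear al be bd bd3 eE Xp X0 hx1 hz1 x1 x2.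
by split; lra.
Qed.

Lemma expR_decay_lt (v d s : R) : 0 < d -> v / d ^+ 2 <= s -> v * expR (- s) < d ^+ 2.
Proof.
move=> d0 h; have d2 : 0 < d ^+ 2 by rewrite exprn_gt0.
have : s < expR s by have := expR_ge1Dx s; lra.
move=> /(le_lt_trans h); rewrite ltr_pdivrMr // => h'.
by rewrite expRN ltr_pdivrMr ?expR_gt0 // [ltRHS]mulrC.
Qed.

(** T stands for the trajectories of the rescaled flow.  Only two facts about it
    enter: its elements solve the planar system, and solutions of the planar system
    are elements of it. *)
Section Repelling.
Variables (T : set R -> (R -> R * R) -> Prop) (p q A B C eps : R).
Let dl : R := 1 / 100.
Let V (x z : R) := A * (x - p) ^+ 2 + B * (x - p) * (z - q) + C * (z - q) ^+ 2.
Let dV (x z : R) := (2 * A * (x - p) + B * (z - q)) * rate_X x z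
  + (B * (x - p) + 2 * C * (z - q)) * rate_Z x z.

Hypotheses (eps2 : eps * eps = 1) (p_gt : dl < p) (q_gt : dl < eps * q).
Hypothesis V_bounds : forall x z,
  (x - p) ^+ 2 + (z - q) ^+ 2 <= V x z <= 15 * ((x - p) ^+ 2 + (z - q) ^+ 2).
Hypothesis V_growth : forall x z, `|x - p| <= dl -> `|z - q| <= dl -> V x z <= dV x z.
Hypothesis T_solution : forall J gam, T J gam ->
  [/\ open J, is_interval J, J 0 &
  forall s, J s -> 0 < (gam s).1 /\
    is_derive s (1 : R) (fun s => (gam s).1) (rate_X (gam s).1 (eps * (gam s).2)) /\
    is_derive s (1 : R) (fun s => eps * (gam s).2) (rate_Z (gam s).1 (eps * (gam s).2))].
Hypothesis solution_T : forall (J : set R) (x z k : R -> R), open J -> is_interval J -> J 0 ->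
  continuous k ->
  (forall s, J s -> [/\ 0 < x s, 0 < eps * z s, k s = rate_c (x s) (z s),
    is_derive s (1 : R) x (rate_X (x s) (z s)) & is_derive s (1 : R) z (rate_Z (x s) (z s))]) ->
  T J (fun s => (x s, eps * z s)).

Let dl0 : 0 < dl. Proof. by rewrite /dl divr_gt0. Qed.

Let eps_norm : `|eps| = 1.
Proof.
by apply/eqP; rewrite -(@eqrXn2 _ 2) // expr1n real_normK ?num_real // expr2 eps2.
Qed.

Let V_ge0 x z : 0 <= V x z.
Proof.
have /andP[h _] := V_bounds x z; apply: le_trans h.
by rewrite addr_ge0 // sqr_ge0.
Qed.

Let V_lt (x z e : R) : 0 < e -> V x z < e ^+ 2 -> `|x - p| < e /\ `|z - q| < e.
Proof.
move=> e0 Ve; have /andP[h _] := V_bounds x z.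
have h1 : 0 <= (x - p) ^+ 2 by exact: sqr_ge0.
have h2 : 0 <= (z - q) ^+ 2 by exact: sqr_ge0.
split; rewrite -(@ltr_pXn2r _ 2) ?nnegrE ?normr_ge0 ?(ltW e0) // real_normK ?num_real //; lra.
Qed.

Let V_lt_ball (x z d : R) : `|x - p| < d / 6 -> `|z - q| < d / 6 -> V x z < d ^+ 2.
Proof.
move=> hx hz; have /andP[_ h] := V_bounds x z; apply: (le_lt_trans h).
have d0 : 0 < d by have := normr_ge0 (x - p); lra.
have sq (y : R) : `|y| < d / 6 -> y ^+ 2 < (d / 6) ^+ 2.
  move=> hy; rewrite -real_normK ?num_real // ltr_pXn2r ?nnegrE //.
  by rewrite divr_ge0 // ltW.
have := sq _ hx; have := sq _ hz; rewrite expr_div_n.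
have : 0 < d ^+ 2 by rewrite exprn_gt0.
by rewrite (_ : (6 : R) ^+ 2 = 36); [lra | rewrite -natrX].
Qed.

Let V_eq0 x z : V x z <= 0 -> x = p /\ z = q.
Proof.
move=> h; have /andP[h' _] := V_bounds x z.
have h1 : 0 <= (x - p) ^+ 2 by exact: sqr_ge0.
have h2 : 0 <= (z - q) ^+ 2 by exact: sqr_ge0.
have e1 : (x - p) ^+ 2 == 0 by rewrite eq_le h1 andbT; lra.
have e2 : (z - q) ^+ 2 == 0 by rewrite eq_le h2 andbT; lra.
by move: e1 e2; rewrite !sqrf_eq0 !subr_eq0 => /eqP -> /eqP ->.
Qed.

Let V_derive (x z : R -> R) s dx dz : is_derive s (1 : R) x dx -> is_derive s (1 : R) z dz ->
  is_derive s (1 : R) (fun s => V (x s) (z s))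
    ((2 * A * (x s - p) + B * (z s - q)) * dx + (B * (x s - p) + 2 * C * (z s - q)) * dz).
Proof.
move=> Dx Dz.
have Dx' : is_derive s (1 : R) (fun s => x s - p) dx.
  by rewrite -[X in is_derive _ _ _ X]subr0; apply: is_deriveB.
have Dz' : is_derive s (1 : R) (fun s => z s - q) dz.
  by rewrite -[X in is_derive _ _ _ X]subr0; apply: is_deriveB.
have D1 := is_deriveZ A (is_deriveM Dx' Dx').
have D2 := is_deriveZ B (is_deriveM Dx' Dz').
have D3 := is_deriveZ C (is_deriveM Dz' Dz').
have -> : (fun s => V (x s) (z s)) =
   (A *: ((fun s => x s - p) * (fun s => x s - p)) + B *: ((fun s => x s - p) * (fun s => z s - q))
   + C *: ((fun s => z s - q) * (fun s => z s - q)))%R.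
  by apply/funext => t; rewrite /V !fctE /GRing.scale /=; ring.
apply: is_derive_eq (is_deriveD (is_deriveD D1 D2) D3) _.
by rewrite /GRing.scale /=; ring.
Qed.

Let V_le x z : V x z <= dl ^+ 2 -> `|x - p| <= dl /\ `|z - q| <= dl.
Proof.
move=> Ve; have /andP[h _] := V_bounds x z.
have h1 : 0 <= (x - p) ^+ 2 by exact: sqr_ge0.
have h2 : 0 <= (z - q) ^+ 2 by exact: sqr_ge0.
split; rewrite -(@ler_pXn2r _ 2) ?nnegrE ?normr_ge0 ?(ltW dl0) // real_normK ?num_real //; lra.
Qed.

Let V_decay (x z dx dz : R -> R) (a b : R) : a <= b ->
  (forall s, a <= s <= b -> [/\ is_derive s (1 : R) x (dx s), is_derive s (1 : R) z (dz s) &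
     `|x s - p| <= dl -> `|z s - q| <= dl ->
     dx s = rate_X (x s) (z s) /\ dz s = rate_Z (x s) (z s)]) ->
  V (x b) (z b) < dl ^+ 2 ->
  (forall s, a <= s <= b -> V (x s) (z s) < dl ^+ 2) /\
  V (x a) (z a) <= V (x b) (z b) * expR (a - b).
Proof.
move=> ab H Vb.
apply: (@backward_decay R (fun s => V (x s) (z s)) (fun s =>
  (2 * A * (x s - p) + B * (z s - q)) * dx s + (B * (x s - p) + 2 * C * (z s - q)) * dz s)
  (dl ^+ 2) a b ab) => //.
  by move=> s /H[Dx Dz _]; exact: V_derive.
by move=> s /H[_ _ Hs] /V_le[hx hz]; have [-> ->] := Hs hx hz; exact: V_growth.
Qed.

Let box_pos x z : V x z < dl ^+ 2 -> 0 < x /\ 0 < eps * z.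
Proof.
move=> /(V_lt dl0)[]; rewrite ltr_distl => /andP[h1 _] h2; split; first by move: p_gt; lra.
have : `|eps * z - eps * q| < dl by rewrite -mulrBr normrM eps_norm mul1r.
by rewrite ltr_distl => /andP[h3 _]; move: q_gt; lra.
Qed.

(** Cutting the field off outside the square makes it bounded and Lipschitz,
    hence globally solvable; the backward estimate keeps the past of the solution
    in the square, where the field is unchanged. *)
Let local_solution (x0 z0 : R) : V x0 z0 < dl ^+ 2 ->
  exists (x z k : R -> R) (e : R), [/\ x 0 = x0, z 0 = z0, continuous k, 0 < e &
    (forall s, s < e -> [/\ V (x s) (z s) < dl ^+ 2, k s = rate_c (x s) (z s),
      is_derive s (1 : R) x (rate_X (x s) (z s)) & is_derive s (1 : R) z (rate_Z (x s) (z s))]) /\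
    forall s, s <= 0 -> V (x s) (z s) <= V x0 z0 * expR s].
Proof.
move=> V0; have dl0' := ltW dl0.
pose X (x _ : R) := clamp p dl x; pose Z (_ z : R) := clamp q dl z.
have bX : bounded_lipschitz X by exact: bounded_lipschitz_clamp1.
have bZ : bounded_lipschitz Z by exact: bounded_lipschitz_clamp2.
have pd : 0 < p - dl by rewrite subr_gt0.
have bW : bounded_lipschitz (fun x z => (X x z)^-1).
  by apply: (bounded_lipschitzV pd) => // x z; exact: clamp_ge.
have bWn n : bounded_lipschitz (fun x z => (X x z ^+ n)^-1).
  have -> : (fun x z => (X x z ^+ n)^-1) = (fun x z => (X x z)^-1 ^+ n).
    by apply/funext => x; apply/funext => z; rewrite exprVn.
  exact: bounded_lipschitzX.
have bl := (bounded_lipschitz_cst, bX, bZ, bW).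
have bf : bounded_lipschitz (fun x z => rate_X (X x z) (Z x z)).
  rewrite /rate_X; repeat first [exact: bounded_lipschitz_cst | exact: bX | exact: bZ | exact: bW
   | exact: bWn | apply: bounded_lipschitzD | apply: bounded_lipschitzN
   | apply: bounded_lipschitzM | apply: bounded_lipschitzX].
have bg : bounded_lipschitz (fun x z => rate_Z (X x z) (Z x z)).
  rewrite /rate_Z; repeat first [exact: bounded_lipschitz_cst | exact: bX | exact: bZ | exact: bW
   | exact: bWn | apply: bounded_lipschitzD | apply: bounded_lipschitzN
   | apply: bounded_lipschitzM | apply: bounded_lipschitzX].
have bk : bounded_lipschitz (fun x z => rate_c (X x z) (Z x z)).
  rewrite /rate_c; repeat first [exact: bounded_lipschitz_cst | exact: bX | exact: bZ | exact: bW
   | exact: bWn | apply: bounded_lipschitzD | apply: bounded_lipschitzN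
   | apply: bounded_lipschitzM | apply: bounded_lipschitzX].
have [x [z [x00 z00 D]]] := bounded_lipschitz_solution x0 z0 bf bg.
have cx : continuous x by move=> t; exact: is_derive_continuous (D t).1.
have cz : continuous z by move=> t; exact: is_derive_continuous (D t).2.
have box s : V (x s) (z s) < dl ^+ 2 -> X (x s) (z s) = x s /\ Z (x s) (z s) = z s.
  by move=> /ltW/V_le[hx hz]; split; exact: clamp_id.
have dec s : s <= 0 -> V (x s) (z s) < dl ^+ 2 /\ V (x s) (z s) <= V x0 z0 * expR s.
  move=> s0.
  have := @V_decay x z (fun s => rate_X (X (x s) (z s)) (Z (x s) (z s)))
    (fun s => rate_Z (X (x s) (z s)) (Z (x s) (z s))) s 0 s0.
  rewrite x00 z00 subr0 => -[||h1 h2]; [|exact: V0|].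
    move=> r _; split; [exact: (D r).1|exact: (D r).2|].
    by move=> hx hz; rewrite /X /Z !clamp_id.
  by split=> //; apply: h1; rewrite lexx s0.
(* The estimate persists for a short positive time, so that 0 is interior to
   the interval of definition. *)
have [e e0 He] : exists2 e, 0 < e & forall s, s < e -> V (x s) (z s) < dl ^+ 2.
  have DV := V_derive (D 0).1 (D 0).2.
  have := cvgr_lt _ (is_derive_continuous DV) (dl ^+ 2).
  rewrite x00 z00 => /(_ _ V0) /nbhs_ballP[e /= e0 He]; exists e => // s se.
  have [s0|s0] := leP s 0; first exact: (dec s s0).1.
  by apply: He; rewrite /ball /= sub0r normrN gtr0_norm.
exists x, z, (fun s => rate_c (X (x s) (z s)) (Z (x s) (z s))), e; split=> //.
  have [K [L [_ L0 _ Lk]]] := bk.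
  exact: (lipschitz2_comp_continuous L0 Lk cx cz).
split=> [s se|s s0]; last exact: (dec s s0).2.
have Vs := He s se; have [eX eZ] := box s Vs; have [D1 D2] := D s.
by rewrite eX eZ in D1 D2 *.
Qed.

Let backward_T (x0 z0 : R) : V x0 z0 < dl ^+ 2 ->
  exists (x z : R -> R) (e : R), [/\ x 0 = x0, z 0 = z0, 0 < e,
    forall tau, 0 <= tau ->
      T `]-oo, e + tau[ (fun s => (x (s - tau), eps * z (s - tau))) &
    forall s, s <= 0 -> V (x s) (z s) <= V x0 z0 * expR s].
Proof.
move=> V0; have [x [z [k [e [x00 z00 ck e0 [H1 H2]]]]]] := local_solution V0.
exists x, z, e; split=> // tau tau0.
apply: (@solution_T _ (fun s => x (s - tau)) (fun s => z (s - tau)) (fun s => k (s - tau))).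
- exact: interval_open.
- exact: interval_is_interval.
- by rewrite /= in_itv /=; lra.
- move=> s; apply: continuous_comp; last exact: ck.
  by apply: cvgB; [exact: cvg_id | exact: cvg_cst].
move=> s; rewrite /= in_itv /= => se.
have [Vs -> D1 D2] := H1 (s - tau) ltac:(lra).
have [xp zp] := box_pos Vs.
have Ds : is_derive s (1 : R) (fun s : R => s - tau) 1.
  by rewrite -[X in is_derive _ _ _ X]subr0; apply: is_deriveB.
split=> //.
  by have := @is_derive1_comp R x (fun s => s - tau) s _ _ D1 Ds; rewrite mulr1.
by have := @is_derive1_comp R z (fun s => s - tau) s _ _ D2 Ds; rewrite mulr1.
Qed.

Let T_decay J gam a b : T J gam -> J a -> J b -> a <= b ->
  V (gam b).1 (eps * (gam b).2) < dl ^+ 2 ->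
  V (gam a).1 (eps * (gam a).2) <= V (gam b).1 (eps * (gam b).2) * expR (a - b).
Proof.
move=> /T_solution[_ Ji _ H] Ja Jb ab Vb.
apply: (@V_decay (fun s => (gam s).1) (fun s => eps * (gam s).2) _ _ a b ab _ Vb).2.
by move=> s sab; have [_ [D1 D2]] := H s (Ji _ _ Ja Jb _ sab); split; [exact: D1|exact: D2|].
Qed.

Let reversed_decay J gam s : time_reversed T J gam -> J s -> 0 <= s ->
  V (gam 0).1 (eps * (gam 0).2) < dl ^+ 2 ->
  V (gam s).1 (eps * (gam s).2) <= V (gam 0).1 (eps * (gam 0).2) * expR (- s).
Proof.
move=> TJ Js s0 V0; have [_ _ J0 _] := T_solution TJ.
have Js' : [set - s | s in J] (- s) by exists s.
have s0' : - s <= 0 by rewrite oppr_le0.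
by have := T_decay TJ Js' J0 s0'; rewrite opprK oppr0 addr0; apply.
Qed.

Let ball_box d (Q : R * R) : ball (p, eps * q) d Q -> `|Q.1 - p| < d /\ `|eps * Q.2 - q| < d.
Proof.
case=> /= h1 h2; split; first by rewrite distrC.
have -> : eps * Q.2 - q = eps * (Q.2 - eps * q) by rewrite mulrBr mulrA eps2 mul1r.
by rewrite normrM eps_norm mul1r distrC.
Qed.

Let box_ball d (Q : R * R) : `|Q.1 - p| < d -> `|eps * Q.2 - q| < d -> ball (p, eps * q) d Q.
Proof.
move=> h1 h2; split; rewrite /ball /= distrC //.
have -> : Q.2 - eps * q = eps * (eps * Q.2 - q) by rewrite mulrBr mulrA eps2 mul1r.
by rewrite normrM eps_norm mul1r.
Qed.

(** V < d^2 confines the trajectory to the ball of radius d, and the ball of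
    radius d / 6 lies in this sublevel set. *)
Lemma repelling_stable : stable (time_reversed T) (p, eps * q).
Proof.
move=> e e0; have m0 : 0 < Num.min dl e by rewrite lt_min dl0.
exists (Num.min dl e / 6); first by rewrite divr_gt0.
move=> J gam TJ /ball_box[bx bz] s Js s0.
have V0 := V_lt_ball bx bz.
have V0e : V (gam 0).1 (eps * (gam 0).2) < e ^+ 2.
  apply: (lt_le_trans V0); rewrite ler_pXn2r ?nnegrE ?(ltW m0) ?(ltW e0) //.
  by rewrite ge_min lexx orbT.
have V0d : V (gam 0).1 (eps * (gam 0).2) < dl ^+ 2.
  apply: (lt_le_trans V0); rewrite ler_pXn2r ?nnegrE ?(ltW m0) ?(ltW dl0) //.
  by rewrite ge_min lexx.
have H := reversed_decay TJ Js s0 V0d.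
have E1 : expR (- s) <= 1 by rewrite -expR0 ler_expR oppr_le0.
have [|] := @V_lt (gam s).1 (eps * (gam s).2) e e0.
  apply: le_lt_trans V0e; apply: (le_trans H).
  by rewrite ler_piMr // V_ge0.
exact: box_ball.
Qed.

Lemma repelling_source : source T (p, eps * q).
Proof.
split; first exact: repelling_stable.
exists (dl / 6); first by rewrite divr_gt0.
move=> Q /ball_box[bx bz]; have V0 := V_lt_ball bx bz; split.
  have [x [z [e [x0 z0 e0 HT _]]]] := backward_T V0.
  exists `]- e, +oo[%classic, (fun s => (x (- s), eps * z (- s))); split.
  - have := HT 0 (lexx _); rewrite /time_reversed addr0.
    have -> : [set - s | s in `]- e, +oo[%classic] = `]-oo, e[%classic.
      apply/seteqP; split=> [_ [s + <-]|s]; rewrite /= !in_itv /= ?andbT; first by lra.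
      by move=> se; exists (- s); rewrite ?opprK //= in_itv /= andbT; lra.
    by congr T; apply/funext => s; rewrite subr0 opprK.
  - by rewrite oppr0 x0 z0 mulrA eps2 mul1r; case: Q {bx bz V0 x0 z0}.
  - by move=> s; rewrite /= !in_itv /= !andbT; lra.
move=> J gam TJ g0 sJ.
have dec s : 0 <= s -> V (gam s).1 (eps * (gam s).2) <= V Q.1 (eps * Q.2) * expR (- s).
  move=> s0; rewrite -g0; apply: (reversed_decay TJ) => //; last by rewrite g0.
  by apply: sJ; rewrite /= in_itv /= s0.
apply/cvg_ballP => e e0; near=> s.
have s0 : 0 <= s by near: s; exact: nbhs_pinfty_ge.
have [|] := @V_lt (gam s).1 (eps * (gam s).2) e e0; last exact: box_ball.
apply: (le_lt_trans (dec s s0)).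
apply: expR_decay_lt => //; near: s; apply: nbhs_pinfty_ge; exact: num_real.
Unshelve. all: by end_near. Qed.

(** The trajectory through a point at a fixed distance has been arbitrarily close to
    the critical point; shifting time makes it start there. *)
Lemma repelling_unstable : unstable T (p, eps * q).
Proof.
move=> /(_ (dl / 12)) [|d d0 H]; first by rewrite divr_gt0.
have V0 : V (p + dl / 12) q < dl ^+ 2.
  by apply: V_lt_ball; rewrite ?subrr ?normr0 ?divr_gt0 // [p + _]addrC addrK gtr0_norm ?divr_gt0 //; have := dl0; lra.
have [x [z [e [x0 z0 e0 HT dec]]]] := backward_T V0.
(* As S < e^S, the value of V at time -S is at most S d^2 e^(-S) < d^2. *)
pose S := V (p + dl / 12) q / d ^+ 2.
have S0 : 0 <= S by rewrite divr_ge0 // exprn_ge0 // ltW.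
have := H _ _ (HT S S0) _ S _ S0; rewrite subrr sub0r x0 z0.
case.
- have [|] := @V_lt (x (- S)) (z (- S)) d d0; last first.
    by move=> h1 h2; apply: box_ball => //=; rewrite mulrA eps2 mul1r.
  apply: (le_lt_trans (dec (- S) _)); first by rewrite oppr_le0.
  exact: expR_decay_lt.
- by rewrite /= in_itv /=; lra.
rewrite /ball /= => + _; rewrite opprD addrA subrr sub0r normrN gtr0_norm ?divr_gt0 //.
by rewrite ltxx.
Qed.

(** Once the trajectory stays where V is small, V is nondecreasing, so that it
    can tend to 0 only if it vanishes already; the backward estimate carries the
    zero back to time 0. *)
Lemma repelling_not_reached J gam : T J gam ->
  (forall W, nbhs (p, eps * q) W -> exists2 s0, J s0 & forall s, J s -> s0 <= s -> W (gam s)) ->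
  gam 0 = (p, eps * q).
Proof.
move=> TJ H; have [_ _ J0 _] := T_solution TJ.
pose v s := V (gam s).1 (eps * (gam s).2).
have small r : 0 < r -> exists2 s0, J s0 & forall s, J s -> s0 <= s -> v s < r.
  move=> r0; pose d := Num.sqrt r / 6.
  have d0 : 0 < d by rewrite divr_gt0 // sqrtr_gt0.
  have [s0 Js0 Hs] := H _ (nbhsx_ballx (p, eps * q) d d0).
  exists s0 => // s Js s0s; have /ball_box[h1 h2] := Hs s Js s0s.
  by rewrite -(@sqr_sqrtr _ r (ltW r0)); exact: V_lt_ball.
have maxJ a b : J a -> J b -> J (Num.max a b) by move=> ? ?; case: leP.
have [s0 Js0 Hs0] := small (dl ^+ 2) ltac:(by rewrite exprn_gt0).
pose s1 := Num.max s0 0.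
have Js1 : J s1 by exact: maxJ.
have s01 : s0 <= s1 by rewrite le_max lexx.
have v1 : v s1 <= 0.
  rewrite leNgt; apply/negP => v1; have [s2 Js2 Hs2] := small _ v1.
  pose s3 := Num.max s1 s2; have Js3 : J s3 by exact: maxJ.
  have s13 : s1 <= s3 by rewrite le_max lexx.
  have s23 : s2 <= s3 by rewrite le_max lexx orbT.
  have := Hs2 _ Js3 s23; have := T_decay TJ Js1 Js3 s13 (Hs0 _ Js3 (le_trans s01 s13)).
  rewrite -/(v s1) -/(v s3) => h1 h2.
  have : expR (s1 - s3) <= 1 by rewrite -expR0 ler_expR subr_le0.
  have : 0 <= v s3 by exact: V_ge0.
  by have := expR_ge0 (s1 - s3); nra.
have s10 : 0 <= s1 by rewrite le_max lexx orbT.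
have := T_decay TJ J0 Js1 s10 (Hs0 _ Js1 s01); rewrite -/(v s1) -/(v 0) => v0.
have {}v0 : v 0 <= 0.
  by apply: (le_trans v0); rewrite mulr_le0_ge0 // expR_ge0.
have [g1 g2] := V_eq0 v0.
by rewrite [gam 0]surjective_pairing g1 -g2 mulrA eps2 mul1r.
Qed.

End Repelling.

End PlanarSystem.

(** * From the flow of (a, b, c) to the planar system and back *)

Section Reparametrization.
Variable R : realType.
Implicit Types (J : set R) (f g df dg : R -> R).

Lemma is_derive_div f g t (df dg : R) : is_derive t (1 : R) f df -> is_derive t (1 : R) g dg ->
  g t != 0 -> is_derive t (1 : R) (fun t => f t / g t) ((df * g t - f t * dg) / g t ^+ 2).
Proof.
move=> Df Dg g0; have Dv : is_derive t (1 : R) (fun y => (g y)^-1) (- (g t) ^- 2 *: dg).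
  exact: is_deriveV.
apply: is_derive_eq (is_deriveM Df Dv) _; rewrite /GRing.scale /=; field; exact: g0.
Qed.

Lemma is_derive_open_eq f g t (d : R) J : open J -> J t -> (forall s, J s -> f s = g s) ->
  is_derive t (1 : R) f d -> is_derive t (1 : R) g d.
Proof.
move=> oJ Jt fg; apply: near_eq_is_derive.
have : \forall s \near t, J s by exact: (oJ t Jt).
by apply: filterS => s /fg ->.
Qed.

(** f is injective on J by the mean value theorem, so that it has an inverse on
    all of f(J); this image is open because the inverse is continuous, and an
    interval by the intermediate value theorem. *)
Lemma increasing_reparametrization f df J : open J -> is_interval J ->
  (forall t, J t -> is_derive t (1 : R) f (df t) /\ 0 < df t) ->
  exists g, [/\ forall t, J t -> g (f t) = t, open (f @` J), is_interval (f @` J) &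
    forall t, J t -> is_derive (f t) (1 : R) g (df t)^-1].
Proof.
move=> oJ iJ D.
have mono s t : J s -> J t -> s < t -> f s < f t.
  move=> Js Jt st; apply: (@derive_gt0_lt _ f df) => // r rst.
    exact: (D r (iJ _ _ Js Jt _ rst)).1.
  exact: (D r (iJ _ _ Js Jt _ rst)).2.
have inj s t : J s -> J t -> f s = f t -> s = t.
  move=> Js Jt E; have [st|ts|//] := ltgtP s t.
    by have := mono _ _ Js Jt st; rewrite E ltxx.
  by have := mono _ _ Jt Js ts; rewrite E ltxx.
have /choice[g Hg] : forall y, exists t, (exists2 r, J r & f r = y) -> J t /\ f t = y.
  move=> y; have [[r Jr fr]|n] := pselect (exists2 r, J r & f r = y); first by exists r.
  by exists 0.
have gK t : J t -> g (f t) = t.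
  by move=> Jt; have [Jg fg] := Hg (f t) (ex_intro2 _ _ t Jt erefl); exact: inj.
have near_J t : J t -> \forall s \near t, J s by move=> Jt; exact: (oJ t Jt).
have near_gK t : J t -> {near t, cancel f g}.
  by move=> Jt; apply: filterS (near_J t Jt) => s; exact: gK.
have near_cf t : J t -> {near t, continuous f}.
  move=> Jt; apply: filterS (near_J t Jt) => s Js.
  exact: is_derive_continuous (D s Js).1.
exists g; split=> //.
- move=> _ [t Jt <-].
  have cg : {for f t, continuous g} by exact: nbhs_singleton (near_can_continuous (near_gK t Jt) (near_cf t Jt)).
  have fgK := near_continuous_can_sym (near_cf t Jt) (near_gK t Jt).
  have Jg : \forall y \near f t, J (g y) by apply: cg; rewrite gK //; exact: near_J.
  by apply: filterS2 fgK Jg => y E Jgy; exists (g y).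
- move=> _ _ [t1 J1 <-] [t2 J2 <-] y /andP[y1 y2].
  have [t12|/(mono _ _ J2 J1)] := leP t1 t2; last by move: y1 y2; lra.
  have J12 t : t1 <= t <= t2 -> J t by exact: iJ.
  have cf : {within `[t1, t2], continuous f}.
    by apply: within_continuous_derive => t /J12 Jt; exact: (D t Jt).1.
  have [|t] := IVT t12 cf (v := y).
    by rewrite ge_min le_max y1 y2 orbT.
  by rewrite in_itv /= => /J12 Jt <-; exists t.
move=> t Jt; apply: is_derive_inverse; [exact: near_gK|exact: near_cf|exact: (D t Jt).1|].
by rewrite gt_eqF // (D t Jt).2.
Qed.

End Reparametrization.

Section FamilyFlow.
Variable R : realType.
Implicit Types (a b c : R).

(** The coefficients of * d phi and, in [lap1], [lap2], [lap3], of the Laplacian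
    of phi; b stands for eps b. *)
Definition star1 a b c : R := 2 * (4 * (a * c ^+ 2) + 2 * (b * c ^+ 2)) * (a ^+ 2 * b) / c ^+ 4.
Definition star2 a b c : R := - ((- 2 * (a ^+ 2 * b) - 2 * (b * c ^+ 2)) / b).
Definition star3 a b c : R :=
  - ((- 2 * (a ^+ 2 * b) - 4 * (a * c ^+ 2) + 2 * (b * c ^+ 2)) * b / a ^+ 2).
Definition lap1 a b c : R := 2 * (4 * star2 a b c + 2 * star3 a b c) * (a ^+ 2 * b) / c ^+ 4.
Definition lap2 a b c : R := - ((- 2 * star1 a b c - 2 * star3 a b c) / b).
Definition lap3 a b c : R :=
  - ((- 2 * star1 a b c - 4 * star2 a b c + 2 * star3 a b c) * b / a ^+ 2).

Definition family_flow (eps : R) (J : set R) (a b c : R -> R) := forall t, J t ->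
  [/\ is_derive t (1 : R) (fun r => a r ^+ 2 * (eps * b r)) (lap1 (a t) (eps * b t) (c t)),
      is_derive t (1 : R) (fun r => a r * c r ^+ 2) (lap2 (a t) (eps * b t) (c t)) &
      is_derive t (1 : R) (fun r => eps * b r * c r ^+ 2) (lap3 (a t) (eps * b t) (c t))].

(** The quotient rule for X = u / w and Z = u / v; the factor c^2 is dt / ds. *)
Lemma family_flow_rates a b c : a != 0 -> b != 0 -> c != 0 ->
  let u := a ^+ 2 * b in let v := a * c ^+ 2 in let w := b * c ^+ 2 in
  (lap1 a b c * w - u * lap3 a b c) / w ^+ 2 * c ^+ 2 = rate_X (a ^+ 2 / c ^+ 2) (a * b / c ^+ 2) /\
  (lap1 a b c * v - u * lap2 a b c) / v ^+ 2 * c ^+ 2 = rate_Z (a ^+ 2 / c ^+ 2) (a * b / c ^+ 2).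
Proof.
move=> a0 b0 c0 u v w; rewrite /u /v /w /rate_X /rate_Z /lap1 /lap2 /lap3 /star1 /star2 /star3.
by split; field; rewrite a0 b0 c0.
Qed.

(** With a = c y and b = c z / y one has X = y^2 and Z = z, and
    u = c^3 y z, v = c^3 y, w = c^3 z / y.  Here k is c' / c with respect to s, and
    the identities say that u, v, w evolve by the Laplacian. *)
Lemma family_flow_lift c y z : c != 0 -> y != 0 -> z != 0 ->
  let k := rate_c (y ^+ 2) z in let y' := rate_X (y ^+ 2) z / (2 * y) in
  let z' := rate_Z (y ^+ 2) z in
  [/\ 3 * c ^+ 3 * k * y * z + c ^+ 3 * y' * z + c ^+ 3 * y * z' = lap1 (c * y) (c * z / y) c * c ^+ 2,
   3 * c ^+ 3 * k * y + c ^+ 3 * y' = lap2 (c * y) (c * z / y) c * c ^+ 2 &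
   (3 * c ^+ 3 * k * z + c ^+ 3 * z') / y - c ^+ 3 * z * y' / y ^+ 2 = lap3 (c * y) (c * z / y) c * c ^+ 2].
Proof.
move=> c0 y0 z0; rewrite /= /rate_X /rate_Z /rate_c /lap1 /lap2 /lap3 /star1 /star2 /star3.
by split; field; rewrite c0 y0 ?z0.
Qed.

Lemma ratio_wu a b c : b != 0 -> c != 0 -> a ^+ 2 * b / (b * c ^+ 2) = a ^+ 2 / c ^+ 2.
Proof. by move=> b0 c0; field; rewrite b0 c0. Qed.

Lemma ratio_vu a b c : a != 0 -> c != 0 -> a ^+ 2 * b / (a * c ^+ 2) = a * b / c ^+ 2.
Proof. by move=> a0 c0; field; rewrite a0 c0. Qed.

Variable eps : R.
Hypothesis eps2 : eps * eps = 1.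

Let eps0 : eps != 0.
Proof. by apply: contra_eq_neq eps2 => ->; rewrite mul0r eq_sym oner_eq0. Qed.

(** The time s is a strictly increasing function of t, so its inverse turns
    the equations for (u, v, w) into the planar system. *)
Lemma rescaled_family_flow (J J' : set R) (a b c s : R -> R) (gam : R -> R * R) :
  open J -> is_interval J -> J 0 -> (forall t, J t -> [/\ 0 < a t, 0 < b t & 0 < c t]) ->
  family_flow eps J a b c -> s 0 = 0 -> s @` J = J' ->
  (forall t, J t -> is_derive t (1 : R) s (c t ^+ 2)^-1 /\ gam (s t) = XY (a t) (b t) (c t)) ->
  [/\ open J', is_interval J', J' 0 &
  forall r, J' r -> 0 < (gam r).1 /\
    is_derive r (1 : R) (fun r => (gam r).1) (rate_X (gam r).1 (eps * (gam r).2)) /\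
    is_derive r (1 : R) (fun r => eps * (gam r).2) (rate_Z (gam r).1 (eps * (gam r).2))].
Proof.
move=> oJ iJ J0 pos flow s0 sJ Hs.
have [g [gK oJ' iJ' Dg]] : exists g, [/\ forall t, J t -> g (s t) = t, open (s @` J),
    is_interval (s @` J) & forall t, J t -> is_derive (s t) (1 : R) g ((c t ^+ 2)^-1)^-1].
  apply: increasing_reparametrization => // t Jt; split; first exact: (Hs t Jt).1.
  by have [_ _ ct] := pos t Jt; rewrite invr_gt0 exprn_gt0.
rewrite -sJ; split=> //; first by exists 0.
move=> _ [t Jt <-]; have [_ gt] := Hs t Jt; rewrite gt /=.
have [at0 bt0 ct0] := pos t Jt; have [D1 D2 D3] := flow t Jt.
have nz r : J r -> [/\ a r != 0, eps * b r != 0 & c r != 0].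
  move=> /pos[p1 p2 p3].
  by split; [exact: lt0r_neq0|apply: mulf_neq0 => //; exact: lt0r_neq0|exact: lt0r_neq0].
have [an bn cn] := nz t Jt.
have [r1 r2] := family_flow_rates an bn cn.
have eab r : eps * (a r * b r / c r ^+ 2) = a r * (eps * b r) / c r ^+ 2 by ring.
have DX : is_derive t (1 : R) (fun r => a r ^+ 2 / c r ^+ 2)
   (rate_X (a t ^+ 2 / c t ^+ 2) (a t * (eps * b t) / c t ^+ 2) / c t ^+ 2).
  rewrite -r1 mulfK ?expf_neq0 //.
  have n0 : eps * b t * c t ^+ 2 != 0 by rewrite mulf_neq0 ?expf_neq0.
  apply: (is_derive_open_eq oJ Jt _ (is_derive_div D1 D3 n0)).
  by move=> r /nz[ar br cr]; exact: ratio_wu.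
have DZ : is_derive t (1 : R) (fun r => a r * (eps * b r) / c r ^+ 2)
   (rate_Z (a t ^+ 2 / c t ^+ 2) (a t * (eps * b t) / c t ^+ 2) / c t ^+ 2).
  rewrite -r2 mulfK ?expf_neq0 //.
  have n0 : a t * c t ^+ 2 != 0 by rewrite mulf_neq0 ?expf_neq0.
  apply: (is_derive_open_eq oJ Jt _ (is_derive_div D1 D2 n0)).
  by move=> r /nz[ar br cr]; exact: ratio_vu.
rewrite eab; have Dgt := Dg t Jt; rewrite invrK in Dgt.
have Jst : (s @` J) (s t) by exists t.
split; first by rewrite divr_gt0 // exprn_gt0.
split.
  apply: (@is_derive_open_eq _ ((fun r => a r ^+ 2 / c r ^+ 2) \o g) _ _ _ _ oJ' Jst).
    by move=> _ [r Jr <-]; rewrite /= gK // (Hs r Jr).2.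
  rewrite -[X in is_derive _ _ _ X](@divfK _ (c t ^+ 2)) ?expf_neq0 //.
  by apply: is_derive1_comp; rewrite gK.
apply: (@is_derive_open_eq _ ((fun r => a r * (eps * b r) / c r ^+ 2) \o g) _ _ _ _ oJ' Jst).
  by move=> _ [r Jr <-]; rewrite /= gK // (Hs r Jr).2 /= eab.
rewrite -[X in is_derive _ _ _ X](@divfK _ (c t ^+ 2)) ?expf_neq0 //.
by apply: is_derive1_comp; rewrite gK.
Qed.

(** Integrating rate_c along the solution gives log c as a function of s, and
    integrating c^2 gives t; both are defined for all s since k is. *)
Lemma family_flow_exists (J' : set R) (x z k : R -> R) : open J' -> is_interval J' -> J' 0 ->
  continuous k ->
  (forall s, J' s -> [/\ 0 < x s, 0 < eps * z s, k s = rate_c (x s) (z s),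
    is_derive s (1 : R) x (rate_X (x s) (z s)) & is_derive s (1 : R) z (rate_Z (x s) (z s))]) ->
  exists (J : set R) (a b c s : R -> R),
  [/\ [/\ open J, is_interval J & J 0], forall t, J t -> [/\ 0 < a t, 0 < b t & 0 < c t],
   family_flow eps J a b c, s 0 = 0 /\ s @` J = J' &
   forall t, J t -> is_derive t (1 : R) s (c t ^+ 2)^-1 /\
     (x (s t), eps * z (s t)) = XY (a t) (b t) (c t)].
Proof.
move=> oJ' iJ' J'0 ck H.
have [K [K0 DK]] := primitive_exists ck.
pose C s := expR (K s); have C0 s : 0 < C s by exact: expR_gt0.
have DC s : is_derive s (1 : R) C (C s * k s) by exact: is_derive1_comp (DK s).
have DC2 s : is_derive s (1 : R) (fun s => C s ^+ 2) (2 * C s * (C s * k s)).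
  have -> : (fun s => C s ^+ 2) = (C * C)%R by apply/funext => r; rewrite !fctE expr2.
  by apply: is_derive_eq (is_deriveM (DC s) (DC s)) _; rewrite /GRing.scale /=; ring.
have [tau [tau0 Dtau]] : exists tau : R -> R, tau 0 = 0 /\
    forall s, is_derive s (1 : R) tau (C s ^+ 2).
  apply: primitive_exists => s; exact: is_derive_continuous (DC2 s).
have [g [gK oJ iJ Dg]] : exists g, [/\ forall s, J' s -> g (tau s) = s, open (tau @` J'),
    is_interval (tau @` J') & forall s, J' s -> is_derive (tau s) (1 : R) g (C s ^+ 2)^-1].
  by apply: increasing_reparametrization => // s _; split; rewrite ?exprn_gt0.
pose y s := Num.sqrt (x s).
have ypos s : J' s -> 0 < y s by move=> /H[? _ _ _ _]; rewrite sqrtr_gt0.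
have y2 s : J' s -> y s ^+ 2 = x s by move=> /H[/ltW ? _ _ _ _]; rewrite sqr_sqrtr.
have znz s : J' s -> z s != 0.
  by move=> /H[_ + _ _ _]; apply: contraTneq => ->; rewrite mulr0 ltxx.
have Dy s : J' s -> is_derive s (1 : R) y (rate_X (y s ^+ 2) (z s) / (2 * y s)).
  move=> Js; have [xp _ _ Dx _] := H s Js; rewrite y2 // mulrC.
  by apply: is_derive1_comp Dx; exact: is_derive1_sqrt.
exists (tau @` J'), (fun t => C (g t) * y (g t)), (fun t => C (g t) * (eps * z (g t)) / y (g t)),
  (fun t => C (g t)), g; split.
- by split=> //; exists 0.
- move=> _ [s Js <-]; rewrite gK //; have [_ zp _ _ _] := H s Js.
  have yp := ypos s Js; have Cp := C0 (s : R).
  by split; [exact: mulr_gt0|apply: divr_gt0 => //; exact: mulr_gt0|].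
- move=> _ [s Js <-] /=; rewrite gK //.
  have [xp zp kE Dx Dz] := H s Js; have cn := lt0r_neq0 (C0 s).
  have yn := lt0r_neq0 (ypos s Js); have zn := znz s Js.
  have eE r : eps * (C r * (eps * z r) / y r) = C r * z r / y r.
    by rewrite -[in RHS](mul1r (z r)) -eps2; ring.
  rewrite eE; have [l1 l2 l3] := family_flow_lift cn yn zn.
  rewrite y2 // -kE in l1 l2 l3.
  have Dys := Dy s Js; rewrite y2 // in Dys.
  have DC3 : is_derive s (1 : R) (fun s => C s ^+ 3) (3 * C s ^+ 3 * k s).
    have -> : (fun s => C s ^+ 3) = (C * (fun s => C s ^+ 2))%R.
      by apply/funext => r; rewrite !fctE exprS.
    by apply: is_derive_eq (is_deriveM (DC s) (DC2 s)) _; rewrite /GRing.scale /=; ring.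
  have comp (F : R -> R) (L : R) (f : R -> R) :
      is_derive s (1 : R) F (L * C s ^+ 2) -> (forall r, J' r -> F r = f r) ->
      is_derive (tau s) (1 : R) (fun t => f (g t)) L.
    move=> DF Ff; have -> : L = L * C s ^+ 2 * (C s ^+ 2)^-1 by rewrite mulfK ?expf_neq0.
    apply: (@is_derive1_comp _ f g); last exact: Dg.
    by rewrite gK //; apply: (is_derive_open_eq oJ' Js) DF.
  split.
  + apply: (comp (fun r => C r ^+ 3 * y r * z r) _
      (fun r => (C r * y r) ^+ 2 * (eps * (C r * (eps * z r) / y r)))).
      rewrite -l1; apply: is_derive_eq (is_deriveM (is_deriveM DC3 Dys) Dz) _.
      by rewrite ?fctE /GRing.scale /=; ring.
    by move=> r Jr; rewrite eE; have yr := lt0r_neq0 (ypos r Jr); field.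
  + apply: (comp (fun r => C r ^+ 3 * y r) _ (fun r => C r * y r * C r ^+ 2)).
      rewrite -l2; apply: is_derive_eq (is_deriveM DC3 Dys) _.
      by rewrite ?fctE /GRing.scale /=; ring.
    by move=> r Jr; ring.
  + apply: (comp (fun r => (C r ^+ 3 * z r) / y r) _
      (fun r => eps * (C r * (eps * z r) / y r) * C r ^+ 2)).
      rewrite -l3; apply: is_derive_eq (is_derive_div (is_deriveM DC3 Dz) Dys yn) _.
      rewrite ?fctE /GRing.scale /=; move: (rate_X _ _) (rate_Z _ _) => p q.
      by rewrite -(y2 s Js); field.
    by move=> r Jr; rewrite eE; ring.
- split; first by rewrite -{1}tau0 gK.
  by apply/seteqP; split=> [_ [_ [s Js <-] <-]|s Js]; [rewrite gK|exists (tau s); [exists s|rewrite gK]].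
move=> _ [s Js <-]; rewrite gK //; split; first exact: Dg.
have cn := lt0r_neq0 (C0 s); have yn := lt0r_neq0 (ypos s Js).
by rewrite /XY -(y2 s Js); congr pair; field; rewrite ?cn ?yn.
Qed.

End FamilyFlow.

(** * The families on the manifold *)

Section Global.
Variables (R : realType) (M : manifold7 R).
Variables (g : chart M -> 'rV[R]_7 -> 'M[R]_7) (E : 'I_3 -> chart M -> 'rV[R]_7 -> 'rV[R]_7).
Hypothesis HM : three_sasakian g E.
Variable eps : R.
Hypothesis eps2 : eps * eps = 1.

Local Notation F i := (fun l => E l i).

Let oU i : open (img (M := M) i). Proof. exact: img_open. Qed.
Let sG i : smooth_on (img i) (g i). Proof. by case: HM => -[/(_ i)[]]. Qed.
Let rG i : riemannian_on (img i) (g i). Proof. by case: HM => -[/(_ i)[]]. Qed.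
Let sE i l : smooth_on (img i) (F i l). Proof. by case: HM => _ _ /(_ l)[/(_ i)]. Qed.
Let onE i x : img i x -> forall a b, ip (g i x) (F i a x) (F i b x) = (a == b)%:R.
Proof. by case: HM => _ _ _ /(_ i)[/(_ x)]. Qed.
Let lieE i x : img i x -> forall a, lie (F i a) (F i (a + 1)) x = 2 *: F i (a + 2) x.
Proof. by case: HM => _ _ _ /(_ i)[_ /(_ x)]. Qed.
Let kE i a : killing_on (img i) (g i) (F i a).
Proof. by case: HM => _ _ _ /(_ i)[_ _ /(_ a)]. Qed.
Let saE i a : sasakian_on (img i) (g i) (F i a).
Proof. by case: HM => _ _ _ /(_ i)[_ _ _ /(_ a)]. Qed.

Let local_laplacian i := laplacian_phi (@oU i) (@sG i) (@sE i) (@rG i) (@onE i) (@lieE i) (@kE i) (@saE i).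
Let local_extd i := extd_phi (@oU i) (@sG i) (@sE i) (@rG i) (@onE i) (@lieE i) (@kE i) (@saE i).
Let local_hodge i := hodge_phi (@oU i) (@sG i) (@sE i) (@rG i) (@onE i) (@lieE i) (@kE i) (@saE i).
Let local_metric i := g2_exists (@oU i) (@sG i) (@sE i) (@rG i) (@onE i) (@lieE i) (@kE i) (@saE i).
Let local_cubic i := cubic_coords (@oU i) (@sG i) (@sE i) (@rG i) (@onE i) (@lieE i) (@kE i) (@saE i).
Let local_quartic i := quartic_coords (@oU i) (@sG i) (@sE i) (@rG i) (@onE i) (@lieE i) (@kE i) (@saE i).

Let eps0 : eps != 0.
Proof. by apply: contra_eq_neq eps2 => ->; rewrite mul0r eq_sym oner_eq0. Qed.

Let some_point : exists i x, img (M := M) i x.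
Proof.
have [p _] := carrier_nonempty M; have [i ip] := dom_cover p.
by exists i, (crd i p), p.
Qed.

Let phiE a b c i : phi g E eps a b c i =
  cubic (g i) (F i) (a ^+ 2 * (eps * b)) (a * c ^+ 2) (eps * b * c ^+ 2).
Proof. exact: phi_local_cubic. Qed.

(** Chartwise existence is enough, as the induced metric is only asked for on
    each chart. *)
Let metric_exists a b c : 0 < a -> 0 < b -> 0 < c ->
  exists g' rho, g2_metric (phi g E eps a b c) g' rho.
Proof.
move=> a0 b0 c0.
have /choice[h Hh] : forall i : chart M, exists h : ('rV[R]_7 -> 'M[R]_7) * ('rV[R]_7 -> R),
    g2_induces (img i) (phi g E eps a b c i) h.1 h.2.
  move=> i; have [|||g' [rho H]] := @local_metric i a (eps * b) c; try exact: lt0r_neq0.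
    by rewrite mulf_neq0 // lt0r_neq0.
  by exists (g', rho); rewrite phiE.
by exists (fun i => (h i).1), (fun i => (h i).2).
Qed.

Lemma laplacian3_family a b c g' rho i x : 0 < a -> 0 < b -> 0 < c ->
  g2_metric (phi g E eps a b c) g' rho -> img i x ->
  laplacian3 (g' i) (rho i) (phi g E eps a b c i) x =
  cubic (g i) (F i) (lap1 a (eps * b) c) (lap2 a (eps * b) c) (lap3 a (eps * b) c) x.
Proof.
move=> a0 b0 c0 /(_ i); rewrite phiE => Hg Ux.
have b0' : eps * b != 0 by rewrite mulf_neq0 // lt0r_neq0.
exact: (local_laplacian (lt0r_neq0 a0) b0' (lt0r_neq0 c0) Hg Ux).
Qed.

(** Evaluating the flow equation on three fixed triples of vectors at one point
    separates the coefficients u, v, w. *)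
Lemma flow_in_family_flow J (a b c : R -> R) : flow_in_family g E eps J a b c ->
  family_flow eps J a b c.
Proof.
move=> [_ _ _ pos flow] t Jt; have [g' [rho [Hg D]]] := flow t Jt.
have [a0 b0 c0] := pos t Jt.
have [i [x Ux]] := some_point; have [v1 [v2 [v3 Hv]]] := local_cubic Ux.
have Dv v := D i x v Ux.
have D' v : is_derive t (1 : R) (fun r => cubic (g i) (F i) (a r ^+ 2 * (eps * b r))
     (a r * c r ^+ 2) (eps * b r * c r ^+ 2) x v)
   (cubic (g i) (F i) (lap1 (a t) (eps * b t) (c t)) (lap2 (a t) (eps * b t) (c t))
      (lap3 (a t) (eps * b t) (c t)) x v).
  rewrite -(laplacian3_family a0 b0 c0 Hg Ux).
  have -> : (fun r => cubic (g i) (F i) (a r ^+ 2 * (eps * b r)) (a r * c r ^+ 2)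
    (eps * b r * c r ^+ 2) x v) = (fun r => phi g E eps (a r) (b r) (c r) i x v).
    by apply/funext => r; rewrite phiE.
  exact: Dv.
move: (lap1 _ _ _) (lap2 _ _ _) (lap3 _ _ _) D' => l1 l2 l3 D'.
(* A definition that hides the type class is_derive from instance search. *)
pose is_d (f : R -> R) l := is_derive t (1 : R) f l.
have opp (f : R -> R) l : is_d (fun r => - f r) (- l) -> is_d f l.
  by move=> H; have := is_deriveN H; rewrite !opprK.
have Df v (f : R -> R) l : (forall r, cubic (g i) (F i) (a r ^+ 2 * (eps * b r)) (a r * c r ^+ 2)
    (eps * b r * c r ^+ 2) x v = f r) -> cubic (g i) (F i) l1 l2 l3 x v = l -> is_d f l.
  move=> Ef <-; have {1}-> : f = (fun r => cubic (g i) (F i) (a r ^+ 2 * (eps * b r))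
    (a r * c r ^+ 2) (eps * b r * c r ^+ 2) x v) by apply/funext => r; rewrite Ef.
  exact: D'.
clear Dv D D'; split; [apply: (Df v1)|apply: opp; apply: (Df v2)|apply: opp; apply: (Df v3)] => [r||r||r|].
- by have [-> _ _] := Hv (a r ^+ 2 * (eps * b r)) (a r * c r ^+ 2) (eps * b r * c r ^+ 2).
- by have [-> _ _] := Hv l1 l2 l3.
- by have [_ -> _] := Hv (a r ^+ 2 * (eps * b r)) (a r * c r ^+ 2) (eps * b r * c r ^+ 2).
- by have [_ -> _] := Hv l1 l2 l3.
- by have [_ _ ->] := Hv (a r ^+ 2 * (eps * b r)) (a r * c r ^+ 2) (eps * b r * c r ^+ 2).
- by have [_ _ ->] := Hv l1 l2 l3.
Qed.

Lemma family_flow_laplacian J (a b c : R -> R) :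
  (forall t, J t -> [/\ 0 < a t, 0 < b t & 0 < c t]) -> family_flow eps J a b c ->
  laplacian_flow J (fun t => phi g E eps (a t) (b t) (c t)).
Proof.
move=> pos flow t Jt; have [a0 b0 c0] := pos t Jt; have [D1 D2 D3] := flow t Jt.
have [g' [rho Hg]] := metric_exists a0 b0 c0; exists g', rho; split; [exact: Hg|move=> i x v Ux].
rewrite (laplacian3_family a0 b0 c0 Hg Ux).
have -> : (fun r => phi g E eps (a r) (b r) (c r) i x v) =
  (fun r => cubic (g i) (F i) (a r ^+ 2 * (eps * b r)) (a r * c r ^+ 2)
    (eps * b r * c r ^+ 2) x v).
  by apply/funext => r; rewrite phiE.
rewrite /cubic; have := is_deriveB (is_deriveB
  (is_deriveM D1 (is_derive_cst (eta123 (g i) (F i) x v) t 1))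
  (is_deriveM D2 (is_derive_cst (mixed3 (g i) (F i) 0 x v + mixed3 (g i) (F i) 1 x v) t 1)))
  (is_deriveM D3 (is_derive_cst (mixed3 (g i) (F i) 2 x v) t 1)).
by move=> /is_derive_eq; apply; rewrite /GRing.scale /=; ring.
Qed.

Lemma rescaled_flow_solution J gam : rescaled_flow g E eps J gam ->
  [/\ open J, is_interval J, J 0 &
  forall s, J s -> 0 < (gam s).1 /\
    is_derive s (1 : R) (fun s => (gam s).1) (rate_X (gam s).1 (eps * (gam s).2)) /\
    is_derive s (1 : R) (fun s => eps * (gam s).2) (rate_Z (gam s).1 (eps * (gam s).2))].
Proof.
move=> [I [a [b [c [fl [s [s0 sI Hs]]]]]]]; have [oI iI I0 pos _] := fl.
exact: (rescaled_family_flow eps2 oI iI I0 pos (flow_in_family_flow fl) s0 sI Hs).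
Qed.

Lemma solution_rescaled_flow (J : set R) (x z k : R -> R) : open J -> is_interval J -> J 0 ->
  continuous k ->
  (forall s, J s -> [/\ 0 < x s, 0 < eps * z s, k s = rate_c (x s) (z s),
    is_derive s (1 : R) x (rate_X (x s) (z s)) & is_derive s (1 : R) z (rate_Z (x s) (z s))]) ->
  rescaled_flow g E eps J (fun s => (x s, eps * z s)).
Proof.
move=> oJ iJ J0 ck H.
have [I [a [b [c [s [[oI iI I0] pos fl [s0 sI] Hs]]]]]] := family_flow_exists eps2 oJ iJ J0 ck H.
exists I, a, b, c; split; last by exists s.
by split=> //; exact: family_flow_laplacian.
Qed.

(** Comparing the coefficients of d phi and of psi. *)
Lemma nearly_parallel_familyP a b c : 0 < a -> 0 < b -> 0 < c ->
  let b' := eps * b in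
  nearly_parallel (phi g E eps a b c) <->
  exists2 lam, lam != 0 &
    [/\ 4 * (a * c ^+ 2) + 2 * (b' * c ^+ 2) = lam * c ^+ 4 / 2,
        2 * (a ^+ 2 * b') + 2 * (b' * c ^+ 2) = lam * (a * b' * c ^+ 2) &
        2 * (a ^+ 2 * b') + 4 * (a * c ^+ 2) - 2 * (b' * c ^+ 2) = lam * (a ^+ 2 * c ^+ 2)].
Proof.
move=> a0 b0 c0 b'.
have bn : b' != 0 by rewrite mulf_neq0 // lt0r_neq0.
have an := lt0r_neq0 a0; have cn := lt0r_neq0 c0.
have hodgeE g' rho i x : g2_metric (phi g E eps a b c) g' rho -> img i x ->
    hodge (k := 3) (l := 4) (g' i) (volform (rho i)) (phi g E eps a b c i) x =
    quartic (g i) (F i) (c ^+ 4 / 2) (- (a * b' * c ^+ 2)) (- (a ^+ 2 * c ^+ 2)) x.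
  by move=> /(_ i); rewrite phiE => Hg Ux; exact: (local_hodge an bn cn Hg Ux).
have extdE i x : img i x -> extd (phi g E eps a b c i) x =
    quartic (g i) (F i) (4 * (a * c ^+ 2) + 2 * (b' * c ^+ 2))
      (-2 * (a ^+ 2 * b') - 2 * (b' * c ^+ 2))
      (-2 * (a ^+ 2 * b') - 4 * (a * c ^+ 2) + 2 * (b' * c ^+ 2)) x.
  by move=> Ux; rewrite phiE; exact: local_extd.
split=> [[g' [rho [lam [Hg lam0 H]]]]|[lam lam0 [h1 h2 h3]]].
  exists lam => //; have [i [x Ux]] := some_point.
  have [v1 [v2 [v3 Hv]]] := local_quartic Ux.
  have {}H v := H i x v Ux; rewrite extdE // (hodgeE _ _ _ _ Hg Ux) in H.
  have := H v1; have := H v2; have := H v3.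
  have [-> -> ->] := Hv (4 * (a * c ^+ 2) + 2 * (b' * c ^+ 2))
      (-2 * (a ^+ 2 * b') - 2 * (b' * c ^+ 2))
      (-2 * (a ^+ 2 * b') - 4 * (a * c ^+ 2) + 2 * (b' * c ^+ 2)).
  have [-> -> ->] := Hv (c ^+ 4 / 2) (- (a * b' * c ^+ 2)) (- (a ^+ 2 * c ^+ 2)).
  by move=> e3 e2 e1; split; lra.
have [g' [rho Hg]] := metric_exists a0 b0 c0.
exists g', rho, lam; split=> // i x v Ux; rewrite extdE // (hodgeE _ _ _ _ Hg Ux) /quartic.
have -> : 4 * (a * c ^+ 2) + 2 * (b' * c ^+ 2) = lam * (c ^+ 4 / 2) by rewrite h1 mulrA.
have -> : -2 * (a ^+ 2 * b') - 2 * (b' * c ^+ 2) = lam * (- (a * b' * c ^+ 2)).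
  by rewrite mulrN -h2; ring.
have -> : -2 * (a ^+ 2 * b') - 4 * (a * c ^+ 2) + 2 * (b' * c ^+ 2) =
   lam * (- (a ^+ 2 * c ^+ 2)) by rewrite mulrN -h3; ring.
by rewrite !mulrDr !mulrA.
Qed.

(** The first equation gives lambda; the second then says
    c^2 = 3 a^2 + 2 eps a b, and with this the third one is a^2 = b^2. *)
Lemma nearly_parallel_shape a b c : 0 < a -> 0 < b -> 0 < c ->
  nearly_parallel (phi g E eps a b c) <-> b = a /\ c ^+ 2 = (3 + 2 * eps) * a ^+ 2.
Proof.
move=> a0 b0 c0; rewrite nearly_parallel_familyP //.
have an := lt0r_neq0 a0; have cn := lt0r_neq0 c0.
have bn : eps * b != 0 by rewrite mulf_neq0 // lt0r_neq0.
split=> [[lam lam0 [h1 h2 h3]]|[-> c2]].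
  have lamE : lam = (8 * a + 4 * (eps * b)) / c ^+ 2.
    apply: (@mulIf _ (c ^+ 4 / 2)); first by rewrite mulf_neq0 ?expf_neq0 ?invr_neq0.
    by rewrite [LHS]mulrA -h1; field.
  have c2 : c ^+ 2 = 3 * a ^+ 2 + 2 * (eps * (a * b)).
    apply: (@mulIf _ (2 * (eps * b))); first by rewrite mulf_neq0.
    have -> : c ^+ 2 * (2 * (eps * b)) = lam * (a * (eps * b) * c ^+ 2) - 2 * (a ^+ 2 * (eps * b)).
      by rewrite -h2; ring.
    by rewrite lamE; field.
  have k3 : 2 * (a ^+ 2 * (eps * b)) + 4 * (a * c ^+ 2) - 2 * (eps * b * c ^+ 2) =
      a ^+ 2 * (8 * a + 4 * (eps * b)).
    by rewrite h3 lamE; field.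
  have ab : a ^+ 2 = b ^+ 2.
    apply: (@mulfI _ (4 * a)); first by rewrite mulf_neq0.
    rewrite c2 in k3; apply/eqP; rewrite -subr_eq0; apply/eqP.
    have -> : b ^+ 2 = eps * eps * b ^+ 2 by rewrite eps2 mul1r.
    by move/eqP: k3; rewrite -subr_eq0 => /eqP k3; rewrite -[RHS]k3; ring.
  have {}ab : a = b by apply/eqP; rewrite -(@eqrXn2 _ 2) ?ltW // ab.
  by split=> //; rewrite c2 -ab; ring.
have en : 3 + 2 * eps != 0.
  by apply: contra_neq cn => e; apply/eqP; rewrite -sqrf_eq0 c2 e mul0r.
exists (4 * (2 + eps) * a / c ^+ 2).
  rewrite mulf_neq0 ?invr_neq0 ?expf_neq0 // mulf_neq0 // mulf_neq0 //.
  apply/eqP => e; have e2 : eps = - 2 by lra.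
  by move: eps2; rewrite e2; lra.
have e2 : eps ^+ 2 = 1 by rewrite expr2.
split.
- by field.
- rewrite c2; have -> : 4 * (2 + eps) * a / ((3 + 2 * eps) * a ^+ 2) *
     (a * (eps * a) * ((3 + 2 * eps) * a ^+ 2)) = 4 * (2 * eps + eps ^+ 2) * a ^+ 3.
    by field; rewrite ?en ?an.
  have -> : 2 * (a ^+ 2 * (eps * a)) + 2 * (eps * a * ((3 + 2 * eps) * a ^+ 2)) =
    (8 * eps + 4 * eps ^+ 2) * a ^+ 3 by ring.
  by ring.
- rewrite c2; have -> : 4 * (2 + eps) * a / ((3 + 2 * eps) * a ^+ 2) *
     (a ^+ 2 * ((3 + 2 * eps) * a ^+ 2)) = 4 * (2 + eps) * a ^+ 3.
    by field; rewrite ?en ?an.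
  have -> : 2 * (a ^+ 2 * (eps * a)) + 4 * (a * ((3 + 2 * eps) * a ^+ 2)) -
    2 * (eps * a * ((3 + 2 * eps) * a ^+ 2)) = (12 + 4 * eps - 4 * eps ^+ 2) * a ^+ 3 by ring.
  by rewrite e2; ring.
Qed.

End Global.

Section MainTheorem.
Variables (R : realType) (M : manifold7 R).
Variables (g : chart M -> 'rV[R]_7 -> 'M[R]_7) (E : 'I_3 -> chart M -> 'rV[R]_7 -> 'rV[R]_7).
Hypothesis HM : three_sasakian g E.

(** The common form of the two cases: the behaviour of the planar system near
    the critical point, and the fact that the critical point determines a : b : c. *)
Lemma unstable_source_criterion (a0 p q A B C eps : R) : eps * eps = 1 ->
  0 < a0 -> nearly_parallel_up_to_scale g E eps a0 a0 1 ->
  XY a0 a0 1 = (p, eps * q) -> 1 / 100 < p -> 1 / 100 < eps * q ->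
  (forall x z, (x - p) ^+ 2 + (z - q) ^+ 2
     <= A * (x - p) ^+ 2 + B * (x - p) * (z - q) + C * (z - q) ^+ 2
     <= 15 * ((x - p) ^+ 2 + (z - q) ^+ 2)) ->
  (forall x z, `|x - p| <= 1 / 100 -> `|z - q| <= 1 / 100 ->
     A * (x - p) ^+ 2 + B * (x - p) * (z - q) + C * (z - q) ^+ 2
     <= (2 * A * (x - p) + B * (z - q)) * rate_X x z
        + (B * (x - p) + 2 * C * (z - q)) * rate_Z x z) ->
  unstable_source g E eps a0 a0 1 /\ not_reached g E eps a0 a0 1.
Proof.
move=> eps2 a00 np XYE p0 q0 Vb Vg.
have T1 := rescaled_flow_solution HM eps2; have T2 := solution_rescaled_flow HM eps2.
split; first split.
- by rewrite XYE; exact: (repelling_source eps2 p0 q0 Vb Vg T1 T2).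
- by rewrite XYE; exact: (repelling_unstable eps2 p0 q0 Vb Vg T2).
move=> a b c pa pb pc nnp [J [al [be [ga [J' [gam [[fl Hs] [ea eb ec] lim]]]]]]].
apply: nnp; rewrite XYE in lim.
have TJ : rescaled_flow g E eps J' gam by exists J, al, be, ga.
have g0 := repelling_not_reached eps2 Vb Vg T1 TJ lim.
have [s [s0 _ Hst]] := Hs; have [_ _ J0 _ _] := fl.
have [_] := Hst 0 J0; rewrite s0 g0 ea eb ec -XYE /XY !expr1n !divr1 => -[X Y].
have cn := lt0r_neq0 pc; have c2 : 0 < c ^+ 2 by rewrite exprn_gt0.
have aE : a = c * a0.
  apply/eqP; rewrite -(@eqrXn2 _ 2) ?ltW // ?mulr_gt0 //; apply/eqP.
  by rewrite exprMn X; field.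
apply/np => //; exists c => //; split; rewrite ?mulr1 //.
apply: (@mulfI _ a); first exact: lt0r_neq0.
have -> : a * b = a0 ^+ 2 * c ^+ 2 by rewrite Y divfK // lt0r_neq0.
by rewrite aE; ring.
Qed.

End MainTheorem.

Lemma nearly_parallel_scaling (R : realType) (M : manifold7 R)
    (g : chart M -> 'rV[R]_7 -> 'M[R]_7) (E : 'I_3 -> chart M -> 'rV[R]_7 -> 'rV[R]_7)
    (eps a0 : R) : three_sasakian g E -> eps * eps = 1 -> 0 < a0 ->
  (3 + 2 * eps) * a0 ^+ 2 = 1 -> nearly_parallel_up_to_scale g E eps a0 a0 1.
Proof.
move=> HM eps2 a00 e a b c pa pb pc; rewrite (nearly_parallel_shape HM eps2) //.
split=> [[-> c2]|[k k0 [-> -> ->]]]; last first.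
  by split=> //; rewrite mulr1 exprMn mulrCA e mulr1.
have aE : a = c * a0.
  apply/eqP; rewrite -(@eqrXn2 _ 2) ?ltW // ?mulr_gt0 // exprMn c2.
  by rewrite mulrAC e mul1r.
by exists c => //; rewrite mulr1.
Qed.

Theorem theorem1p2 (R : realType) (M : manifold7 R)
    (g : chart M -> 'rV[R]_7 -> 'M[R]_7)
    (E : 'I_3 -> chart M -> 'rV[R]_7 -> 'rV[R]_7)
    (HM : three_sasakian g E) :
  let q : R := (Num.sqrt 5)^-1 in
  [/\ nearly_parallel_up_to_scale g E 1 q q 1 /\
      nearly_parallel_up_to_scale g E (-1) 1 1 1,
      unstable_source g E 1 q q 1 /\ unstable_source g E (-1) 1 1 1 &
      not_reached g E 1 q q 1 /\ not_reached g E (-1) 1 1 1].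
Proof.
move=> q.
have five : (0 : R) < 5 by [].
have q0 : 0 < q by rewrite invr_gt0 sqrtr_gt0.
have q2 : q ^+ 2 = 1 / 5 by rewrite exprVn sqr_sqrtr ?ltW // div1r.
have qq : q * q = 1 / 5 by rewrite -q2 expr2.
have np : nearly_parallel_up_to_scale g E 1 q q 1.
  by apply: nearly_parallel_scaling => //; rewrite ?q2; field.
have ts : nearly_parallel_up_to_scale g E (-1) 1 1 1.
  by apply: nearly_parallel_scaling => //; ring.
have [] : unstable_source g E 1 q q 1 /\ not_reached g E 1 q q 1.
  apply: (@unstable_source_criterion R M g E HM q (1 / 5) (1 / 5) 2 2 5) => //.
  - by rewrite mulr1.
  - by rewrite /XY q2 qq expr1n divr1 !mul1r.
  - lra.
  - lra.
  - by move=> x z; move: (x - 1 / 5) (z - 1 / 5) => {}x {}z; apply/andP; split; nra.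
  move=> x z hx hz; have := lyapunov_np hx hz.
  by rewrite ![1 / 5 + _]addrC !subrK; lra.
have [] : unstable_source g E (-1) 1 1 1 /\ not_reached g E (-1) 1 1 1.
  apply: (@unstable_source_criterion R M g E HM 1 1 (-1) 10 10 5) => //.
  - by rewrite mulrNN mulr1.
  - by rewrite /XY !expr1n mulr1 divr1 mulrNN mulr1.
  - lra.
  - lra.
  - move=> x z; move: (x - 1) (z - -1) => {}x {}z.
    have h1 : 0 <= (9 * x + 5 * z) ^+ 2 by exact: sqr_ge0.
    have h2 : 0 <= (x - z) ^+ 2 by exact: sqr_ge0.
    have h3 : 0 <= z ^+ 2 by exact: sqr_ge0.
    by apply/andP; split; nra.
  move=> x z hx hz; have := lyapunov_ts hx hz.
  by rewrite ![1 + _]addrC ![-1 + _]addrC !subrK; lra.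
by [].
Qed.
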